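(* Let $\mathbf{k}$ be a commutative ring with $1$, $V=\mathbf{k}^n$, $S=\mathbf{k}[x_1,\ldots,x_n]=S(V)$. Fix integers $d,r,r'\geq 1$, and let $R=S^{(d)}$, $M=S^{(\geq r,d)}$, $M'=S^{(\geq r',d)}$. Then for every $i\geq 1$, the $R$-module $\operatorname{Tor}_i^R(M,M')$ is annihilated by $R_+$, and as a module over $\mathbf{k}=R/R_+$ there is a $GL(V)$-isomorphism $$\operatorname{Tor}_i^R(M,M')\cong\mathbb{S}^{\sigma(r,d^i,r')}(V).$$
   Context: Let $x_1,\ldots,x_n$ be the $\mathbf{k}$-basis of $V$. $S=\bigoplus_j S_j$ has the standard grading, with $S_j=S^j(V)$ the $j$th symmetric power, and $GL(V)\cong GL_n(\mathbf{k})$ acts on $S$ by $\mathbf{k}$-algebra automorphisms extending its action on $V$. The $d$th Veronese subalgebra is $S^{(d)}=\bigoplus_{j\equiv 0 \bmod d}S_j$, and for $r\ge 0$, $S^{(\geq r,d)}=\bigoplus_{j\ge r,\ j\equiv r \bmod d}S_j$, an $S^{(d)}$-submodule of $S$. $R_+=S^{(\geq d,d)}$. $GL(V)$ acts on $\operatorname{Tor}$ by functoriality. Schur functors: for a finite diagram $D$ of cells (matrix-style coordinates, rows listed bottom-to-top $R_1,\dots,R_p$, columns listed left-to-right $C_1,\dots,C_c$), $\mathbb{S}^D(V)$ is the $GL(V)$-submodule of $S^{|R_1|}(V)\otimes_{\mathbf{k}}\cdots\otimes_{\mathbf{k}} S^{|R_p|}(V)$ that is the image of the composite $$\wedge^{|C_1|}(V)\otimes\cdots\otimes\wedge^{|C_c|}(V)\to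 V^{\otimes |D|}\to S^{|R_1|}(V)\otimes\cdots\otimes S^{|R_p|}(V),$$ where tensor positions of $V^{\otimes|D|}$ are indexed by cells of $D$, the first map is the tensor product over columns of the antisymmetrizations $v_1\wedge\cdots\wedge v_\ell\mapsto\sum_{w\in\mathfrak{S}_\ell}\operatorname{sgn}(w)\,v_{w(1)}\otimes\cdots\otimes v_{w(\ell)}$ (placed in the cells of that column from top to bottom), and the second map multiplies together the entries in each row. Ribbons: for a composition (sequence of positive integers) $\alpha=(\alpha_1,\ldots,\alpha_\ell)$, $\sigma(\alpha)$ is the ribbon skew diagram whose row sizes from bottom to top are $\alpha_1,\ldots,\alpha_\ell$, each row's rightmost cell lying in the same column as the leftmost cell of the row just above it, and no other column overlaps. $(r,d^i,r')$ denotes $(r,d,\ldots,d,r')$ with $i$ copies of $d$. *)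

(* Defs.v *)
From HB Require Import structures.
From mathcomp Require Import all_boot all_order all_fingroup all_algebra finmap.
From mathcomp Require Import boolp generic_quotient ring_quotient.
From mathcomp Require Import freeg mpoly.

Set Implicit Arguments.
Unset Strict Implicit.
Unset Printing Implicit Defensive.

Import GRing.Theory.
Local Open Scope ring_scope.
Local Open Scope quotient_scope.

Inductive span (R : comNzRingType) (M : lmodType R) (G : M -> Prop) : M -> Prop :=
| span0 : span G 0
| span_step a x y : G x -> span G y -> span G (a *: x + y).

Section Span.
Variables (R : comNzRingType) (M : lmodType R) (G : M -> Prop).

Lemma span_gen x : G x -> span G x.
Proof.
by move=> Gx; rewrite -[x]addr0 -[x]scale1r; apply: span_step => //; apply: span0.
Qed.

Lemma span_lin a x y : span G x -> span G y -> span G (a *: x + y).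
Proof.
move=> Gx; elim: Gx y => [|b u v Gu _ IH] y Gy; first by rewrite scaler0 add0r.
by rewrite scalerDr scalerA -addrA; apply: span_step => //; apply: IH.
Qed.

Definition span_pred (x : M) : bool := `[< span G x >].

Lemma span_pred_closed : submod_closed span_pred.
Proof.
split; first by apply/asboolP; apply: span0.
move=> a x y /asboolP Gx /asboolP Gy; apply/asboolP; exact: span_lin.
Qed.

HB.instance Definition _ :=
  GRing.isSubmodClosed.Build R M span_pred span_pred_closed.

Record spanm := Spanm { spanm_val :> M; _ : spanm_val \in span_pred }.
HB.instance Definition _ := [isSub for spanm_val].
HB.instance Definition _ := [Choice of spanm by <:].
HB.instance Definition _ := [SubChoice_isSubLmodule of spanm by <:].

(* M / span G *)
Definition quotm : Type := Quotient.quot (GRing.ZmodClosed.clone M span_pred _).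
HB.instance Definition _ := Choice.on quotm.
HB.instance Definition _ := GRing.Zmodule.on quotm.
HB.instance Definition _ := Quotient.on quotm.
HB.instance Definition _ := ZmodQuotient.on quotm.

Lemma quotm_eqP (x y : M) :
  reflect (span G (x - y)) (\pi_quotm x == \pi_quotm y).
Proof.
rewrite -[_ == _]/(x == y %[mod quotm]) -Quotient.idealrBE.
exact: asboolP.
Qed.

Definition quotm_scale (a : R) (x : quotm) : quotm := \pi_quotm (a *: repr x).

Lemma quotm_piZ a x : quotm_scale a (\pi_quotm x) = \pi_quotm (a *: x).
Proof.
apply/eqP/quotm_eqP; rewrite -scalerBr -[_ *: _]addr0.
apply: span_lin; last exact: span0.
by apply/quotm_eqP; rewrite reprK.
Qed.

Fact quotm_scaleA a b x :
  quotm_scale a (quotm_scale b x) = quotm_scale (a * b) x.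
Proof. by rewrite -[x]reprK (quotm_piZ b) !quotm_piZ scalerA. Qed.
Fact quotm_scale1 : left_id 1 quotm_scale.
Proof. by move=> x; rewrite -[x]reprK quotm_piZ scale1r. Qed.
Fact quotm_scaleDr : right_distributive quotm_scale +%R.
Proof.
move=> a x y; rewrite -[x]reprK -[y]reprK.
by rewrite -raddfD !quotm_piZ scalerDr raddfD.
Qed.
Fact quotm_scaleDl x : {morph quotm_scale^~ x : a b / a + b}.
Proof.
by move=> a b; rewrite -[x]reprK !quotm_piZ scalerDl raddfD.
Qed.
HB.instance Definition _ := GRing.Zmodule_isLmodule.Build R quotm
  quotm_scaleA quotm_scale1 quotm_scaleDr quotm_scaleDl.

Lemma quotm_pi_lin a (x y : M) :
  \pi_quotm (a *: x + y) = a *: (\pi_quotm x : quotm) + \pi_quotm y.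
Proof.
by rewrite [LHS]raddfD; congr (_ + _); apply/esym; exact: quotm_piZ.
Qed.

End Span.

(* Maps that are semilinear along th : R -> R' are {linear _ -> _ | th \; *:%R}. *)
Section Semilinear.
Variables (R R' : comNzRingType) (th : {rmorphism R -> R'}).
Variables (M : lmodType R) (M' : lmodType R').
Variable f : {linear M -> M' | th \; *:%R}.

Lemma semilinZ a x : f (a *: x) = th a *: f x.
Proof. exact: (linearZ_LR f). Qed.

Lemma semilin a x y : f (a *: x + y) = th a *: f x + f y.
Proof. by rewrite -semilinZ; apply: raddfD. Qed.

Lemma semilinB x y : f (x - y) = f x - f y.
Proof. exact: raddfB. Qed.

End Semilinear.

Section QuotientMap.
Variables (R R' : comNzRingType) (th : {rmorphism R -> R'}).
Variables (M : lmodType R) (M' : lmodType R').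
Variables (G : M -> Prop) (G' : M' -> Prop).
Variable f : {linear M -> M' | th \; *:%R}.

Definition quot_map (x : quotm G) : quotm G' := \pi_(quotm G') (f (repr x)).

Hypothesis fG : forall x, G x -> span G' (f x).

Lemma quot_mapE x : quot_map (\pi_(quotm G) x) = \pi_(quotm G') (f x).
Proof.
apply/eqP/quotm_eqP; rewrite -semilinB.
have /quotm_eqP : \pi_(quotm G) (repr (\pi_(quotm G) x)) == \pi_(quotm G) x.
  by rewrite reprK.
elim=> [|a u v /fG Gu _ IH]; first by rewrite raddf0; apply: span0.
by rewrite semilin; apply: span_lin.
Qed.

Lemma quot_map_linear a x y :
  quot_map (a *: x + y) = th a *: quot_map x + quot_map y.
Proof.
rewrite -[x]reprK -[y]reprK.
by rewrite -quotm_pi_lin !quot_mapE semilin quotm_pi_lin.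
Qed.

End QuotientMap.

Section Kernel.
Variables (R : comNzRingType) (M N : lmodType R) (f : {linear M -> N}).

Definition ker_pred (x : M) : bool := f x == 0.

Lemma ker_pred_closed : submod_closed ker_pred.
Proof.
split; rewrite ?inE /ker_pred; first by rewrite unfold_in raddf0.
by move=> a x y /eqP fx /eqP fy; rewrite unfold_in linearP fx fy scaler0 addr0.
Qed.

HB.instance Definition _ :=
  GRing.isSubmodClosed.Build R M ker_pred ker_pred_closed.

Record kerm := Kerm { kerm_val :> M; kermP : kerm_val \in ker_pred }.
HB.instance Definition _ := [isSub for kerm_val].
HB.instance Definition _ := [Choice of kerm by <:].
HB.instance Definition _ := [SubChoice_isSubLmodule of kerm by <:].

End Kernel.

Section KernelMap.
Variables (R R' : comNzRingType) (th : {rmorphism R -> R'}).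
Variables (M N : lmodType R) (M' N' : lmodType R').
Variables (f : {linear M -> N}) (f' : {linear M' -> N'}).
Variables (g : {linear M -> M' | th \; *:%R}) (h : {linear N -> N' | th \; *:%R}).
Hypothesis gh : forall x, f' (g x) = h (f x).

Fact ker_map_subproof (x : kerm f) : g (val x) \in ker_pred f'.
Proof. by rewrite unfold_in gh (eqP (kermP x)) raddf0. Qed.

Definition ker_map (x : kerm f) : kerm f' := Kerm (ker_map_subproof x).

Fact ker_map_linear : linear_for (th \; *:%R) ker_map.
Proof. by move=> a x y; apply: val_inj; rewrite /= semilin. Qed.
HB.instance Definition _ :=
  GRing.isLinear.Build R (kerm f) (kerm f') (th \; *:%R) ker_map ker_map_linear.

End KernelMap.

Section FreeLift.
Variables (R R' : comNzRingType) (th : {rmorphism R -> R'}).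
Variables (X : choiceType) (M : lmodType R') (f : X -> M).

(* The th-semilinear extension of f to the free R-module {freeg X / R}. *)
Definition free_lift (D : {freeg X / R}) : M :=
  \sum_(x <- dom D) th (coeff x D) *: f x.

Lemma free_liftE (s : seq X) D : uniq s -> {subset dom D <= s} ->
  free_lift D = \sum_(x <- s) th (coeff x D) *: f x.
Proof.
move=> us sD; rewrite [RHS](bigID (mem (dom D))) /= [X in _ + X]big1 ?addr0.
  rewrite -big_filter; apply: perm_big; apply: uniq_perm.
  - exact: uniq_dom.
  - exact: filter_uniq.
  by move=> x; rewrite mem_filter; case: (boolP (x \in dom D)) => // /sD.
by move=> x /coeff_outdom ->; rewrite rmorph0 scale0r.
Qed.

Fact free_lift_linear : linear_for (th \; *:%R) free_lift.
Proof.
move=> a D E; pose s := undup (dom D ++ dom E).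
have sD : {subset dom D <= s} by move=> x xD; rewrite mem_undup mem_cat xD.
have sE : {subset dom E <= s} by move=> x xE; rewrite mem_undup mem_cat xE orbT.
have sDE : {subset dom (a *: D + E) <= s}.
  move=> x /domD_subset; rewrite mem_cat => /orP[|/sE //].
  by move/domZ_subset/sD.
rewrite !(@free_liftE s) ?undup_uniq //= scaler_sumr -big_split /=.
apply: eq_bigr => x _.
by rewrite coeffD coeffZ rmorphD rmorphM scalerDl scalerA.
Qed.
HB.instance Definition _ :=
  GRing.isLinear.Build R {freeg X / R} M (th \; *:%R) free_lift free_lift_linear.

Lemma free_liftU x : free_lift << x >> = f x.
Proof. by rewrite /free_lift domU1 big_seq1 coeffU eqxx mulr1 rmorph1 scale1r. Qed.

End FreeLift.

Lemma freeg_ind (R : comNzRingType) (X : choiceType) (P : {freeg X / R} -> Prop) :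
  P 0 -> (forall a x D, P D -> P (a *: << x >> + D)) -> forall D, P D.
Proof.
move=> P0 PD D; rewrite -[D]freeg_sumE.
elim: (dom D) => [|x s IH]; first by rewrite big_nil.
rewrite big_cons; have -> : << (coeff x D) *g x >> = coeff x D *: << x >>.
  by apply/eqP/freeg_eqP => y; rewrite coeffZ !coeffU mul1r.
exact: PD.
Qed.

Definition free_map (R R' : comNzRingType) (th : {rmorphism R -> R'})
    (X Y : choiceType) (f : X -> Y) : {freeg X / R} -> {freeg Y / R'} :=
  free_lift th (fun x => << f x >>).
HB.instance Definition _ (R R' : comNzRingType) (th : {rmorphism R -> R'})
    (X Y : choiceType) (f : X -> Y) := GRing.Linear.on (free_map th f).

Lemma free_mapU (R R' : comNzRingType) (th : {rmorphism R -> R'})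
    (X Y : choiceType) (f : X -> Y) x : free_map th f << x >> = << f x >>.
Proof. exact: free_liftU. Qed.

Section Tensor.
Variables (R : comNzRingType) (M N : lmodType R).

Variant tens_rel : {freeg (M * N)%type / R} -> Prop :=
| TensAddl x x' y : tens_rel (<< (x + x', y) >> - << (x, y) >> - << (x', y) >>)
| TensAddr x y y' : tens_rel (<< (x, y + y') >> - << (x, y) >> - << (x, y') >>)
| TensScalel a x y : tens_rel (<< (a *: x, y) >> - a *: << (x, y) >>)
| TensScaler a x y : tens_rel (<< (x, a *: y) >> - a *: << (x, y) >>).

Definition tens : lmodType R := quotm tens_rel.

Definition tpure (x : M) (y : N) : tens := \pi_(quotm tens_rel) << (x, y) >>.

End Tensor.

Section TensorMap.
Variables (R R' : comNzRingType) (th : {rmorphism R -> R'}).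
Variables (M N : lmodType R) (M' N' : lmodType R').
Variables (f : {linear M -> M' | th \; *:%R}) (g : {linear N -> N' | th \; *:%R}).

Definition tens_map : tens M N -> tens M' N' :=
  quot_map (@tens_rel R' M' N')
    (free_map th (fun z : M * N => (f z.1, g z.2))).

Let phi := free_map th (fun z : M * N => (f z.1, g z.2)).

Fact tens_map_subproof z :
  tens_rel z -> span (@tens_rel R' M' N') (phi z).
Proof.
rewrite /phi; case=> [x x' y|x y y'|a x y|a x y].
- rewrite !semilinB /= !free_mapU /= raddfD; apply: span_gen.
  exact: TensAddl.
- rewrite !semilinB /= !free_mapU /= raddfD; apply: span_gen.
  exact: TensAddr.
- rewrite semilinB semilinZ /= !free_mapU /= semilinZ; apply: span_gen.
  exact: TensScalel.
- rewrite semilinB semilinZ /= !free_mapU /= semilinZ; apply: span_gen.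
  exact: TensScaler.
Qed.

Fact tens_map_linear : linear_for (th \; *:%R) tens_map.
Proof. by move=> a x y; apply: quot_map_linear; apply: tens_map_subproof. Qed.
HB.instance Definition _ := GRing.isLinear.Build R (tens M N) (tens M' N')
  (th \; *:%R) tens_map tens_map_linear.

Lemma tens_mapE x y : tens_map (tpure x y) = tpure (f x) (g y).
Proof.
by rewrite /tens_map quot_mapE /= ?free_mapU //; apply: tens_map_subproof.
Qed.

End TensorMap.

Lemma tens_ind (R : comNzRingType) (M N : lmodType R) (P : tens M N -> Prop) :
  P 0 -> (forall a x y t, P t -> P (a *: tpure x y + t)) -> forall t, P t.
Proof.
move=> P0 PD t; rewrite -[t]reprK; elim/freeg_ind: (repr t) => [|a [x y] D IH].
  by rewrite raddf0.
by rewrite quotm_pi_lin; apply: PD.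
Qed.

(* Tor is computed with the standard functorial free resolution of M: F_0 is
   free on the underlying set of M, and F_(i+1) is free on the underlying set
   of the i-th syzygy module ker (F_i -> syz i). *)
Section Resolution.
Variable R : comNzRingType.

Definition free_aug (M : lmodType R) : {freeg M / R} -> M := free_lift idfun id.

Fact free_aug_linear M : linear (@free_aug M).
Proof. by move=> a x y; rewrite /free_aug semilin. Qed.
HB.instance Definition _ (M : lmodType R) :=
  GRing.isLinear.Build R {freeg M / R} M *:%R (@free_aug M) (@free_aug_linear M).

Fixpoint syz (M : lmodType R) (i : nat) : lmodType R :=
  if i is j.+1 then kerm (@free_aug (syz M j)) else M.

Definition res (M : lmodType R) (i : nat) : lmodType R := {freeg (syz M i) / R}.

Definition res_diff (M : lmodType R) (i : nat) : res M i.+1 -> res M i :=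
  fun x => val (free_aug x : kerm (@free_aug (syz M i))).

Fact res_diff_linear M i : linear (@res_diff M i).
Proof. by move=> a x y; rewrite /res_diff !linearP. Qed.
HB.instance Definition _ (M : lmodType R) i :=
  GRing.isLinear.Build R (res M i.+1) (res M i) *:%R (@res_diff M i) (@res_diff_linear M i).

Definition tens_diff (M N : lmodType R) (i : nat) :
    tens (res M i.+1) N -> tens (res M i) N :=
  tens_map (@res_diff M i : {linear _ -> _ | idfun \; *:%R})
           (idfun : {linear N -> N | idfun \; *:%R}).

Fact tens_diff_linear M N i : linear (@tens_diff M N i).
Proof. by move=> a x y; rewrite /tens_diff semilin. Qed.
HB.instance Definition _ (M N : lmodType R) i :=
  GRing.isLinear.Build R (tens (res M i.+1) N) (tens (res M i) N)
  *:%R (@tens_diff M N i) (@tens_diff_linear M N i).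

Definition tens_diff_out (M N : lmodType R) (i : nat) :
    {linear tens (res M i) N -> tens (res M i.-1) N} :=
  match i with
  | 0 => \0
  | j.+1 => @tens_diff M N j
  end.

Definition Tor (i : nat) (M N : lmodType R) : lmodType R :=
  quotm (fun z : kerm (tens_diff_out M N i) =>
           exists w : tens (res M i.+1) N, tens_diff w = val z).

End Resolution.

Section TorMap.
Variables (R R' : comNzRingType) (th : {rmorphism R -> R'}).

Lemma free_aug_map (M : lmodType R) (M' : lmodType R')
    (f : {linear M -> M' | th \; *:%R}) x :
  free_aug (free_map th f x) = f (free_aug x).
Proof.
elim/freeg_ind: x => [|a x D IH]; first by rewrite !raddf0.
rewrite (semilin (free_map th f)) /= !linearP /= IH.
by rewrite free_mapU /free_aug !free_liftU.
Qed.

Section Map.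
Variables (M : lmodType R) (M' : lmodType R').
Variable f : {linear M -> M' | th \; *:%R}.

Fixpoint syz_map (i : nat) : {linear syz M i -> syz M' i | th \; *:%R} :=
  match i with
  | 0 => f
  | j.+1 => ker_map (free_aug_map (syz_map j))
  end.

Definition res_map (i : nat) : {linear res M i -> res M' i | th \; *:%R} :=
  free_map th (syz_map i).

Lemma res_map_diff i x :
  res_diff (res_map i.+1 x) = res_map i (res_diff x).
Proof. by rewrite /res_diff free_aug_map. Qed.

Variables (N : lmodType R) (N' : lmodType R').
Variable g : {linear N -> N' | th \; *:%R}.

Definition tens_res_map i :
    {linear tens (res M i) N -> tens (res M' i) N' | th \; *:%R} :=
  tens_map (res_map i) g.

Lemma tens_res_map_diff i w :
  tens_diff (tens_res_map i.+1 w) = tens_res_map i (tens_diff w).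
Proof.
elim/tens_ind: w => [|a x y w IH]; first by rewrite !raddf0.
rewrite semilin /= !linearP /= [X in _ + X]IH.
by rewrite /tens_diff !tens_mapE /= res_map_diff.
Qed.

Lemma tens_res_map_diff_out i w :
  tens_diff_out M' N' i (tens_res_map i w) =
  tens_res_map i.-1 (tens_diff_out M N i w).
Proof.
by case: i w => [|i] w; rewrite /= ?raddf0 // tens_res_map_diff.
Qed.

Definition Tor_map (i : nat) : Tor i M N -> Tor i M' N' :=
  quot_map _ (ker_map (@tens_res_map_diff_out i)).

Fact Tor_map_linear i : linear_for (th \; *:%R) (@Tor_map i).
Proof.
move=> a x y; apply: quot_map_linear => z [w wz]; apply: span_gen.
by exists (tens_res_map i.+1 w); rewrite tens_res_map_diff wz.
Qed.

End Map.
End TorMap.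

Section Poly.
Variables (k : comNzRingType) (n : nat).
Implicit Types (J : pred nat) (p q : {mpoly k[n]}) (g : 'M[k]_n).

(* The k-algebra endomorphism of k[x_1, ..., x_n] with x_j |-> \sum_i g_ij x_i;
   g in GL_n(k) acts on S in this way. *)
Definition act (g : 'M[k]_n) : {mpoly k[n]} -> {mpoly k[n]} :=
  comp_mpoly [tuple \sum_i g i j *: 'X_i | j < n].

HB.instance Definition _ (g : 'M[k]_n) := GRing.Linear.on (act g).
HB.instance Definition _ (g : 'M[k]_n) := GRing.RMorphism.on (act g).

(* The polynomials in \bigoplus_(j in J) S_j. *)
Definition in_degs (J : pred nat) : {pred {mpoly k[n]}} :=
  fun p => all (fun m => J (mdeg m)) (msupp p).

Lemma in_degsP J p :
  reflect {in msupp p, forall m, J (mdeg m)} (p \in in_degs J).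
Proof. exact: allP. Qed.

Lemma in_degs_submod J : submod_closed (in_degs J).
Proof.
split=> [|c p q /in_degsP Jp /in_degsP Jq]; apply/in_degsP => m.
  by rewrite msupp0.
by move/msuppD_le; rewrite mem_cat => /orP[/msuppZ_le/Jp|/Jq].
Qed.
HB.instance Definition _ (J : pred nat) :=
  GRing.isSubmodClosed.Build k {mpoly k[n]} (in_degs J) (in_degs_submod J).

Lemma in_degsM (J J1 J2 : pred nat) p q :
  (forall a b, J1 a -> J2 b -> J (a + b)%N) ->
  p \in in_degs J1 -> q \in in_degs J2 -> p * q \in in_degs J.
Proof.
move=> JD /in_degsP Jp /in_degsP Jq; apply/in_degsP => m.
by case/msuppM_le/allpairsP=> -[u v] /= [/Jp Ju /Jq Jv ->]; rewrite mdegD JD.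
Qed.

Lemma in_degsC (J : pred nat) c : J 0%N -> c%:MP \in in_degs J.
Proof.
move=> J0; apply/in_degsP => m; rewrite msuppC.
by case: eqP => // _; rewrite inE => /eqP ->; rewrite mdeg0.
Qed.

Lemma act_in_degs J g p : p \in in_degs J -> act g p \in in_degs J.
Proof.
move=> /in_degsP Jp; rewrite /act comp_mpolyEX.
rewrite big_seq; apply: rpred_sum => m /Jp Jm; apply: rpredZ.
have hom : 'X_[m] \mPo [tuple \sum_i g i j *: 'X_i | j < n] \is
             (mdeg m).-homog.
  rewrite comp_mpolyX mdegE.
  elim/big_rec2: _ => [|i a q _ hq]; first exact: dhomog1.
  rewrite addnC mulrC; apply: dhomogM => //.
  rewrite -[X in X.-homog]mul1n; apply: dhomogMn; rewrite tnth_mktuple.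
  by apply: rpred_sum => l _; apply: rpredZ; rewrite dhomogX; apply/eqP; apply: mdeg1.
by apply/in_degsP => u /(dhomog_mf hom) ->.
Qed.

Lemma act_dhomog e g p : p \is e.-homog -> act g p \is e.-homog.
Proof. by rewrite !dhomogE; apply: (@act_in_degs (pred1 e)). Qed.

(* k is not assumed to have decidable units, so unitmx is not available. *)
Definition invertible g : Prop :=
  exists h : 'M[k]_n, g *m h = 1%:M /\ h *m g = 1%:M.

End Poly.

Section Veronese.
Variables (k : comNzRingType) (n d : nat).

Definition ver_degs : pred nat := fun j => (d %| j)%N.

(* S^(d) *)
Record veronese :=
  Veronese { ver_val :> {mpoly k[n]}; verP : ver_val \in in_degs ver_degs }.
HB.instance Definition _ := [isSub for ver_val].
HB.instance Definition _ := [Choice of veronese by <:].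

Fact ver_mul_closed : mulr_closed (@in_degs k n ver_degs).
Proof.
split=> [|p q]; first by rewrite -mpolyC1 in_degsC // /ver_degs dvdn0.
by apply: in_degsM => a b; apply: dvdn_add.
Qed.
HB.instance Definition _ := GRing.isMulClosed.Build {mpoly k[n]}
  (@in_degs k n ver_degs) ver_mul_closed.
HB.instance Definition _ := [SubChoice_isSubComNzRing of veronese by <:].

Definition mod_degs (r : nat) : pred nat :=
  fun j => (r <= j)%N && (j == r %[mod d])%N.

(* The ideal R_+ of R = S^(d). *)
Definition ver_plus : {pred veronese} := fun a => ver_val a \in in_degs (mod_degs d).

(* The quotient map R -> R / R_+ = k takes the constant term. *)
Definition ver_const (a : veronese) : k := (ver_val a)@_0%MM.

Fact ver_const_zmod : zmod_morphism ver_const.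
Proof. by move=> a b; apply: mcoeffB. Qed.
Fact ver_const_monoid : monoid_morphism ver_const.
Proof. by split=> [|a b]; rewrite /ver_const ?mcoeff1 ?eqxx ?rmorphM. Qed.
HB.instance Definition _ :=
  GRing.isZmodMorphism.Build veronese k ver_const ver_const_zmod.
HB.instance Definition _ :=
  GRing.isMonoidMorphism.Build veronese k ver_const ver_const_monoid.

Section Action.
Variable g : 'M[k]_n.

Definition ver_act (a : veronese) : veronese :=
  Veronese (act_in_degs g (verP a)).

Fact ver_act_zmod : zmod_morphism ver_act.
Proof. by move=> a b; apply: val_inj; rewrite /= raddfB. Qed.
Fact ver_act_monoid : monoid_morphism ver_act.
Proof.
by split=> [|a b]; apply: val_inj; rewrite /= ?rmorph1 ?rmorphM.
Qed.
HB.instance Definition _ :=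
  GRing.isZmodMorphism.Build veronese veronese ver_act ver_act_zmod.
HB.instance Definition _ :=
  GRing.isMonoidMorphism.Build veronese veronese ver_act ver_act_monoid.
End Action.

Section Module.
Variable r : nat.

(* S^(>= r, d) *)
Record ver_mod := VerMod {
  ver_mod_val :> {mpoly k[n]}; ver_modP : ver_mod_val \in in_degs (mod_degs r) }.
HB.instance Definition _ := [isSub for ver_mod_val].
HB.instance Definition _ := [Choice of ver_mod by <:].
HB.instance Definition _ := [SubChoice_isSubZmodule of ver_mod by <:].

Fact ver_mod_scale_subproof (a : veronese) (x : ver_mod) :
  ver_val a * ver_mod_val x \in in_degs (mod_degs r).
Proof.
apply: in_degsM (verP a) (ver_modP x) => u v /dvdnP[q ->] /andP[le_rv /eqP vr].
by rewrite /mod_degs modnMDl vr eqxx (leq_trans le_rv) // leq_addl.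
Qed.

Definition ver_mod_scale (a : veronese) (x : ver_mod) : ver_mod :=
  VerMod (ver_mod_scale_subproof a x).

Fact ver_mod_scaleA a b x :
  ver_mod_scale a (ver_mod_scale b x) = ver_mod_scale (a * b) x.
Proof. by apply: val_inj; rewrite /= mulrA. Qed.
Fact ver_mod_scale1 : left_id 1 ver_mod_scale.
Proof. by move=> x; apply: val_inj; rewrite /= mul1r. Qed.
Fact ver_mod_scaleDr : right_distributive ver_mod_scale +%R.
Proof. by move=> a x y; apply: val_inj; rewrite /= mulrDr. Qed.
Fact ver_mod_scaleDl x : {morph ver_mod_scale^~ x : a b / a + b}.
Proof. by move=> a b; apply: val_inj; rewrite /= mulrDl. Qed.
HB.instance Definition _ := GRing.Zmodule_isLmodule.Build veronese ver_mod
  ver_mod_scaleA ver_mod_scale1 ver_mod_scaleDr ver_mod_scaleDl.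

Definition ver_mod_act (g : 'M[k]_n) (x : ver_mod) : ver_mod :=
  VerMod (act_in_degs g (ver_modP x)).

Fact ver_mod_act_linear g : linear_for (ver_act g \; *:%R) (ver_mod_act g).
Proof. by move=> a x y; apply: val_inj; rewrite /= raddfD /= rmorphM. Qed.
HB.instance Definition _ (g : 'M[k]_n) := GRing.isLinear.Build veronese
  ver_mod ver_mod (ver_act g \; *:%R) (ver_mod_act g) (ver_mod_act_linear g).

End Module.
End Veronese.

Arguments ver_plus {k n d}.
Arguments ver_const {k n d} a.

Definition Tor_act (k : comNzRingType) (n d r r' i : nat) (g : 'M[k]_n) :
    Tor i (ver_mod k n d r) (ver_mod k n d r') ->
    Tor i (ver_mod k n d r) (ver_mod k n d r') :=
  fun t => Tor_map (ver_mod_act g) (ver_mod_act g) t.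

Section SymTens.
Variables (k : comNzRingType) (n : nat).

(* S^a_1(V) (x) (S^a_2(V) (x) ... (S^a_p(V) (x) k)), with V = S^1(V) the span of
   the variables; the empty tensor product is k. *)
Fixpoint symtens (s : seq nat) : lmodType k :=
  if s is a :: s' then tens (dhomog n k a) (symtens s') else k^o.

Definition sym_act (g : 'M[k]_n) (a : nat) (p : dhomog n k a) : dhomog n k a :=
  DHomog (act_dhomog g (dhomog_is_dhomog p)).

Fact sym_act_linear g a : linear_for (idfun \; *:%R) (@sym_act g a).
Proof. by move=> c x y; apply: val_inj; rewrite /= linearP. Qed.
HB.instance Definition _ (g : 'M[k]_n) a := GRing.isLinear.Build k
  (dhomog n k a) (dhomog n k a) (idfun \; *:%R) (@sym_act g a)
  (@sym_act_linear g a).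

Fixpoint symtens_act (g : 'M[k]_n) (s : seq nat) :
    {linear symtens s -> symtens s | idfun \; *:%R} :=
  match s with
  | [::] => idfun : {linear k^o -> k^o}
  | a :: s' => tens_map (@sym_act g a) (symtens_act g s')
  end.

End SymTens.

Section Schur.
Variables (k : comNzRingType) (n : nat) (D : {fset nat * nat}).

(* Cells are pairs (row, column) in matrix coordinates: row indices increase
   downwards and column indices increase to the right. *)
Definition cell_row (c : D) : nat := (val c).1.
Definition cell_col (c : D) : nat := (val c).2.

(* The indices of the nonempty rows, from bottom to top. *)
Definition diag_rows : seq nat := sort geq (undup [seq c.1 | c <- D]).

Definition row_size (i : nat) : nat := #|[pred c : D | cell_row c == i]|.

Definition row_symtens : lmodType k := symtens k n (map row_size diag_rows).

Section Filling.
Variable v : D -> dhomog n k 1.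

Fact row_prod_subproof i :
  \prod_(c : D | cell_row c == i) mpoly_of_dhomog (v c) \is (row_size i).-homog.
Proof.
rewrite /row_size -sum1_card; elim/big_rec2: _ => [|c a p _ hp].
  exact: dhomog1.
by apply: dhomogM => //; apply: dhomog_is_dhomog.
Qed.

Definition row_prod (i : nat) : dhomog n k (row_size i) :=
  DHomog (row_prod_subproof i).

Fixpoint row_tensor (s : seq nat) : symtens k n (map row_size s) :=
  if s is i :: s' then tpure (row_prod i) (row_tensor s') else 1.

End Filling.

Definition col_perm_pred (w : {perm D}) : bool :=
  [forall c, cell_col (w c) == cell_col c].

(* The image in row_symtens of the tensor product, over the columns of D, of
   the exterior products of the entries of v in each column: the product over
   columns of the antisymmetrizations is the signed sum over the permutations
   of D that preserve every column. *)
Definition col_antisym (v : D -> dhomog n k 1) : row_symtens :=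
  \sum_(w : {perm D} | col_perm_pred w)
     (-1) ^+ w *: row_tensor (fun c => v (w c)) diag_rows.

(* The Schur module of D: the tensor product over the columns of the exterior
   powers of V is spanned by the decomposable tensors, so the image of the
   composite is spanned by their images. *)
Definition schur : lmodType k :=
  spanm (fun t : row_symtens => exists v, t = col_antisym v).

Section Action.
Variable g : 'M[k]_n.

Lemma row_tensor_act v s :
  symtens_act g (map row_size s) (row_tensor v s) =
  row_tensor (fun c => sym_act g (v c)) s.
Proof.
elim: s => [|i s IH] //; rewrite [LHS]tens_mapE IH /=; congr tpure.
by apply: val_inj; rewrite /= /act rmorph_prod.
Qed.

Lemma col_antisym_act v :
  symtens_act g (map row_size diag_rows) (col_antisym v) =
  col_antisym (fun c => sym_act g (v c)).
Proof.
rewrite /col_antisym raddf_sum; apply: eq_bigr => w _.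
by apply: etrans (semilinZ _ _ _) _; rewrite row_tensor_act.
Qed.

Fact schur_act_subproof (t : schur) :
  symtens_act g (map row_size diag_rows) (val t) \in
    span_pred (fun t : row_symtens => exists v, t = col_antisym v).
Proof.
case: t => t /= /asboolP ht; apply/asboolP.
elim: ht => [|c x y [v ->] _ IH]; first by rewrite raddf0; apply: span0.
by rewrite semilin col_antisym_act; apply: span_step => //; eexists.
Qed.

Definition schur_act (t : schur) : schur := Spanm (schur_act_subproof t).

End Action.

End Schur.

(* sigma(al): row t of the ribbon, counted from the bottom starting at t = 0,
   has matrix row index size al - 1 - t and begins in column
   \sum_(s < t) (al_s - 1). *)
Definition ribbon (al : seq nat) : {fset nat * nat} :=
  [fset c in [seq ((size al - t.+1)%N, (sumn [seq a.-1 | a <- take t al] + j)%N)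
             | t <- iota 0 (size al), j <- iota 0 (nth 0%N al t)]]%fset.

(* Main.v *)
Require Import Defs.
From HB Require Import structures.
From mathcomp Require Import all_boot all_order all_fingroup all_algebra finmap.
From mathcomp Require Import boolp zify.
From mathcomp Require Import -(notations) monalg.
From mathcomp Require Import generic_quotient freeg mpoly.

Set Implicit Arguments.
Unset Strict Implicit.
Unset Printing Implicit Defensive.

Import GRing.Theory.
Local Open Scope ring_scope.
Local Open Scope quotient_scope.

(** Let A be the polynomial ring over k in variables x_(j,a), for rows j = 0, 1, ..
    and letters a < n, and let mu_j be the substitution of row j for row j.+1. Tensor
    products of symmetric powers of V embed in A, the j-th factor being written in row
    j, and there mu_j multiplies two adjacent factors.

    A ribbon Schur module is the common kernel of the mergings of its adjacent rows.
    Adjacent rows share a column, so antisymmetrized fillings are in the kernel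
    ([mu_ribbon]). Conversely, order the monomials of A by a weight that prefers large
    letters in high rows. A monomial of greatest weight in a multihomogeneous element of
    the kernel of mu_j has a descent from row j to row j.+1: a letter of row j that is
    smaller than some letter of row j.+1 ([lead_descent]). A monomial with descents at
    all junctions is in turn the leading monomial, with coefficient 1, of an
    antisymmetrized filling ([tab_antisym]). Subtracting leading terms, which needs no
    division, shows that the fillings span the kernel ([triangular_span], [tab_span]).

    The same reduction resolves M over R. Let P_i be the free R-module on the tableaux,
    that is, the monomials with descents whose i+1 rows have lengths r, d, .., d. It is
    realized in A by the antisymmetrized fillings, with the coefficients from R written
    in the next row, and the differential rereads the last tableau row as a coefficient
    and merges the old coefficient row into it ([mu_vemb]). For exactness, the d
    greatest letters of the coefficient row of a leading monomial are split off as a new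
    row ([tab_split_span], [vdiffK]). Tensoring with M' replaces coefficients in R by
    coefficients in M', and the argument then fails only in the lowest degree r' of the
    coefficient row ([tens_vdiffK]). Hence a cycle of P (x) M' of positive index is a
    boundary exactly when its part of degree r' vanishes, and these parts form the
    common kernel for the ribbon (r, d^i, r').

    Tor and the action of GL(V) on it are defined by the standard resolution F, whose
    terms are free on all elements of the syzygies. A comparison of resolutions
    ([cycle_comparison]) makes every cycle of F (x) M' homologous to the image of a
    cycle of P (x) M'. The isomorphism itself is written on F: a syzygy z has a lowest
    part [tau] z in A, obtained by taking degree r parts in M and degree d parts of all
    coefficients, and Phi (z (x) m) is tau z times the part of degree r' of m, for a
    generator z of F. This formula commutes with GL(V), it kills boundaries
    ([Phi_diff]), and on the image of P (x) M' it is the extraction of the part of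
    degree r' ([Phi_gmap]); so it induces a bijection from Tor onto the ribbon Schur
    module. It is semilinear along the constant term R -> k, whence R_+ acts on Tor by
    zero. *)

(** * Monomials in rows of variables *)

Section RowMonomials.
Variable n : nat.

(** The exponents of the monomials in the variables x_(j,a), listed by rows. *)
Definition rowmon : Type := {fsfun nat -> 'X_{1..n} with 0%MM}.
HB.instance Definition _ := Choice.on rowmon.

Definition rm_fun (m : rowmon) (j : nat) : 'X_{1..n} := m j.
Coercion rm_fun : rowmon >-> Funclass.

Lemma rmP (m1 m2 : rowmon) : (forall j, m1 j = m2 j) <-> m1 = m2.
Proof. by split=> [h|->//]; apply/fsfunP. Qed.

Definition mkrm (s : seq nat) (f : nat -> 'X_{1..n}) : rowmon :=
  [fsfun j in seq_fset tt s => f j].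

Lemma mkrmE s f j : mkrm s f j = if j \in s then f j else 0%MM.
Proof. by rewrite /rm_fun /mkrm fsfunE seq_fsetE. Qed.

Definition rows (m : rowmon) : seq nat := finsupp m.

Lemma rowsE (m : rowmon) j : (j \in rows m) = (m j != 0%MM).
Proof. by rewrite /rows mem_finsupp. Qed.

Lemma rows_uniq (m : rowmon) : uniq (rows m).
Proof. exact: fset_uniq. Qed.

Definition rm1 : rowmon := mkrm [::] (fun=> 0%MM).
Definition rmM (m1 m2 : rowmon) : rowmon :=
  mkrm (rows m1 ++ rows m2) (fun j => (m1 j + m2 j)%MM).

Lemma rm1E j : rm1 j = 0%MM. Proof. by rewrite mkrmE. Qed.
Lemma rmME m1 m2 j : rmM m1 m2 j = (m1 j + m2 j)%MM.
Proof.
rewrite mkrmE mem_cat !rowsE -negb_and; case: ifP => // /negbFE /andP[/eqP-> /eqP->].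
by rewrite addm0.
Qed.

Fact rmMA : associative rmM.
Proof. by move=> x y z; apply/rmP => j; rewrite !rmME addmA. Qed.
Fact rmMC : commutative rmM.
Proof. by move=> x y; apply/rmP => j; rewrite !rmME addmC. Qed.
Fact rm1M : left_id rm1 rmM.
Proof. by move=> x; apply/rmP => j; rewrite !rmME rm1E add0m. Qed.
Fact rmM1 : right_id rm1 rmM.
Proof. by move=> x; rewrite rmMC rm1M. Qed.
Fact rmM_eq1 x y : rmM x y = rm1 -> x = rm1 /\ y = rm1.
Proof.
move=> h; split; apply/rmP => j; have/rmP/(_ j)/eqP := h;
  by rewrite rmME rm1E mnmD_eq0 => /andP[/eqP ? /eqP ?].
Qed.
HB.instance Definition _ :=
  monalg.Choice_isMonomialDef.Build rowmon rmMA rm1M rmM1 rmM_eq1.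
HB.instance Definition _ :=
  monalg.MonomialDef_isConomialDef.Build rowmon rmMC.

Definition rowm (j : nat) (u : 'X_{1..n}) : rowmon := mkrm [:: j] (fun=> u).

Lemma rowmE j u i : rowm j u i = if i == j then u else 0%MM.
Proof. by rewrite mkrmE inE. Qed.

Lemma rowmD j u v : rowm j (u + v)%MM = rmM (rowm j u) (rowm j v).
Proof. by apply/rmP => i; rewrite rmME !rowmE; case: eqP => //; rewrite addm0. Qed.

Lemma rowm0 j : rowm j 0%MM = rm1.
Proof. by apply/rmP => i; rewrite rowmE rm1E; case: eqP. Qed.

(** The effect on exponents of the substitution of x_(j,a) for x_(j.+1,a). *)
Definition merge_row (j : nat) (m : rowmon) : rowmon :=
  mkrm (j :: rows m) (fun i => if i == j then (m j + m j.+1)%MM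
                               else if i == j.+1 then 0%MM else m i).

Lemma merge_rowE j m i : merge_row j m i =
  if i == j then (m j + m j.+1)%MM else if i == j.+1 then 0%MM else m i.
Proof.
rewrite mkrmE inE rowsE; case: eqP => //= _; case: eqP => // ->.
by case: ifP => //; case: eqP.
Qed.

Lemma merge_rowM j m1 m2 : merge_row j (rmM m1 m2) =
  rmM (merge_row j m1) (merge_row j m2).
Proof.
apply/rmP => i; rewrite rmME !merge_rowE !rmME; case: ifP => _; last first.
  by case: ifP => // _; rewrite addm0.
by rewrite -!addmA; congr (_ + _)%MM; rewrite !addmA; congr (_ + _)%MM; rewrite addmC.
Qed.

Lemma merge_row1 j : merge_row j rm1 = rm1.
Proof. by apply/rmP => i; rewrite merge_rowE !rm1E addm0; do 2!case: ifP => //. Qed.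

Definition lweight (u : 'X_{1..n}) : nat := (\sum_(a < n) a * u a)%N.

Lemma lweightD u v : lweight (u + v)%MM = (lweight u + lweight v)%N.
Proof. by rewrite /lweight -big_split /=; apply: eq_bigr => a _;
  rewrite mnmDE mulnDr. Qed.

Lemma lweight0 : lweight 0%MM = 0%N.
Proof. by rewrite /lweight big1 // => a _; rewrite mnm0E muln0. Qed.

(** Letters weigh more in higher rows. So the weight of a filling is greatest when its
    columns increase upwards, and a monomial is lightest among those with the same row
    degrees and the same merging of two rows when its smallest letters are in the upper
    row. *)
Definition weight (m : rowmon) : nat := (\sum_(j <- rows m) j * lweight (m j))%N.

Lemma weightE (s : seq nat) (m : rowmon) : uniq s -> {subset rows m <= s} ->
  weight m = (\sum_(j <- s) j * lweight (m j))%N.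
Proof.
move=> us sm; rewrite [RHS](bigID (mem (rows m))) /= [X in (_ + X)%N]big1 ?addn0.
  rewrite -big_filter; apply: perm_big; apply: uniq_perm;
    rewrite ?filter_uniq ?rows_uniq //.
  by move=> x; rewrite mem_filter; case: (boolP (x \in rows m)) => // /sm.
by move=> j; rewrite rowsE negbK => /eqP ->; rewrite lweight0 muln0.
Qed.

Lemma weightM m1 m2 : weight (rmM m1 m2) = (weight m1 + weight m2)%N.
Proof.
pose s := undup (rows m1 ++ rows m2).
have us : uniq s by apply: undup_uniq.
have s1 : {subset rows m1 <= s} by move=> j; rewrite mem_undup mem_cat => ->.
have s2 : {subset rows m2 <= s} by move=> j; rewrite mem_undup mem_cat orbC => ->.
have s12 : {subset rows (rmM m1 m2) <= s}.
  by move=> j; rewrite mem_undup mem_cat !rowsE rmME mnmD_eq0 negb_and.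
rewrite (weightE us s1) (weightE us s2) (weightE us s12).
by rewrite -big_split; apply: eq_bigr => j _; rewrite rmME lweightD mulnDr.
Qed.

Lemma weight_rowm j u : weight (rowm j u) = (j * lweight u)%N.
Proof.
have sub : {subset rows (rowm j u) <= [:: j]}.
  by move=> i; rewrite rowsE rowmE inE; case: (i =P j) => // _; rewrite eqxx.
by rewrite (weightE _ sub) // big_seq1 rowmE eqxx.
Qed.

End RowMonomials.

(** * The polynomial ring in rows of variables *)

(** The polynomial ring in the variables x_(j,a), presented by its basis of monomials
    with coefficients and finite supports; every later argument is in these terms. *)
Record row_algebra (k : comNzRingType) (n : nat) := RowAlgebra {
  ra_alg : comAlgType k;
  ra_X : rowmon n -> ra_alg;
  ra_coef : rowmon n -> ra_alg -> k;
  ra_supp : ra_alg -> seq (rowmon n);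
  ra_X1 : ra_X (rm1 n) = 1;
  ra_XM : forall m1 m2, ra_X m1 * ra_X m2 = ra_X (rmM m1 m2);
  ra_coefD : forall m x y, ra_coef m (x + y) = ra_coef m x + ra_coef m y;
  ra_coefZ : forall m c x, ra_coef m (c *: x) = c * ra_coef m x;
  ra_coefX : forall m m', ra_coef m' (ra_X m) = (m == m')%:R;
  ra_coefP : forall x y, (forall m, ra_coef m x = ra_coef m y) -> x = y;
  ra_supp_uniq : forall x, uniq (ra_supp x);
  ra_suppE : forall m x, (m \in ra_supp x) = (ra_coef m x != 0) }.

Lemma row_algebra_exists (k : comNzRingType) (n : nat) : row_algebra k n.
Proof.
pose A : comAlgType k := monalg.malg (rowmon n) k.
pose X m : A := monalg.mkmalgU m 1.
pose c m (x : A) : k := monalg.mcoeff m x.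
apply: (@RowAlgebra k n A X c (fun x => monalg.msupp x)).
- exact: erefl.
- move=> m1 m2.
  apply: etrans (monalg.fgmulUU (1 : k) 1 m1 m2) _.
  by rewrite mulr1.
- move=> m x y; exact: monalg.mcoeffD.
- move=> m a x; exact: monalg.mcoeffZ.
- move=> m m'; exact: monalg.mcoeffU.
- by move=> x y h; apply/monalg.malgP.
- move=> x; exact: fset_uniq.
- move=> m x; symmetry; exact: monalg.mcoeff_neq0.
Qed.

Definition rowring (k : comNzRingType) (n : nat) :
  comAlgType k := ra_alg (row_algebra_exists k n).

Section RowRing.
Variables (k : comNzRingType) (n : nat).
Local Notation K := (rowmon n).
Local Notation A := (rowring k n).
Local Notation S := {mpoly k[n]}.
Implicit Types (m : K) (t x y : A).

Definition rcoef (m : K) (t : A) : k := ra_coef m t.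
Definition rX (m : K) : A := ra_X _ m.
Definition rsupp (t : A) : seq K := ra_supp t.

Lemma rcoefD m x y : rcoef m (x + y) = rcoef m x + rcoef m y.
Proof. exact: ra_coefD. Qed.

Lemma rcoefZ m c x : rcoef m (c *: x) = c * rcoef m x.
Proof. exact: ra_coefZ. Qed.

Fact rcoef_linear m : scalar (rcoef m).
Proof. by move=> c x y; rewrite rcoefD rcoefZ. Qed.
HB.instance Definition _ m := GRing.isLinear.Build k A k *%R (rcoef m) (rcoef_linear m).

Lemma rsuppE m t : (m \in rsupp t) = (rcoef m t != 0).
Proof. exact: ra_suppE. Qed.

Lemma rsupp_uniq t : uniq (rsupp t).
Proof. exact: ra_supp_uniq. Qed.

Lemma rcoefX m m' : rcoef m' (rX m) = (m == m')%:R.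
Proof. exact: ra_coefX. Qed.

Lemma rP x y : (forall m, rcoef m x = rcoef m y) -> x = y.
Proof. exact: ra_coefP. Qed.

Lemma rXM m1 m2 : rX m1 * rX m2 = rX (rmM m1 m2).
Proof. exact: ra_XM. Qed.

Lemma rX1 : rX (rm1 n) = 1.
Proof. exact: ra_X1. Qed.

Lemma rowring_sum t : t = \sum_(m <- rsupp t) rcoef m t *: rX m.
Proof.
apply: rP => m; rewrite linear_sum /=.
under eq_bigr do rewrite linearZ /= rcoefX.
case: (boolP (m \in rsupp t)) => [mt|mNt].
  rewrite (bigD1_seq m) ?rsupp_uniq //= eqxx mulr1 big1 ?addr0 // => m' /negPf->.
  by rewrite mulr0.
rewrite big_seq big1 => [|m' m't]; first by move: mNt; rewrite rsuppE negbK => /eqP.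
by case: eqP m't => [->|]; rewrite ?(negPf mNt) ?mulr0.
Qed.

Lemma rowring_ind (P : A -> Prop) :
  P 0 -> (forall c m t, P t -> P (c *: rX m + t)) -> forall t, P t.
Proof.
move=> P0 PD t.
have h (s : seq K) : P (\sum_(m <- s) rcoef m t *: rX m).
  elim: s => [|m s IH].
    by rewrite big_nil.
  by rewrite big_cons; apply: PD.
by have e := rowring_sum t; rewrite e; apply: h.
Qed.

Section Lift.
Variables (V : lmodType k) (f : K -> V).
Definition mlift (t : A) : V := \sum_(m <- rsupp t) rcoef m t *: f m.

Lemma mliftE (s : seq K) t : uniq s -> {subset rsupp t <= s} ->
  mlift t = \sum_(m <- s) rcoef m t *: f m.
Proof.
move=> us sm; rewrite [RHS](bigID (mem (rsupp t))) /= [X in _ + X]big1 ?addr0.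
  rewrite -big_filter; apply: perm_big.
  apply: uniq_perm; rewrite ?filter_uniq ?rsupp_uniq //.
  by move=> x; rewrite mem_filter; case: (boolP (x \in rsupp t)) => // /sm.
by move=> j; rewrite rsuppE negbK => /eqP ->; rewrite scale0r.
Qed.

Fact mlift_linear : linear mlift.
Proof.
move=> c x y; pose s := undup (rsupp x ++ rsupp y).
have us : uniq s by apply: undup_uniq.
have sx : {subset rsupp x <= s} by move=> j; rewrite mem_undup mem_cat => ->.
have sy : {subset rsupp y <= s} by move=> j; rewrite mem_undup mem_cat orbC => ->.
have sxy : {subset rsupp (c *: x + y) <= s}.
  move=> j; rewrite mem_undup mem_cat !rsuppE linearP /=.
  by apply: contraNT; rewrite negb_or !negbK => /andP[/eqP-> /eqP->];
    rewrite mulr0 addr0.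
rewrite (mliftE us sx) (mliftE us sy) (mliftE us sxy) scaler_sumr -big_split /=.
by apply: eq_bigr => m _; rewrite linearP /= scalerDl scalerA.
Qed.
HB.instance Definition _ := GRing.isLinear.Build k A V *:%R mlift mlift_linear.

Lemma mliftX m : mlift (rX m) = f m.
Proof.
have sub : {subset rsupp (rX m) <= [:: m]}.
  by move=> j; rewrite rsuppE rcoefX inE [j == m]eq_sym; apply: contraNT => /negPf->.
by rewrite (mliftE _ sub) // big_seq1 rcoefX eqxx scale1r.
Qed.
End Lift.

Lemma rcoef_mlift (f : K -> A) m t :
  rcoef m (mlift f t) = \sum_(m' <- rsupp t) rcoef m' t * rcoef m (f m').
Proof. by rewrite /mlift linear_sum /=; apply: eq_bigr => m' _; rewrite linearZ. Qed.

Section AlgLift.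
Variable (f : K -> A).
Hypotheses (f1 : f (rm1 n) = 1) (fM : forall m1 m2, f (rmM m1 m2) = f m1 * f m2).

Lemma mliftM x y : mlift f (x * y) = mlift f x * mlift f y.
Proof.
elim/rowring_ind: x => [|c m x IH]; first by rewrite mul0r linear0 mul0r.
rewrite mulrDl -scalerAl !linearP /= mulrDl -scalerAl IH mliftX.
congr (_ *: _ + _).
elim/rowring_ind: y {IH} => [|c' m' y IH]; first by rewrite mulr0 linear0 mulr0.
by rewrite mulrDr -scalerAr !linearP /= mulrDr -scalerAr IH rXM !mliftX fM.
Qed.

Lemma mlift1 : mlift f 1 = 1.
Proof. by rewrite -[X in mlift f X]rX1 mliftX f1. Qed.
End AlgLift.

(** The copy of S in the variables of row j. *)
Definition iota_ j : S -> A :=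
  mpoly.mmap (GRing.in_alg A) (fun a => rX (rowm j U_(a)%MM)).
HB.instance Definition _ j := GRing.RMorphism.on (iota_ j).

Lemma iotaX j u : iota_ j 'X_[u] = rX (rowm j u).
Proof.
pose phi u := rX (rowm j u).
have phiD : {morph phi : u v / (u + v)%MM >-> u * v}.
  by move=> v w; rewrite /phi rowmD rXM.
have phi0 : phi 0%MM = 1 by rewrite /phi rowm0 rX1.
rewrite /iota_ mmapX /mmap1 -/(phi u) {2}[u]multinomUE_id.
rewrite (big_morph phi phiD phi0); apply: eq_bigr => a _.
by elim: (u a) => [|c IH]; rewrite ?expr0 ?mulm0n // exprS mulmS phiD IH.
Qed.

Lemma iotaZ j c p : iota_ j (c *: p) = c *: iota_ j p.
Proof. by rewrite /iota_ mmapZ /= mulr_algl. Qed.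
HB.instance Definition _ j :=
  GRing.isScalable.Build k S A *:%R (iota_ j) (iotaZ j).

Lemma mpoly_lin_ind (P : S -> Prop) :
  P 0 -> (forall c u p, P p -> P (c *: 'X_[u] + p)) -> forall p, P p.
Proof.
move=> P0 PD p; rewrite [p]mpolyE; elim: (msupp p) => [|m s IH].
  by rewrite big_nil.
by rewrite big_cons; apply: PD.
Qed.

(** The algebra map with x_(j.+1,a) |-> x_(j,a). On tensor products of symmetric powers
    it multiplies the factors j and j.+1. *)
Definition mu j : A -> A := mlift (fun m => rX (merge_row j m)).
HB.instance Definition _ j := GRing.Linear.on (mu j).

Lemma muX j m : mu j (rX m) = rX (merge_row j m).
Proof. exact: mliftX. Qed.
Lemma muM j x y : mu j (x * y) = mu j x * mu j y.
Proof. by apply: mliftM => m1 m2; rewrite merge_rowM rXM. Qed.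
Lemma mu1 j : mu j 1 = 1.
Proof. by apply: mlift1; rewrite merge_row1 rX1. Qed.
HB.instance Definition _ j :=
  GRing.isMonoidMorphism.Build A A (mu j) (conj (mu1 j) (muM j)).

Lemma mu_iota j i p : mu j (iota_ i p) = iota_ (if i == j.+1 then j else i) p.
Proof.
elim/mpoly_lin_ind: p => [|c u p IH]; first by rewrite !linear0.
rewrite !linearP /= IH !iotaX muX; congr (_ *: rX _ + _); apply/rmP => l.
rewrite merge_rowE !rowmE; case: (i =P j.+1) => [->|/eqP/negPf ij].
  case: (l =P j) => [_|_]; last by case: (l =P j.+1).
  by rewrite eqxx -[j == _]/(j == j.+1) (negPf (_ : j != j.+1)) ?add0m // neq_ltn ltnSn.
rewrite [j.+1 == i]eq_sym ij addm0 [j == i]eq_sym.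
case: (l =P j) => [->|]; first by rewrite eq_sym.
by case: (l =P j.+1) => [->|//]; rewrite eq_sym ij.
Qed.

End RowRing.

(** * Leading monomials in the kernel of a merging *)

Section Leading.
Variables (k : comNzRingType) (n : nat).
Local Notation K := (rowmon n).
Local Notation A := (rowring k n).
Implicit Types (m : K) (t x y : A).

(** A row with exponent u can be placed below a row with exponent v so that their shared
    column increases upwards. *)
Definition descent (u v : 'X_{1..n}) : bool :=
  [exists a : 'I_n, exists b : 'I_n, [&& (a < b)%N, u a != 0%N & v b != 0%N]].

Lemma descentP (u v : 'X_{1..n}) :
  reflect (exists a b : 'I_n, [/\ (a < b)%N, u a != 0%N & v b != 0%N]) (descent u v).
Proof.
apply: (iffP existsP) => [[a /existsP[b /and3P[*]]]|[a [b [*]]]]; exists a.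
  by exists b.
by apply/existsP; exists b; apply/and3P.
Qed.

(** Without a descent no letter of u1 is smaller than a letter of u2: u2 consists of the
    smallest letters of u1 + u2, and any other choice of as many letters is heavier. *)
Lemma lweight_min (u1 u2 v1 v2 : 'X_{1..n}) :
  (u1 + u2 = v1 + v2)%MM -> mdeg u2 = mdeg v2 -> ~~ descent u1 u2 -> u2 <> v2 ->
  (lweight u2 < lweight v2)%N.
Proof.
move=> e d2 ndsc ne.
have uv a : (u1 a + u2 a = v1 a + v2 a)%N by rewrite -!mnmDE e.
(* A threshold: all letters of u2 are at most th, all letters of u1 at least th. *)
pose th := \max_(b < n | u2 b != 0%N) (b : nat).
have th2 (b : 'I_n) : (th < b)%N -> u2 b = 0%N.
  move=> thb; apply/eqP; apply: contraLR thb => u2b; rewrite -leqNgt.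
  by apply: (bigmax_sup b).
have th1 (a : 'I_n) : (a < th)%N -> u1 a = 0%N.
  move=> ath; apply/eqP; apply: contraLR ath => u1a; rewrite -leqNgt.
  apply/bigmax_leqP => b u2b; rewrite leqNgt; apply: contra ndsc => ab.
  by apply/descentP; exists a, b.
(* Summed over a, the terms with th cancel because u2 and v2 have the same degree. *)
have term (a : 'I_n) : (a * u2 a + th * v2 a <= a * v2 a + th * u2 a
    ?= iff ((a == th :> nat) || (u2 a == v2 a)))%N.
  have := uv a; have := th2 a; have := th1 a.
  case: (ltngtP a th) => [ath /(_ isT) -> _|tha _ /(_ isT) ->|-> _ _] /= h.
  - have hle : (v2 a <= u2 a)%N by rewrite -[u2 a]add0n h leq_addl.
    split; last first.
      apply/eqP/eqP => [|->]; last by rewrite addnC.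
      move: ath hle; move: (u2 a) (v2 a) (a : nat) (th) => x y a' t; nia.
    move: ath hle; move: (u2 a) (v2 a) (a : nat) (th) => x y a' t; nia.
  - split; first by rewrite !muln0 add0n addn0 leq_mul2r (ltnW tha) orbT.
    apply/eqP/eqP => [|<-]; last by rewrite !muln0.
    move: tha; move: (v2 a) (a : nat) (th) => y a' t; nia.
  - by rewrite addnC; split; rewrite ?eqxx.
have sums : (lweight u2 + th * mdeg v2 <= lweight v2 + th * mdeg u2
    ?= iff [forall a : 'I_n, (a == th :> nat) || (u2 a == v2 a)])%N.
  have := leqif_sum (fun a (_ : xpredT a) => term a).
  by rewrite !big_split /= -!big_distrr /= -!mdegE.
move: sums; rewrite d2 => -[]; rewrite leq_add2r eqn_add2r ltn_neqAle => -> eq.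
rewrite andbT eq; apply/forallP => al; apply: ne; apply/mnmP => a.
have oth (b : 'I_n) : b != a -> (a == th :> nat) -> u2 b = v2 b.
  move=> ba /eqP ath; case/orP: (al b) => [/eqP bth|/eqP //].
  by case/eqP: ba; apply: val_inj; rewrite /= bth ath.
case/orP: (al a) => [ath|/eqP //].
move: d2; rewrite !mdegE (bigD1 a) //= [in RHS](bigD1 a) //=.
rewrite (eq_bigr (fun b => v2 b)) => [/eqP|b ba]; last exact: oth.
by rewrite eqn_add2r => /eqP.
Qed.

Lemma weight_merge_row j m : weight m = (weight (merge_row j m) + lweight (m j.+1))%N.
Proof.
have : rmM (merge_row j m) (rowm j.+1 (m j.+1)) = rmM m (rowm j (m j.+1)).
  apply/rmP => i; rewrite !rmME merge_rowE !rowmE.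
  case: (i =P j) => [->|_]; first by rewrite -[j == _]/(j == j.+1) ltn_eqF ?addm0.
  by case: (i =P j.+1) => [->|//]; rewrite add0m addm0.
move/(congr1 (@weight n)); rewrite !weightM !weight_rowm mulSn; lia.
Qed.

(** If m had no descent, then by [lweight_min] it would be strictly lighter than all
    other monomials with the same row degrees and the same merging. Being of greatest
    weight in t, it would be the only monomial of t with this merging, and its
    coefficient would survive in mu j t. *)
Lemma lead_descent j t m : mu j t = 0 -> m \in rsupp t ->
  (forall m', m' \in rsupp t -> mdeg (m' j) = mdeg (m j)) ->
  (forall m', m' \in rsupp t -> (weight m' <= weight m)%N) -> descent (m j) (m j.+1).
Proof.
move=> mut mt deg mx; apply: contraT => nd.
have := congr1 (rcoef (merge_row j m)) mut; rewrite linear0 rcoef_mlift.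
rewrite (bigD1_seq m) ?rsupp_uniq //= rcoefX eqxx mulr1.
rewrite big_seq_cond big1 ?addr0 => [/eqP mt0|m' /andP[m't m'm]].
  by move: mt; rewrite rsuppE mt0.
rewrite rcoefX; case: (merge_row j m' =P merge_row j m) => [e|]; last by rewrite mulr0.
have ej i : i != j -> i != j.+1 -> m' i = m i.
  by move=> /negPf h /negPf h'; have/rmP/(_ i) := e; rewrite !merge_rowE h h'.
have/rmP/(_ j) := e; rewrite !merge_rowE eqxx => ee.
have d1 := deg _ m't.
have d2 : mdeg (m j.+1) = mdeg (m' j.+1).
  by have := congr1 (@mdeg n) ee; rewrite !mdegD d1 => /addnI ->.
have : (lweight (m j.+1) < lweight (m' j.+1))%N.
  apply: (lweight_min (esym ee) d2 nd) => ee1.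
  case/eqP: m'm; apply/rmP => i; case: (i =P j.+1) => [->//|/eqP ij1].
  case: (i =P j) => [->|/eqP ij]; last exact: ej.
  by move: ee; rewrite ee1 => /addIm.
by move=> lt; have := mx _ m't; rewrite (weight_merge_row j m')
  (weight_merge_row j m) e leq_add2l leqNgt lt.
Qed.

Definition lin_closed (E : A -> Prop) :=
  E 0 /\ forall c x y, E x -> E y -> E (c *: x + y).

(** A leading coefficient 1 can be used for reduction over every k. *)
Definition leads (x : A) (m : K) : Prop :=
  rcoef m x = 1 /\ forall m', m' \in rsupp x -> m' != m -> (weight m' < weight m)%N.

(** By induction on the weight: subtracting multiples of elements of P and E that are
    led by the monomials of greatest weight in t leaves an element of P of smaller
    weight. The leading elements are lighter elsewhere, so the monomials of greatest
    weight can be removed one by one. *)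
Lemma triangular_span (P E : A -> Prop) (good : K -> Prop) :
  lin_closed P -> lin_closed E ->
  (forall t m, P t -> m \in rsupp t ->
     (forall m', m' \in rsupp t -> (weight m' <= weight m)%N) -> good m) ->
  (forall m, good m -> exists x, [/\ P x, E x & leads x m]) ->
  forall t, P t -> E t.
Proof.
move=> [P0 PD] [E0 ED] Pgood goodE.
suff main N t : P t -> (forall m, m \in rsupp t -> (weight m < N)%N) -> E t.
  move=> t Pt; apply: (main (\max_(m <- rsupp t) weight m).+1) => // m mt.
  by rewrite ltnS (bigD1_seq m) ?rsupp_uniq //= leq_maxl.
elim: N t => [|N IH] t Pt tN.
  suff -> : t = 0 by [].
  rewrite [t]rowring_sum; case e: (rsupp t) => [|m s]; first by rewrite big_nil.
  by have := tN m; rewrite e inE eqxx => /(_ isT).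
pose T := [seq m <- rsupp t | weight m == N].
have gT m : m \in T -> good m.
  rewrite mem_filter => /andP[/eqP mN mt]; apply: (Pgood t) => // m' /tN.
  by rewrite mN.
(* x agrees with t at the monomials of weight N in s, and is lighter elsewhere. *)
suff main (s : seq K) : uniq s -> {subset s <= T} -> exists x, [/\ P x, E x,
    forall m, m \in s -> rcoef m x = rcoef m t &
    forall m, m \in rsupp x -> m \notin s -> (weight m < N)%N].
  have [x [Px Ex xT xN]] := main T (filter_uniq _ (rsupp_uniq t)) (fun _ => id).
  have -> : t = 1 *: x + (t - x) by rewrite scale1r addrC subrK.
  apply: ED => //.
  apply: IH => [|m]; first by rewrite addrC -[- x]scaleN1r; apply: PD.
  rewrite rsuppE linearB /=; case: (boolP (m \in T)) => [mT|mNT].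
    by rewrite xT // subrr eqxx.
  case: (boolP (m \in rsupp x)) => [mx _|]; first exact: xN.
  rewrite rsuppE negbK => /eqP ->; rewrite subr0 -rsuppE => mt.
  by have := tN _ mt; move: mNT; rewrite mem_filter mt andbT; lia.
elim: s => [_ _|m s IHs /andP[ms us] sT].
  exists 0; split=> // m; rewrite rsuppE linear0 eqxx //.
have [x [Px Ex xs xN]] := IHs us (fun a h => sT a (mem_behead (s := m :: s) h)).
have mT : m \in T by apply: sT; rewrite inE eqxx.
have [y [Py Ey [my yl]]] := goodE _ (gT _ mT).
have wN a : a \in T -> weight a = N by rewrite mem_filter => /andP[/eqP].
have xm : rcoef m x = 0.
  apply/eqP/negPn/negP; rewrite -rsuppE => mx.
  by have := xN _ mx ms; rewrite wN // ltnn.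
exists (rcoef m t *: y + x); split=> // [||a|a].
- exact: PD.
- exact: ED.
- rewrite inE linearP /= => /orP[/eqP ->|as_]; first by rewrite my xm mulr1 addr0.
  suff -> : rcoef a y = 0 by rewrite mulr0 add0r xs.
  apply/eqP/negPn/negP; rewrite -rsuppE => ay.
  have am : a != m by apply: contraNneq ms => <-.
  have aT : a \in T by apply: sT; rewrite inE as_ orbT.
  by have := yl _ ay am; rewrite !wN // ltnn.
rewrite rsuppE linearP /= inE negb_or => ne /andP[am as_].
case: (boolP (a \in rsupp x)) => [ax|]; first exact: xN.
rewrite rsuppE negbK => /eqP ax; move: ne; rewrite ax addr0.
case: (boolP (a \in rsupp y)) => [ay _|]; first by rewrite -(wN m mT); apply: yl.
by rewrite rsuppE negbK => /eqP ->; rewrite mulr0 eqxx.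
Qed.

(** From the greatest weight downwards: the coefficient of a vanishing combination at m
    is c m plus contributions of heavier indices, whose coefficients vanish already. *)
Lemma leads_free (s : seq K) (c : K -> k) (b : K -> A) :
  uniq s -> (forall m, m \in s -> leads (b m) m) ->
  \sum_(m <- s) c m *: b m = 0 -> forall m, m \in s -> c m = 0.
Proof.
move=> us sb s0.
suff main N m : (\max_(m <- s) weight m < weight m + N)%N -> m \in s -> c m = 0.
  by move=> m; apply: (main (\max_(m <- s) weight m).+1); rewrite addnS ltnS leq_addl.
elim: N m => [|N IH] m mN ms.
  by move: mN; rewrite addn0 (bigD1_seq m) //= ltnNge leq_maxl.
have := congr1 (rcoef m) s0; rewrite linear_sum linear0 /= (bigD1_seq m) //=.
rewrite linearZ /=; have [-> _] := sb _ ms; rewrite mulr1.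
rewrite big_seq_cond big1 ?addr0 // => a /andP[as_ am]; rewrite linearZ /=.
case: (boolP (m \in rsupp (b a))) => [mb|]; last first.
  by rewrite rsuppE negbK => /eqP ->; rewrite mulr0.
have [_ /(_ _ mb)] := sb _ as_; rewrite eq_sym => /(_ am) lt.
by rewrite IH ?mul0r //; lia.
Qed.

End Leading.

(** * Antisymmetrization over columns and its leading monomial *)

Section Antisym.
Variables (k : comNzRingType) (n : nat) (C : finType) (rw cl : C -> nat).
Local Notation K := (rowmon n).
Local Notation A := (rowring k n).
Local Notation S := {mpoly k[n]}.

Definition col_stable (w : {perm C}) : bool := [forall c, cl (w c) == cl c].

Lemma col_stableP (w : {perm C}) : reflect (forall c, cl (w c) = cl c) (col_stable w).
Proof. by apply: (iffP forallP) => h c; apply/eqP. Qed.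

Definition antisym (v : C -> S) : A :=
  \sum_(w : {perm C} | col_stable w)
    (-1) ^+ w *: \prod_c iota_ (rw c) (v (w c)).

(** Exchanging the entries of p and q does not change the merged product but changes the
    sign of the permutation: the terms cancel in pairs. *)
Lemma mu_antisym j p q v : cl p = cl q -> rw p = j -> rw q = j.+1 ->
  mu j (antisym v) = 0.
Proof.
move=> clpq rp rq; rewrite /antisym linear_sum.
have pq : p != q by apply: contra_eqN clpq => /eqP e; move: rq; rewrite -e rp; lia.
pose rw' c := if rw c == j.+1 then j else rw c.
pose F (w : {perm C}) : A := \prod_c iota_ (rw' c) (v (w c)).
rewrite (eq_bigr (fun w : {perm C} => (-1) ^+ w *: F w)); last first.
  move=> w _; rewrite linearZ /= rmorph_prod; congr (_ *: _).
  by apply: eq_bigr => c _; rewrite /= mu_iota.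
pose t := tperm p q.
have rwt c : rw' (t c) = rw' c.
  rewrite /rw' /t; case: tpermP => [->|->|//]; rewrite rp rq eqxx //.
  - by rewrite ltn_eqF.
  by rewrite ltn_eqF.
have clt c : cl (t c) = cl c by rewrite /t; case: tpermP => [->|->|].
have Ft w : F (t * w)%g = F w.
  rewrite /F (reindex_inj (@perm_inj _ t)) /=; apply: eq_bigr => c _.
  by rewrite rwt permM /t tpermK.
rewrite (bigID (@odd_perm C)) /= addrC.
apply: canLR (subrK _) _; rewrite add0r -sumrN.
rewrite (reindex_inj (mulgI t)) /=; apply: eq_big => [w|w /andP[_ ow]].
  rewrite odd_permM odd_tperm pq /= negbK; congr (_ && _).
  by apply/col_stableP/col_stableP => h c; have := h (t c);
    rewrite ?permM /t ?tpermK ?clt //;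
     rewrite -/t ?clt // => <-; rewrite -[in RHS]clt.
rewrite Ft odd_permM odd_tperm pq /= -scaleNr.
by case: (odd_perm w); rewrite /= ?expr0 ?expr1 ?opprK.
Qed.

Section Rearrangement.
Variable f : C -> 'I_n.
Hypothesis inc : forall c c', cl c = cl c' -> (rw c < rw c')%N -> (f c < f c')%N.
Hypothesis inj : forall c c', cl c = cl c' -> rw c = rw c' -> c = c'.

(** The rearrangement inequality in each column. Exchanging the entries of the lowest
    misplaced cell p and of the cell q that received the entry of p puts the latter back
    and strictly increases the sum. *)
Lemma rearrangement (w : {perm C}) : col_stable w -> w != 1%g ->
  (\sum_c rw c * f (w c) < \sum_c rw c * f c)%N.
Proof.
elim: {w}_.+1 {-2}w (ltnSn #|[pred c | w c != c]|) => // N IH w.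
rewrite ltnS => wN /col_stableP cw w1.
have [c0 wc0] : exists c, w c != c.
  apply/existsP; apply: contraNT w1; rewrite negb_exists => /forallP h.
  by apply/eqP/permP => c; rewrite perm1; apply/eqP; have := h c; rewrite negbK.
case: (arg_minnP (P := fun c => w c != c) rw wc0) => p wp pmin.
pose q := (w^-1)%g p; have wq : w q = p by rewrite /q permKV.
have qp : q != p by apply: contraNneq wp => e; rewrite -{1}e wq.
have clq : cl p = cl q by rewrite -wq cw.
have rpq : (rw p < rw q)%N.
  rewrite ltn_neqAle pmin ?wq 1?eq_sym // andbT.
  by apply: contraNneq qp => e; apply/eqP/inj.
have rwp : (rw p < rw (w p))%N.
  rewrite ltn_neqAle pmin ?(inj_eq perm_inj) // andbT.
  by apply: contraNneq wp => e; apply/eqP/inj.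
have fp : (f p < f (w p))%N by apply: inc; rewrite ?cw.
pose w' := (tperm p q * w)%g.
have w'p : w' p = p by rewrite /w' permM tpermL.
have w'q : w' q = w p by rewrite /w' permM tpermR.
have w'o c : c != p -> c != q -> w' c = w c.
  by move=> cp cq; rewrite /w' permM tpermD // eq_sym.
have lt : (\sum_c rw c * f (w c) < \sum_c rw c * f (w' c))%N.
  rewrite (bigD1 p) //= (bigD1 q) //= [X in (_ < X)%N](bigD1 p) //=.
  rewrite [X in (_ < _ + X)%N](bigD1 q) //= w'p w'q wq.
  rewrite [X in (_ < _ + (_ + X))%N](eq_bigr (fun c => rw c * f (w c))%N).
    rewrite !addnA ltn_add2r; move: rpq fp.
    move: (rw p) (rw q) (nat_of_ord (f p)) (nat_of_ord (f (w p))) => a b x y; nia.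
  by move=> c /andP[cp cq]; rewrite w'o.
have [w'1|w'1] := eqVneq w' 1%g.
  apply: leq_trans lt _; apply: leq_sum => c _.
  by rewrite w'1 perm1.
apply: ltn_trans lt _; apply: IH w'1; last first.
  apply/col_stableP => c; case: (c =P p) => [->|/eqP cp]; first by rewrite w'p.
  case: (c =P q) => [->|/eqP cq]; first by rewrite w'q cw.
  by rewrite w'o.
apply: leq_trans wN; apply: proper_card; apply/properP; split.
  apply/subsetP => c; rewrite !inE; case: (c =P p) => [->|/eqP cp].
    by rewrite w'p eqxx.
  case: (c =P q) => [-> _|/eqP cq]; first by rewrite wq eq_sym.
  by rewrite w'o.
by exists p; rewrite !inE ?w'p ?eqxx.
Qed.

Definition fill_mon (w : {perm C}) : K :=
  \big[@monalg.mmul K/monalg.mone]_c rowm (rw c) U_(f (w c))%MM.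

Lemma weight_fill_mon w : weight (fill_mon w) = (\sum_c rw c * f (w c))%N.
Proof.
have wt1 : weight (monalg.mone : K) = 0%N.
  by rewrite -[monalg.mone]/(rm1 n); have := weightM (rm1 n) (rm1 n); rewrite rm1M; lia.
rewrite /fill_mon (big_morph _ (@weightM n) wt1); apply: eq_bigr => c _.
rewrite weight_rowm /lweight (bigD1 (f (w c))) //= mnm1E eqxx muln1 big1 ?addn0 //.
by move=> a; rewrite mnm1E eq_sym => /negPf ->; rewrite muln0.
Qed.

Lemma fill_monE w j : fill_mon w j = (\sum_(c | rw c == j) U_(f (w c)))%MM.
Proof.
rewrite /fill_mon (big_morph (fun m : K => m j) (id1 := 0%MM) (op1 := @mnm_add n)).
- rewrite [RHS]big_mkcond; apply: eq_bigr => c _.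
  by rewrite rowmE eq_sym.
- by move=> x y; rewrite /monalg.mmul /= rmME.
- by rewrite rm1E.
Qed.

Lemma antisymX :
  antisym (fun c => 'X_(f c)) =
  \sum_(w : {perm C} | col_stable w) (-1) ^+ w *: rX k (fill_mon w).
Proof.
apply: eq_bigr => w _; congr (_ *: _).
rewrite /fill_mon (big_morph (@rX k n) (id1 := 1) (op1 := *%R)) //.
- by apply: eq_bigr => c _; rewrite iotaX.
- by move=> x y; rewrite rXM.
- by rewrite -rX1.
Qed.

(** By [rearrangement] the identity permutation alone gives the greatest weight. *)
Lemma antisym_leads : leads (antisym (fun c => 'X_(f c))) (fill_mon 1%g).
Proof.
have colp1 : col_stable 1%g by apply/col_stableP => c; rewrite perm1.
have lt w : col_stable w -> w != 1%g -> (weight (fill_mon w) < weight (fill_mon 1%g))%N.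
  move=> cw w1; rewrite !weight_fill_mon; under [X in (_ < X)%N]eq_bigr do rewrite
    perm1.
  exact: rearrangement.
rewrite antisymX; split.
  rewrite linear_sum (bigD1 1%g) //= linearZ /= rcoefX eqxx odd_perm1 expr0 mulr1.
  rewrite big1 ?addr0 // => w /andP[cw w1]; rewrite linearZ /= rcoefX.
  by case: eqP (lt _ cw w1) => [->|_ _]; rewrite ?ltnn ?mulr0.
move=> m'; rewrite rsuppE linear_sum => h m'1; move: h.
apply: contraR; rewrite -leqNgt => le; rewrite big1 // => w cw.
rewrite linearZ /= rcoefX; case: eqP => [e|]; last by rewrite mulr0.
have w1 : w != 1%g by apply: contraNneq m'1 => <-; rewrite e.
by have := lt _ cw w1; rewrite e ltnNge le.
Qed.

End Rearrangement.
End Antisym.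

(** * Cells of a ribbon *)

Section RibbonCells.
Variables (al : nat -> nat) (al_gt0 : forall t, (0 < al t)%N) (l : nat).

(** The first column of row t. *)
Definition row_start (t : nat) : nat := (\sum_(u < t) (al u).-1)%N.

Lemma row_startS t : row_start t.+1 = (row_start t + (al t).-1)%N.
Proof. by rewrite /row_start big_ord_recr. Qed.

Lemma row_start_le t t' : (t <= t')%N -> (row_start t <= row_start t')%N.
Proof.
move/subnK <-; elim: (t' - t)%N => // e IH.
by rewrite addSn row_startS (leq_trans IH) // leq_addr.
Qed.

Local Notation D := (ribbon (mkseq al l)).

Lemma mem_ribbon (x : nat * nat) : (x \in D) =
  (x.1 < l)%N && (row_start (l.-1 - x.1) <= x.2 < row_start (l.-1 - x.1)
    + al (l.-1 - x.1))%N.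
Proof.
have offE t : (t <= l)%N -> sumn [seq a.-1 | a <- take t (mkseq al l)] = row_start t.
  move=> tl; rewrite /mkseq -map_take take_iota (minn_idPl tl) -map_comp sumnE.
  by rewrite big_map /row_start -{1}[t]subn0 -/(index_iota 0 t) big_mkord.
rewrite /ribbon in_fset size_mkseq; apply/allpairsPdep/idP => /=.
  case=> t [j [tl jt ->]] /=; move: tl jt; rewrite !mem_iota /= !add0n => tl.
  rewrite nth_mkseq // => jt; rewrite offE ?(ltnW tl) //.
  have -> : (l.-1 - (l - t.+1) = t)%N by lia.
  by rewrite leq_addr ltn_add2l jt andbT; lia.
case/andP=> xl /andP[ox xo]; exists (l.-1 - x.1)%N, (x.2 - row_start (l.-1 - x.1))%N.
have tl : (l.-1 - x.1 < l)%N by lia.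
rewrite !mem_iota /= !add0n nth_mkseq // tl; split=> //.
  by move: ox xo; lia.
rewrite offE ?(ltnW tl) // subnKC //.
have -> : (l - (l.-1 - x.1).+1 = x.1)%N by lia.
by case: (x).
Qed.

(** Rows are counted from the bottom here, in contrast to the matrix coordinates of
    cells. *)
Definition crow (c : D) : nat := (l.-1 - (val c).1)%N.
Definition ccol (c : D) : nat := (val c).2.
Definition cpos (c : D) : nat := (ccol c - row_start (crow c))%N.

Lemma crow_lt c : (crow c < l)%N.
Proof. by have := valP c; rewrite mem_ribbon /crow => /andP[h _]; lia. Qed.

Lemma ccolE c : ccol c = (row_start (crow c) + cpos c)%N.
Proof.
by have := valP c; rewrite mem_ribbon => /and3P[_ h _]; rewrite /cpos subnKC.
Qed.

Lemma cpos_lt c : (cpos c < al (crow c))%N.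
Proof.
have := valP c; rewrite mem_ribbon => /and3P[_ h].
by rewrite -/(ccol c) ccolE ltn_add2l.
Qed.

Lemma cell_inj c c' : crow c = crow c' -> ccol c = ccol c' -> c = c'.
Proof.
move=> r e; apply: val_inj.
have := valP c; have := valP c'; rewrite !mem_ribbon => /andP[h' _] /andP[h _].
move: r e h h'; rewrite /crow /ccol; case: (val c) (val c') => [a b] [a' b'] /=.
by move=> r -> h h'; congr (_, _); lia.
Qed.

Fact cell_subproof t j : (t < l)%N -> (j < al t)%N ->
  ((l - t.+1)%N, (row_start t + j)%N) \in D.
Proof.
move=> tl jt; rewrite mem_ribbon /=.
have -> : (l.-1 - (l - t.+1) = t)%N by lia.
by rewrite leq_addr ltn_add2l jt andbT; lia.
Qed.

Definition cell t j (tl : (t < l)%N) (jt : (j < al t)%N) : D :=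
  [` cell_subproof tl jt]%fset.

Lemma crow_cell t j tl jt : crow (@cell t j tl jt) = t.
Proof. by rewrite /crow /=; lia. Qed.
Lemma ccol_cell t j tl jt : ccol (@cell t j tl jt) = (row_start t + j)%N.
Proof. by []. Qed.
Lemma cpos_cell t j tl jt : cpos (@cell t j tl jt) = j.
Proof. by rewrite /cpos crow_cell ccol_cell addKn. Qed.

Lemma row_big (T : Type) (idx : T) (op : Monoid.com_law idx) t (F : nat -> T) :
  (t < l)%N -> \big[op/idx]_(c : D | crow c == t) F (cpos c) =
    \big[op/idx]_(j < al t) F j.
Proof.
move=> tl; pose h (j : 'I_(al t)) := cell tl (ltn_ord j).
pose h' (c : D) : 'I_(al t) := insubd (Ordinal (al_gt0 t)) (cpos c).
rewrite (reindex_onto h h') /=; last first.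
  move=> c /eqP ct; apply: cell_inj; rewrite ?crow_cell // ccol_cell ccolE ct.
  by rewrite val_insubd -ct cpos_lt.
apply: eq_big => [j|j _]; last by rewrite cpos_cell.
by rewrite crow_cell eqxx /h' cpos_cell; apply/eqP/val_inj; rewrite val_insubd ltn_ord.
Qed.

Lemma card_row t : (t < l)%N -> #|[pred c : D | crow c == t]| = al t.
Proof.
move=> tl; rewrite -sum1_card; under eq_bigl do rewrite inE.
by rewrite (row_big _ (fun=> 1%N) tl) sum1_card card_ord.
Qed.

Lemma card_row0 t : (l <= t)%N -> #|[pred c : D | crow c == t]| = 0%N.
Proof.
move=> lt; apply: eq_card0 => c; rewrite inE; apply/negbTE/eqP => e.
by have := crow_lt c; rewrite e ltnNge lt.
Qed.

(** Rows overlap in one column only, so all rows strictly between two cells of a column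
    have length 1. *)
Lemma ribbon_column c c' : ccol c = ccol c' -> (crow c < crow c')%N ->
  [/\ cpos c = (al (crow c)).-1, cpos c' = 0%N & row_start (crow c') =
    row_start (crow c).+1].
Proof.
rewrite !ccolE => e lt; have := row_start_le lt; rewrite row_startS.
by have := cpos_lt c; have := al_gt0 (crow c); move: e; split; lia.
Qed.

End RibbonCells.

(** * Fillings of a ribbon with descents *)

Section Filling.
Variables (k : comNzRingType) (n : nat).
Variables (al : nat -> nat) (al_gt0 : forall t, (0 < al t)%N) (l : nat).
Local Notation K := (rowmon n).
Local Notation A := (rowring k n).
Local Notation D := (ribbon (mkseq al l)).

Definition shape (m : K) : Prop :=
  forall j, if (j < l)%N then mdeg (m j) = al j else m j = 0%MM.

Definition tab (m : K) : Prop :=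
  shape m /\ forall j, (j.+1 < l)%N -> descent (m j) (m j.+1).

(** The letters of u with multiplicity, in decreasing order: at the right end of a row
    is then its smallest letter, which a descent makes smaller than the greatest letter
    of the next row, above it in their shared column. *)
Definition letters (u : 'X_{1..n}) : seq 'I_n :=
  sort (fun a b : 'I_n => (b <= a)%N) (flatten [seq nseq (u a) a | a <- enum 'I_n]).

Lemma count_letters u a : count_mem a (letters u) = u a.
Proof.
rewrite /letters (seq.permP (permEl (perm_sort _ _)))
  count_flatten -map_comp sumnE big_map.
rewrite big_enum /= (bigD1 a) //= big1 => [|b ba].
  by rewrite addn0 count_nseq /= eqxx mul1n.
by rewrite count_nseq /= (negPf ba) mul0n.
Qed.

Lemma mem_letters u a : (a \in letters u) = (u a != 0%N).
Proof. by rewrite -has_pred1 has_count count_letters lt0n. Qed.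

Lemma sum_letters u : (\sum_(a <- letters u) U_(a))%MM = u.
Proof.
apply/mnmP => a; rewrite mnm_sumE -[RHS]count_letters -sum1_count [RHS]big_mkcond.
by apply: eq_bigr => b _; rewrite mnm1E.
Qed.

Lemma size_letters u : size (letters u) = mdeg u.
Proof.
rewrite -{2}[u]sum_letters mdeg_sum; under [RHS]eq_bigr do rewrite mdeg1.
by rewrite sum1_size.
Qed.

Lemma letters_nth x0 u i j : (i <= j)%N -> (j < mdeg u)%N ->
  (nth x0 (letters u) j <= nth x0 (letters u) i)%N.
Proof.
move=> ij ju; have srt : sorted (fun a b : 'I_n => (b <= a)%N) (letters u).
  by apply: sort_sorted => a b; rewrite leq_total.
apply: (sorted_leq_nth _ _ x0 srt) => //; rewrite ?inE ?size_letters //.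
  by move=> b a c /= ab bc; apply: leq_trans ab.
exact: leq_ltn_trans ju.
Qed.

Section Fill.
Variables (x0 : 'I_n) (y : K) (ty : tab y).

Let F t i := nth x0 (letters (y t)) i.

Lemma tab_deg t : (t < l)%N -> mdeg (y t) = al t.
Proof. by move=> tl; have := ty.1 t; rewrite tl. Qed.

Lemma fill_step t : (t.+1 < l)%N -> (F t (al t).-1 < F t.+1 0)%N.
Proof.
move=> tl; have /descentP[a [b [ab ya yb]]] := ty.2 _ tl.
have tl' := ltnW tl.
have /(nthP x0)[i + ea] : a \in letters (y t) by rewrite mem_letters.
have /(nthP x0)[j + eb] : b \in letters (y t.+1) by rewrite mem_letters.
rewrite !size_letters !tab_deg // => jb ia.
apply: (@leq_ltn_trans a).
  by rewrite -ea; apply: letters_nth; rewrite ?tab_deg ?prednK // -ltnS prednK.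
by apply: (leq_trans ab); rewrite -eb; apply: letters_nth; rewrite ?tab_deg.
Qed.

(** A column can pass through several rows of length 1; its steps are junctions of
    adjacent rows. *)
Lemma fill_col t t' : (t < t')%N -> (t' < l)%N -> row_start al t' = row_start al t.+1 ->
  (F t (al t).-1 < F t' 0)%N.
Proof.
elim: t' => // t' IH; rewrite ltnS leq_eqVlt => /predU1P[<- tl _|tt' tl e].
  exact: fill_step.
have e' : row_start al t' = row_start al t.+1.
  by have := @row_start_le al _ _ tt'; have := @row_start_le al _ _ (leqnSn t');
    rewrite e; lia.
apply: ltn_trans (IH tt' (ltnW tl) e') _.
have al1 : (al t').-1 = 0%N by move: e; rewrite row_startS e'; lia.
by have := fill_step tl; rewrite al1.
Qed.

Definition fill (c : D) : 'I_n := F (crow c) (cpos c).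

Lemma fill_inc c c' : ccol c = ccol c' -> (crow c < crow c')%N -> (fill c < fill c')%N.
Proof.
move=> e lt; have [p p' o] := ribbon_column al_gt0 e lt.
by rewrite /fill p p'; apply: fill_col => //; apply: crow_lt.
Qed.

Lemma fill_mon_fill : fill_mon (@crow al l) fill 1%g = y.
Proof.
apply/rmP => t; rewrite fill_monE; under eq_bigr => c /eqP ct do rewrite perm1 /fill ct.
have [tl|lt] := ltnP t l; last first.
  have := ty.1 t; rewrite ltnNge lt /= => ->; rewrite big_pred0 // => c.
  by apply/negbTE/eqP => e; have := crow_lt c; rewrite e ltnNge lt.
rewrite (row_big al_gt0 _ (fun i => U_(F t i))%MM tl) -[RHS]sum_letters.
by rewrite (big_nth x0) size_letters tab_deg // big_mkord.
Qed.
End Fill.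

Lemma fill_mon_shape (f : D -> 'I_n) w : shape (fill_mon (@crow al l) f w).
Proof.
move=> j; case: ltnP => [jl|lj].
  rewrite fill_monE mdeg_sum; under eq_bigr do rewrite mdeg1.
  by rewrite sum1_card card_row.
rewrite fill_monE big_pred0 // => c.
by apply/negbTE/eqP => e; have := crow_lt c; rewrite e ltnNge lj.
Qed.

Lemma mu_ribbon j v : (j.+1 < l)%N ->
  mu j (antisym (@crow al l) (@ccol al l) v : A) = 0.
Proof.
move=> jl; have jl' := ltnW jl.
have lastj : ((al j).-1 < al j)%N by rewrite prednK.
apply: (@mu_antisym _ _ _ _ _ _ (cell jl' lastj) (cell jl (al_gt0 j.+1))).
- by rewrite !ccol_cell addn0 row_startS.
- by rewrite crow_cell.
- by rewrite crow_cell.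
Qed.

Lemma tab_antisym y : tab y -> exists f : D -> 'I_n,
  leads (antisym (@crow al l) (@ccol al l) (fun c => 'X_(f c)) : A) y.
Proof.
(* Without letters there is no default value for fill, but there are no cells
   either. *)
move=> ty; case: (pickP 'I_n) => [x0 _|n0]; last first.
  have nc (c : D) : False.
    have := tab_deg ty (crow_lt c); rewrite mdegE big_pred0 => [e|a].
      by have := al_gt0 (crow c); rewrite -e.
    by have := n0 a.
  pose f (c : D) : 'I_n := match nc c with end.
  have -> : y = fill_mon (@crow al l) f 1%g.
    apply/rmP => j; rewrite fill_monE big_pred0 => [|c]; last by case: (nc c).
    by apply/mnmP => a; have := n0 a.
  by exists f; apply: antisym_leads => c; case: (nc c).
exists (fill x0 y); rewrite -{2}(fill_mon_fill x0 ty); apply: antisym_leads.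
  by move=> c c'; apply: fill_inc.
by move=> c c' e e'; apply: cell_inj.
Qed.

Lemma antisym_shape (f : D -> 'I_n) m :
  m \in rsupp (antisym (@crow al l) (@ccol al l) (fun c => 'X_(f c)) : A) -> shape m.
Proof.
rewrite antisymX rsuppE linear_sum => h; apply: contraPP h => nsh.
apply/negP; rewrite negbK big1 // => w _; rewrite linearZ /= rcoefX.
by case: eqP => [e|_]; rewrite ?mulr0 //; case: nsh; rewrite -e; apply: fill_mon_shape.
Qed.

End Filling.

(** * Spanning common kernels by antisymmetrized fillings *)

Section Shift.
Variables (k : comNzRingType) (n : nat).
Local Notation K := (rowmon n).
Local Notation A := (rowring k n).

Lemma rmM_inj (m : K) : injective (fun m' => rmM m' m).
Proof. by move=> x y /rmP e; apply/rmP => j; have := e j; rewrite !rmME => /addIm. Qed.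

Lemma rcoef_shift (m m' : K) (x : A) : rcoef (rmM m m') (x * rX k m') = rcoef m x.
Proof.
elim/rowring_ind: x => [|c a x IH]; first by rewrite mul0r !linear0.
rewrite mulrDl -scalerAl !linearP /= IH rXM !rcoefX; congr (_ * _%:R + _).
by rewrite (inj_eq (@rmM_inj m')).
Qed.

Lemma rsupp_shift (m' : K) (x : A) a : a \in rsupp (x * rX k m') ->
  exists2 m, m \in rsupp x & a = rmM m m'.
Proof.
rewrite rsuppE => h; suff [m e] : exists m, a = rmM m m'.
  by exists m; rewrite // rsuppE -(rcoef_shift m m') -e.
apply: contraPP h => ne; apply/negP; rewrite negbK; apply/eqP.
elim/rowring_ind: x => [|c b x IH]; first by rewrite mul0r linear0.
rewrite mulrDl -scalerAl linearP /= IH rXM rcoefX addr0.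
by case: eqP => [e|_]; rewrite ?mulr0 //; case: ne; exists b.
Qed.

Lemma leads_shift (x : A) (m m' : K) : leads x m -> leads (x * rX k m') (rmM m m').
Proof.
move=> [xm lt]; split; first by rewrite rcoef_shift.
move=> a /rsupp_shift[b bx ->] ne; rewrite !weightM ltn_add2r lt //.
by apply: contraNneq ne => ->.
Qed.

Definition cut (l : nat) (m : K) : K := mkrm [seq j <- rows m | (j < l)%N] m.

Lemma cutE l m j : cut l m j = if (j < l)%N then m j else 0%MM.
Proof.
rewrite mkrmE mem_filter rowsE; case: (j < l)%N => //=.
by case: eqP => [->|].
Qed.

End Shift.

Section Spanning.
Variables (k : comNzRingType) (n : nat).
Variables (al : nat -> nat) (al_gt0 : forall t, (0 < al t)%N).
Local Notation K := (rowmon n).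
Local Notation A := (rowring k n).
Local Notation D l := (ribbon (mkseq al l)).

(** An antisymmetrized filling that is led by the monomial y. *)
Definition tab_elt l (y : K) : A :=
  if pselect (tab al l y) is left ty then
    antisym (@crow al l) (@ccol al l)
      (fun c => 'X_(projT1 (cid (tab_antisym k al_gt0 ty)) c))
  else 0.

Lemma tab_elt_antisym l y : tab al l y -> exists f : D l -> 'I_n,
  tab_elt l y = antisym (@crow al l) (@ccol al l) (fun c => 'X_(f c)).
Proof. by rewrite /tab_elt; case: pselect => // ty _; eexists. Qed.

Lemma tab_elt_leads l y : tab al l y -> leads (tab_elt l y) y.
Proof. by rewrite /tab_elt; case: pselect => // ty _; case: (cid _). Qed.

Lemma mu_tab_elt j l y : (j.+1 < l)%N -> mu j (tab_elt l y) = 0.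
Proof.
move=> jl; rewrite /tab_elt; case: pselect => [ty|_]; last exact: linear0.
exact: mu_ribbon.
Qed.

Lemma tab_elt_shape l y m : m \in rsupp (tab_elt l y) -> shape al l m.
Proof.
rewrite /tab_elt; case: pselect => [ty|_]; first exact: antisym_shape.
by rewrite rsuppE linear0 eqxx.
Qed.

(** The last row l contains a coefficient, from R or from a module over R, whose
    possible degrees are given by J. *)
Definition shape_last l (J : pred nat) (m : K) : Prop :=
  [/\ forall j, (j < l)%N -> mdeg (m j) = al j, J (mdeg (m l)) &
      forall j, (l < j)%N -> m j = 0%MM].

(** No condition is imposed on the junction with the coefficient row l. *)
Definition ker_rows l J (t : A) : Prop :=
  (forall m, m \in rsupp t -> shape_last l J m) /\
  forall j, (j.+1 < l)%N -> mu j t = 0.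

Lemma supp_lin (Q : K -> Prop) :
  lin_closed (fun t : A => forall m, m \in rsupp t -> Q m).
Proof.
split=> [m|c x y Qx Qy m]; first by rewrite rsuppE linear0 eqxx.
case: (boolP (m \in rsupp x)) => [/Qx //|]; case: (boolP (m \in rsupp y)) => [/Qy //|].
by rewrite !rsuppE linearP /= !negbK => /eqP -> /eqP ->; rewrite mulr0 addr0 eqxx.
Qed.

Lemma lin_closedI (P Q : A -> Prop) :
  lin_closed P -> lin_closed Q -> lin_closed (fun x => P x /\ Q x).
Proof.
move=> [P0 PD] [Q0 QD]; split=> [//|c x y [Px Qx] [Py Qy]].
by split; [apply: PD|apply: QD].
Qed.

Lemma mu_lin (I : nat -> Prop) : lin_closed (fun t : A => forall j, I j -> mu j t = 0).
Proof.
split=> [j _|c x y hx hy j Ij]; first exact: linear0.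
by rewrite linearP /= hx // hy // scaler0 addr0.
Qed.

(** By [lead_descent] a leading monomial of such an element has descents between its
    rows below l, so it is y times a monomial u in row l and leads tab_elt l y * iota_ l
    'X_[u]. *)
Lemma tab_span l (J : pred nat) (E : A -> Prop) : lin_closed E ->
  (forall y u, tab al l y -> J (mdeg u) -> E (tab_elt l y * iota_ l 'X_[u])) ->
  forall t, ker_rows l J t -> E t.
Proof.
move=> Ecl Egen.
apply: (triangular_span (good := fun m => tab al l (cut l m) /\ shape_last l J m))
  => //.
- exact: lin_closedI (supp_lin _) (mu_lin _).
- move=> t m [sh ker] mt mx; have [sl sJ s0] := sh _ mt; split=> //; split.
    by move=> j; rewrite cutE; case jl: (j < l)%N => //; apply: sl.
  move=> j jl; rewrite !cutE jl ltnW //.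
  apply: (lead_descent (ker j jl) mt _ mx) => m' /sh[sl' _ _].
  by rewrite sl ?sl' // ltnW.
move=> m [tm [sl sJ s0]]; pose y := cut l m; pose u := m l.
have em : m = rmM y (rowm l u).
  apply/rmP => j; rewrite rmME cutE rowmE.
  have [jl|lj|->] := ltngtP j l; rewrite ?addm0 ?add0m //; exact: s0.
exists (tab_elt l y * iota_ l 'X_[u]); split; last 2 first.
- exact: Egen.
- by rewrite iotaX em; apply/leads_shift/tab_elt_leads.
split=> [a|j jl]; last by rewrite rmorphM /= mu_tab_elt // mul0r.
rewrite iotaX => /rsupp_shift[b /tab_elt_shape bs ->]; split=> [j jl||j lj].
- by rewrite rmME rowmE (ltn_eqF jl) addm0; have := bs j; rewrite jl.
- by rewrite rmME rowmE eqxx; have := bs l; rewrite ltnn => ->; rewrite add0m.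
rewrite rmME rowmE (gtn_eqF lj) addm0; have := bs j.
by rewrite ltnNge (ltnW lj).
Qed.

(** Splitting off d greatest letters, d > 0, keeps every descent into u. *)
Lemma split_top (u : 'X_{1..n}) d : (d <= mdeg u)%N -> exists v w,
  [/\ u = (v + w)%MM, mdeg v = d &
   (0 < d)%N -> forall b, u b != 0%N -> exists2 b' : 'I_n, (b <= b')%N & v b' != 0%N].
Proof.
move=> du; pose V := take d (letters u); pose W := drop d (letters u).
exists (\sum_(a <- V) U_(a))%MM, (\sum_(a <- W) U_(a))%MM; split.
- by rewrite -big_cat cat_take_drop sum_letters.
- rewrite mdeg_sum; under eq_bigr do rewrite mdeg1.
  by rewrite sum1_size size_takel // size_letters.
move=> d0 b ub; exists (nth b (letters u) 0).
  move: (ub); rewrite -mem_letters => /(nthP b)[i iu e]; rewrite -{1}e.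
  by apply: letters_nth => //; rewrite -size_letters.
have : nth b (letters u) 0 \in V.
  by rewrite -(nth_take b d0); apply: mem_nth; rewrite size_takel ?size_letters.
move: (nth b _ _) => a aV; rewrite mnm_sumE.
apply: contraTneq aV => /eqP; rewrite sum_nat_seq_eq0 => /allP h; apply/negP => /h.
by rewrite mnm1E eqxx.
Qed.

(** This gives the exactness of the resolution below. Now the junction with the
    coefficient row l is among the kernel conditions, so a leading monomial also has a
    descent into row l. The al l greatest letters of this row become the last row of a
    tableau y, by [split_top] with the same descent, and the other letters become a
    coefficient u. The element tab_elt l.+1 y * iota_ l 'X_[u] is the image under the
    differential of the basis element y with coefficient u. *)
Lemma tab_split_span l (J : pred nat) (E : A -> Prop) : lin_closed E ->
  (forall y u, tab al l.+1 y -> J (mdeg u) -> E (tab_elt l.+1 y * iota_ l 'X_[u])) ->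
  forall t,
  (forall m : K, m \in rsupp t ->
     [/\ forall j, (j < l)%N -> mdeg (m j) = al j,
         (l == 0%N) || (0 < mdeg (m l))%N -> (al l <= mdeg (m l))%N && J (mdeg (m
           l) - al l)%N &
         forall j, (l < j)%N -> m j = 0%MM]) ->
  (forall j, (j < l)%N -> mu j t = 0) -> E t.
Proof.
move=> Ecl Egen t sht kert.
have : (forall m : K, m \in rsupp t ->
     [/\ forall j, (j < l)%N -> mdeg (m j) = al j,
         (l == 0%N) || (0 < mdeg (m l))%N -> (al l <= mdeg (m l))%N && J (mdeg (m
           l) - al l)%N &
         forall j, (l < j)%N -> m j = 0%MM]) /\
  (forall j, (j < l)%N -> mu j t = 0) by [].
move: t {sht kert}; apply: (triangular_span (good := fun m : K =>
   [/\ forall j, (j < l)%N -> mdeg (m j) = al j,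
       forall j, (j < l)%N -> descent (m j) (m j.+1),
       (al l <= mdeg (m l))%N && J (mdeg (m l) - al l)%N
     & forall j, (l < j)%N -> m j = 0%MM])) => //.
- exact: lin_closedI (supp_lin _) (mu_lin _).
- move=> t m [sh ker] mt mx; have [sl sJ s0] := sh _ mt.
  have ds j : (j < l)%N -> descent (m j) (m j.+1).
    move=> jl; apply: (lead_descent (ker j jl) mt _ mx) => m' /sh[sl' _ _].
    by rewrite sl ?sl'.
  (* The descent into row l makes this row nonempty. *)
  split=> //; apply: sJ; case: (posnP l) => [//|l0] /=.
  have /descentP[a [b [_ _ h]]] : descent (m l.-1) (m l) by rewrite -{2}(prednK l0)
    ds ?prednK.
  by rewrite lt0n mdeg_eq0; apply: contraNneq h => ->; rewrite mnm0E.
move=> m [sl sd /andP[ld sJ] s0].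
have [v [w [e dv top]]] := split_top ld.
pose y : K := rmM (cut l m) (rowm l v).
have yl j : (j < l)%N -> y j = m j.
  by move=> jl; rewrite rmME cutE rowmE jl (ltn_eqF jl) addm0.
have yv : y l = v by rewrite rmME cutE rowmE ltnn eqxx add0m.
have y0 j : (l < j)%N -> y j = 0%MM.
  by move=> lj; rewrite rmME cutE rowmE (gtn_eqF lj) ltnNge (ltnW lj) addm0.
have em : m = rmM y (rowm l w).
  apply/rmP => j; rewrite rmME rowmE.
  have [jl|lj|->] := ltngtP j l; first by rewrite addm0 yl.
    by rewrite addm0 y0 // s0.
  by rewrite yv.
have ty : tab al l.+1 y.
  split=> j; rewrite ltnS.
    have [jl|/y0 //|->] := ltngtP j l; first by rewrite yl // sl.
    by rewrite yv.
  move=> jl; rewrite yl //; have := sd j jl.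
  have [j1l|j1l|j1l] := ltngtP j.+1 l; first by rewrite yl.
    by move: jl j1l; lia.
  rewrite j1l yv => /descentP[a [b [ab ma mb]]]; apply/descentP.
  (* A greater letter among those split off keeps the descent from row j. *)
  have [b' bb' vb'] := top (al_gt0 l) b mb.
  by exists a, b'; split=> //; apply: leq_trans bb'.
have dw : mdeg (m l) = (al l + mdeg w)%N by rewrite e mdegD dv.
exists (tab_elt l.+1 y * iota_ l 'X_[w]); split; last 2 first.
- by apply: Egen => //; move: sJ; rewrite dw addKn.
- by rewrite iotaX em; apply/leads_shift/tab_elt_leads.
split=> [a|j jl]; last by rewrite rmorphM /= mu_tab_elt // mul0r.
rewrite iotaX => /rsupp_shift[b /tab_elt_shape bs ->]; split=> [j jl|_|j lj].
- by rewrite rmME rowmE (ltn_eqF jl) addm0; have := bs j; rewrite ltnS (ltnW jl).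
- have := bs l; rewrite ltnS leqnn => bl; rewrite rmME rowmE eqxx mdegD bl leq_addr
  addKn.
  by move: sJ; rewrite dw addKn.
rewrite rmME rowmE (gtn_eqF lj) addm0; have := bs j.
by rewrite ltnS leqNgt lj.
Qed.

End Spanning.

(** * Maps out of quotients and tensor products *)

(* The quotient of a module, not a quotient morphism of finite groups. *)
Local Notation quotm := Defs.quotm.

Section QuotLift.
Variables (R R' : comNzRingType) (th : {rmorphism R -> R'}).
Variables (M : lmodType R) (Q : lmodType R') (G : M -> Prop).
Variable f : {linear M -> Q | th \; *:%R}.
Hypothesis fG : forall x, G x -> f x = 0.

Definition quot_lift (x : quotm G) : Q := f (repr x).

Lemma quot_liftE (x : M) : quot_lift (\pi_(quotm G) x) = f x.
Proof.
apply/eqP; rewrite -subr_eq0 -semilinB; apply/eqP.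
have /quotm_eqP : (\pi_(quotm G) (repr (\pi_(quotm G) x)) == \pi_(quotm G) x).
  by rewrite reprK.
elim=> [|a u v /fG fu _ IH]; first by rewrite raddf0.
by rewrite semilin fu IH scaler0 addr0.
Qed.

Lemma quot_lift_linear : linear_for (th \; *:%R) quot_lift.
Proof.
move=> a x y; rewrite -[x]reprK -[y]reprK.
by rewrite -quotm_pi_lin !quot_liftE semilin.
Qed.
End QuotLift.

Section TensorLift.
Variables (R R' : comNzRingType) (th : {rmorphism R -> R'}).
Variables (M N : lmodType R) (Q : lmodType R') (b : M -> N -> Q).

Definition bilin :=
  [/\ forall x x' y, b (x + x') y = b x y + b x' y,
      forall x y y', b x (y + y') = b x y + b x y',
      forall a x y, b (a *: x) y = th a *: b x y &
      forall a x y, b x (a *: y) = th a *: b x y].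

Definition tens_lift (hb : bilin) : tens M N -> Q :=
  quot_lift (free_lift th (fun z : M * N => b z.1 z.2)).

Variable hb : bilin.

Fact tens_lift_subproof z : tens_rel z ->
  free_lift th (fun z : M * N => b z.1 z.2) z = 0.
Proof.
case: hb => Dl Dr Zl Zr; case=> [x x' y|x y y'|a x y|a x y].
- by rewrite !semilinB /= !free_liftU /= Dl addrAC addrK subrr.
- by rewrite !semilinB /= !free_liftU /= Dr addrAC addrK subrr.
- by rewrite semilinB semilinZ /= !free_liftU /= Zl subrr.
- by rewrite semilinB semilinZ /= !free_liftU /= Zr subrr.
Qed.

Fact tens_lift_linear : linear_for (th \; *:%R) (tens_lift hb).
Proof. by move=> a x y; apply: quot_lift_linear; apply: tens_lift_subproof. Qed.
HB.instance Definition _ := GRing.isLinear.Build R (tens M N) Q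
  (th \; *:%R) (tens_lift hb) tens_lift_linear.

Lemma tens_liftD t t' : tens_lift hb (t + t') = tens_lift hb t + tens_lift hb t'.
Proof. exact: raddfD. Qed.
Lemma tens_lift0 : tens_lift hb 0 = 0. Proof. exact: raddf0. Qed.
Lemma tens_liftZ a t : tens_lift hb (a *: t) = th a *: tens_lift hb t.
Proof. exact: semilinZ. Qed.

Lemma tens_liftE x y : tens_lift hb (tpure x y) = b x y.
Proof.
rewrite /tens_lift quot_liftE /=; first by rewrite free_liftU.
exact: tens_lift_subproof.
Qed.
End TensorLift.

Section TensorPure.
Variables (R : comNzRingType) (M N : lmodType R).

Lemma tpureDl x x' (y : N) : tpure (x + x' : M) y = tpure x y + tpure x' y.
Proof.
apply: etrans (raddfD (\pi_(quotm (@tens_rel R M N))) << (x, y) >> << (x', y) >>).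
by apply/eqP/quotm_eqP/span_gen; rewrite opprD addrA; apply: TensAddl.
Qed.

Lemma tpureDr (x : M) (y y' : N) : tpure x (y + y') = tpure x y + tpure x y'.
Proof.
apply: etrans (raddfD (\pi_(quotm (@tens_rel R M N))) << (x, y) >> << (x, y') >>).
by apply/eqP/quotm_eqP/span_gen; rewrite opprD addrA; apply: TensAddr.
Qed.

Lemma tpureZl a (x : M) (y : N) : tpure (a *: x) y = a *: tpure x y.
Proof.
apply: etrans (esym (quotm_piZ (@tens_rel R M N) a << (x, y) >>)).
by apply/eqP/quotm_eqP/span_gen; apply: TensScalel.
Qed.

Lemma tpureZr a (x : M) (y : N) : tpure x (a *: y) = a *: tpure x y.
Proof.
apply: etrans (esym (quotm_piZ (@tens_rel R M N) a << (x, y) >>)).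
by apply/eqP/quotm_eqP/span_gen; apply: TensScaler.
Qed.

Lemma tpure0l (y : N) : tpure (0 : M) y = 0.
Proof. by rewrite -[0 : M](scale0r 0) tpureZl scale0r. Qed.

End TensorPure.

Section LinearTensor.
Variables (R : comNzRingType) (N : lmodType R).

Definition tens_left (M M' : lmodType R) (f : {linear M -> M'}) :
    tens M N -> tens M' N :=
  tens_map (f : {linear _ -> _ | idfun \; *:%R})
           (idfun : {linear N -> N | idfun \; *:%R}).

Fact tens_left_linear M M' f : linear (@tens_left M M' f).
Proof. by move=> a x y; rewrite /tens_left semilin. Qed.
HB.instance Definition _ M M' f :=
  GRing.isLinear.Build R (tens M N) (tens M' N) *:%R (@tens_left M M' f)
    (@tens_left_linear M M' f).

Lemma tens_leftE M M' f x y : @tens_left M M' f (tpure x y) = tpure (f x) y.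
Proof. exact: tens_mapE. Qed.

End LinearTensor.

Section TensorFree.
Variables (R : comNzRingType) (Y : choiceType) (N : lmodType R).

(** Terms with the same generator are collected. *)
Lemma tens_free_form (t : tens {freeg Y / R} N) :
  exists (s : seq Y) (x : Y -> N), uniq s /\ t = \sum_(y <- s) tpure << y >> (x y).
Proof.
pose Q (t : tens {freeg Y / R} N) :=
  exists (s : seq Y) (x : Y -> N), uniq s /\ t = \sum_(y <- s) tpure << y >> (x y).
have Q0 : Q 0 by exists [::], (fun=> 0); rewrite big_nil.
have tp0 (p : {freeg Y / R}) : tpure p (0 : N) = 0.
  by rewrite -[0 : N](scale0r 0) tpureZr scale0r.
have QD t1 t2 : Q t1 -> Q t2 -> Q (t1 + t2).
  move=> [s1 [x1 [u1 ->]]] [s2 [x2 [u2 ->]]].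
  pose s := undup (s1 ++ s2); pose x s x y : N := if y \in (s : seq Y) then x y else 0.
  have ext s' x' : uniq s' -> {subset s' <= s} ->
      \sum_(y <- s') tpure << y >> (x' y) = \sum_(y <- s) tpure << y >> (x s' x' y).
    move=> us' sub; rewrite [RHS](bigID (mem s')) /= [X in _ + X]big1 ?addr0.
      rewrite -[RHS]big_filter; rewrite (perm_big [seq y <- s | y \in s']).
        rewrite !big_filter; apply: eq_bigr => y ys; rewrite /x ys //.
      apply: uniq_perm; rewrite ?filter_uniq ?undup_uniq //.
      by move=> y; rewrite mem_filter; case: (boolP (y \in s')) => // /sub.
    by move=> y /negPf ys; rewrite /x ys tp0.
  exists s, (fun y => x s1 x1 y + x s2 x2 y); split; first exact: undup_uniq.
  rewrite (ext s1 x1 u1) ?(ext s2 x2 u2) => [|y ys|y ys].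
  - by rewrite -big_split; apply: eq_bigr => y _; rewrite tpureDr.
  - by rewrite mem_undup mem_cat ys orbT.
  by rewrite mem_undup mem_cat ys.
elim/tens_ind: t => [|a p z t IH]; first exact: Q0.
apply: (QD _ _ _ IH); rewrite -tpureZr; elim/freeg_ind: p => [|b y p IHp].
  by rewrite tpure0l.
rewrite tpureDl tpureZl -tpureZr; apply: (QD _ _ _ IHp).
by exists [:: y], (fun=> b *: (a *: z)); rewrite big_seq1.
Qed.

End TensorFree.

(** * Comparison of a free resolution with the standard one *)

Section Comparison.
Variables (R : comNzRingType) (M N : lmodType R).

Lemma lin_add (V W : lmodType R) (f g : V -> W) :
  linear f -> linear g -> linear (fun x => f x + g x).
Proof. by move=> lf lg a x y; rewrite lf lg scalerDr addrACA. Qed.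

Lemma lin_opp (V W : lmodType R) (f : V -> W) :
  linear f -> linear (fun x => - f x).
Proof. by move=> lf a x y; rewrite lf opprD scalerN. Qed.

Lemma lin_comp (V W U : lmodType R) (f : W -> U) (g : V -> W) :
  linear f -> linear g -> linear (fun x => f (g x)).
Proof. by move=> lf lg a x y; rewrite lg lf. Qed.

Lemma free_augU (X : lmodType R) (x : X) : free_aug << x >> = x.
Proof. exact: free_liftU. Qed.

Definition syz_val i (z : syz M i.+1) : res M i := val (z :
  kerm (@free_aug R (syz M i))).

Lemma res_diffU i (z : syz M i.+1) : res_diff (<< z >> : res M i.+1) = syz_val z.
Proof. by rewrite /res_diff free_augU. Qed.

Lemma free_aug_syz_val i (z : syz M i.+1) : free_aug (syz_val z) = 0.
Proof. exact: (eqP (kermP (z : kerm (@free_aug R (syz M i))))). Qed.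

Lemma syz_val_inj i : injective (@syz_val i).
Proof. exact: val_inj. Qed.

Lemma res_diffE i (x : res M i.+1) : res_diff x = syz_val (free_aug x).
Proof. by []. Qed.

Lemma free_aug_res_diff i (x : res M i.+1) : free_aug (res_diff x) = 0.
Proof. by rewrite res_diffE free_aug_syz_val. Qed.

Lemma res_diff_eq0 i (x : res M i.+1) : res_diff x = 0 -> free_aug x = 0.
Proof. by rewrite res_diffE => x0; apply: syz_val_inj. Qed.

Lemma res_diff_syz_val i (z : syz M i.+2) : res_diff (syz_val z) = 0.
Proof. by rewrite res_diffE free_aug_syz_val. Qed.

Lemma res_diffB i : {morph @res_diff R M i : x y / x - y}.
Proof. exact: linearB. Qed.

(** A cycle of the standard resolution is the boundary of a generator, namely of itself. *)
Definition res_sect i (x : res M i) : res M i.+1 :=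
  << (insubd (0 : kerm (@free_aug R (syz M i))) x : syz M i.+1) >>.

Lemma res_sectK i (x : res M i) : free_aug x = 0 -> res_diff (res_sect x) = x.
Proof.
move=> x0; rewrite /res_sect res_diffU /syz_val val_insubd.
by rewrite unfold_in /ker_pred /= x0 eqxx.
Qed.

Lemma res_sect_gen i (x : res M i) : free_aug x = 0 ->
  exists2 z : syz M i.+1, res_sect x = << z >> & syz_val z = x.
Proof.
move=> x0; exists (insubd (0 : kerm (@free_aug R (syz M i))) x) => //.
by rewrite /syz_val val_insubd unfold_in /ker_pred /= x0 eqxx.
Qed.

Lemma syz_val_lin i a (x y : syz M i.+1) :
  syz_val (a *: x + y) = a *: syz_val x + syz_val y.
Proof. exact: linearP. Qed.

Lemma free_ext (X : choiceType) (V : lmodType R) (f g : {freeg X / R} -> V) :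
  linear f -> linear g -> (forall x, f << x >> = g << x >>) -> f =1 g.
Proof.
move=> lf lg h; elim/freeg_ind => [|a x D IH]; last by rewrite lf lg h IH.
have z (u : {freeg X / R} -> V) : linear u -> u 0 = 0.
  by move=> lu; have := lu (-1) 0 0; rewrite scaler0 addr0 scaleN1r addNr.
by rewrite !z.
Qed.

Section FreeLiftId.
Variables (X : choiceType) (V : lmodType R) (b : X -> V).
Definition freel : {freeg X / R} -> V := free_lift idfun b.
Fact freel_linear : linear freel. Proof. by move=> a x y; rewrite /freel semilin. Qed.
HB.instance Definition _ := GRing.isLinear.Build R {freeg X / R} V *:%R freel
  freel_linear.
Lemma freelU x : freel << x >> = b x. Proof. exact: free_liftU. Qed.
End FreeLiftId.

Variable Y : nat -> choiceType.
Local Notation P i := {freeg (Y i) / R}.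
Variables (d : forall i, {linear P i.+1 -> P i}) (aug : {linear P 0 -> M}).
Hypotheses (augd : forall p, aug (d 0 p) = 0)
  (ddP : forall i p, d i (d i.+1 p) = 0)
  (aug_surj : forall x, exists p, aug p = x)
  (ex0 : forall p, aug p = 0 -> exists q, d 0 q = p)
  (exS : forall i p, d i p = 0 -> exists q, d i.+1 q = p).

(** The comparison maps g : P -> F and f : F -> P of a free resolution P with the
    standard resolution F, and a homotopy h from g f to the identity, are defined by
    lifting on generators. Lifts to F are made with [res_sect], so g maps generators to
    generators; lifts to P are chosen. *)
Fixpoint cmp_g i : {linear P i -> res M i} :=
  match i return {linear P i -> res M i} with
  | 0 => freel (fun y => (<< aug << y >> >> : res M 0))
  | j.+1 => freel (fun y => res_sect (cmp_g j (d j << y >>)))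
  end.

Lemma cmp_g0 p : free_aug (cmp_g 0 p : res M 0) = aug p.
Proof.
move: p; apply: free_ext => [a x y|a x y|y]; rewrite ?linearP //=.
by apply: etrans (free_augU _); congr (free_aug _); apply: freelU.
Qed.

Lemma cmp_gSU i y : cmp_g i.+1 << y >> = res_sect (cmp_g i (d i << y >>)).
Proof. exact: freelU. Qed.

Lemma cmp_gd i p : res_diff (cmp_g i.+1 p) = cmp_g i (d i p).
Proof.
elim: i p => [|i IH]; apply: free_ext => [a x y|a x y|y]; try by rewrite !linearP.
  by rewrite cmp_gSU; apply: res_sectK; rewrite cmp_g0 augd.
rewrite cmp_gSU; apply: res_sectK; apply: res_diff_eq0.
by rewrite IH ddP linear0.
Qed.

Lemma cmp_g_cycle i q : free_aug (cmp_g i (d i q)) = 0.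
Proof.
case: i q => [|i] q; first by rewrite cmp_g0 augd.
by apply: res_diff_eq0; rewrite cmp_gd ddP linear0.
Qed.

Definition aug_sect (x : M) : P 0 := projT1 (cid (aug_surj x)).
Lemma aug_sectK x : aug (aug_sect x) = x.
Proof. by rewrite /aug_sect; case: cid. Qed.

Definition d_sect i (p : P i) : P i.+1 :=
  if pselect (exists q, d i q = p) is left h then projT1 (cid h) else 0.
Lemma d_sectK i p : (exists q, d i q = p) -> d i (d_sect p) = p.
Proof. by rewrite /d_sect; case: pselect => // h _; case: cid. Qed.

Fixpoint cmp_f i : {linear res M i -> P i} :=
  match i return {linear res M i -> P i} with
  | 0 => freel (fun x : syz M 0 => aug_sect x)
  | j.+1 => freel (fun z : syz M j.+1 => d_sect (cmp_f j (syz_val z)))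
  end.

Lemma cmp_f0 x : aug (cmp_f 0 x) = free_aug (x : res M 0).
Proof.
move: x; apply: free_ext => [a x y|a x y|y]; try by rewrite !linearP.
by rewrite free_augU; apply: etrans (congr1 _ (freelU _ _)) _; apply: aug_sectK.
Qed.

Lemma cmp_fSU i (z : syz M i.+1) :
  cmp_f i.+1 << z >> = d_sect (cmp_f i (syz_val z)).
Proof. exact: freelU. Qed.

Lemma cmp_fd i x : d i (cmp_f i.+1 x) = cmp_f i (res_diff x).
Proof.
elim: i x => [|i IH]; apply: free_ext => [a x y|a x y|z]; try by rewrite !linearP.
  rewrite cmp_fSU (res_diffU z); apply: d_sectK; apply: ex0.
  by rewrite cmp_f0 free_aug_syz_val.
rewrite cmp_fSU (res_diffU z); apply: d_sectK; apply: exS.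
by rewrite IH res_diff_syz_val linear0.
Qed.

Fixpoint cmp_h i : {linear res M i -> res M i.+1} :=
  match i return {linear res M i -> res M i.+1} with
  | 0 => freel (fun x : syz M 0 => res_sect (<< x >> - cmp_g 0 (cmp_f 0 << x >>)))
  | j.+1 => freel (fun z : syz M j.+1 => res_sect
      (<< z >> - cmp_g j.+1 (cmp_f j.+1 << z >>) - cmp_h j (syz_val z)))
  end.

Lemma cmp_hSU i (z : syz M i.+1) : cmp_h i.+1 << z >> = res_sect
  (<< z >> - cmp_g i.+1 (cmp_f i.+1 << z >>) - cmp_h i (syz_val z)).
Proof. exact: freelU. Qed.

Lemma cmp_h0 x : res_diff (cmp_h 0 x) = x - cmp_g 0 (cmp_f 0 x).
Proof.
move: x; apply: free_ext => [a x y|a x y|x].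
- by rewrite !linearP.
- by move: a x y; apply: lin_add; [|apply: lin_opp] => a x y; rewrite ?linearP.
apply: etrans (congr1 _ (freelU _ _)) _; apply: res_sectK.
by rewrite linearB /= cmp_g0 cmp_f0 subrr.
Qed.

Lemma cmp_hS i x : res_diff (cmp_h i.+1 x) =
  x - cmp_g i.+1 (cmp_f i.+1 x) - cmp_h i (res_diff x).
Proof.
have lin j : linear
  (fun x : res M j.+1 => x - cmp_g j.+1 (cmp_f j.+1 x) - cmp_h j (res_diff x)).
  by do !apply: lin_add; try apply: lin_opp; move=> a x' y'; rewrite ?linearP.
elim: i x => [|i IH]; apply: free_ext => [a x y|a x y|z];
  try by [rewrite !linearP|apply: lin].
  rewrite cmp_hSU (res_diffU z); apply: res_sectK; apply: res_diff_eq0.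
  by rewrite !res_diffB (res_diffU z) cmp_gd cmp_fd (res_diffU z) cmp_h0 subrr.
rewrite cmp_hSU (res_diffU z); apply: res_sectK; apply: res_diff_eq0.
rewrite !res_diffB (res_diffU z) cmp_gd cmp_fd (res_diffU z) IH.
by rewrite res_diff_syz_val linear0 subr0 subrr.
Qed.

Lemma tens_diffE i x y : tens_diff (tpure (x : res M i.+1) (y : N)) =
  tpure (res_diff x) y.
Proof. exact: tens_mapE. Qed.

Lemma tens_ext (V W : lmodType R) (f g : tens V N -> W) :
  linear f -> linear g -> (forall x y, f (tpure x y) = g (tpure x y)) -> f =1 g.
Proof.
move=> lf lg h; elim/tens_ind => [|a x y t IH]; last by rewrite lf lg h IH.
have z (u : tens V N -> W) : linear u -> u 0 = 0.
  by move=> lu; have := lu (-1) 0 0; rewrite scaler0 addr0 scaleN1r addNr.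
by rewrite !z.
Qed.

Lemma tens_left_lin (V W : lmodType R) (f : {linear V -> W}) :
  linear (tens_left f : tens V N -> tens W N).
Proof. exact: tens_left_linear. Qed.

Lemma tens_cmp_gd i (t : tens (P i.+1) N) :
  tens_diff (tens_left (cmp_g i.+1) t) = tens_left (cmp_g i) (tens_left (d i) t).
Proof.
move: t; apply: tens_ext => [||x y].
- exact: lin_comp (@tens_diff_linear R M N i) (tens_left_lin _).
- exact: lin_comp (tens_left_lin _) (tens_left_lin _).
by rewrite !tens_leftE tens_diffE cmp_gd.
Qed.

Lemma tens_cmp_fd i (t : tens (res M i.+1) N) :
  tens_left (d i) (tens_left (cmp_f i.+1) t) = tens_left (cmp_f i) (tens_diff t).
Proof.
move: t; apply: tens_ext => [||x y].
- exact: lin_comp (tens_left_lin _) (tens_left_lin _).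
- exact: lin_comp (tens_left_lin _) (@tens_diff_linear R M N i).
by rewrite !tens_leftE tens_diffE tens_leftE cmp_fd.
Qed.

Lemma tens_cmp_h i (t : tens (res M i.+1) N) :
  t = tens_left (cmp_g i.+1) (tens_left (cmp_f i.+1) t) +
      tens_left (cmp_h i) (tens_diff t) + tens_diff (tens_left (cmp_h i.+1) t).
Proof.
move: t; apply: tens_ext => [||x y]; first by [].
  apply: lin_add; first apply: lin_add.
  - exact: lin_comp (tens_left_lin _) (tens_left_lin _).
  - exact: lin_comp (tens_left_lin _) (@tens_diff_linear R M N i).
  exact: lin_comp (@tens_diff_linear R M N i.+1) (tens_left_lin _).
rewrite !tens_leftE !tens_diffE !tens_leftE -!tpureDl cmp_hS; congr tpure.
by rewrite -[x - _ - _]addrA -opprD [RHS]addrC subrK.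
Qed.

(** From t - g (f t) = d (h t) + h (d t), tensored with N. *)
Theorem cycle_comparison i (t : tens (res M i.+1) N) : tens_diff t = 0 ->
  exists2 p : tens (P i.+1) N, tens_left (d i) p = 0 &
    exists w, t = tens_left (cmp_g i.+1) p + tens_diff w.
Proof.
move=> t0; exists (tens_left (cmp_f i.+1) t).
  by rewrite tens_cmp_fd t0 linear0.
exists (tens_left (cmp_h i.+1) t).
by rewrite {1}[t]tens_cmp_h t0 linear0 addr0.
Qed.

End Comparison.

(** * Homogeneous parts *)

Section Graded.
Variables (k : comNzRingType) (n : nat).
Local Notation K := (rowmon n).
Local Notation A := (rowring k n).
Local Notation S := {mpoly k[n]}.

Definition hpart (e : nat) : {linear S -> S} := pihomog mdeg e.

Lemma hpartD e p q : hpart e (p + q) = hpart e p + hpart e q.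
Proof. exact: linearD. Qed.

Lemma hpartZ e c p : hpart e (c *: p) = c *: hpart e p.
Proof. exact: linearZ. Qed.

Lemma hpartX e u : hpart e 'X_[u] = if mdeg u == e then 'X_[u] else 0.
Proof. exact: pihomogX. Qed.

Lemma in_degs_ind (J : pred nat) (Q : S -> Prop) : Q 0 ->
  (forall c u p, J (mdeg u) -> p \in in_degs J -> Q p -> Q (c *: 'X_[u] + p)) ->
  forall p, p \in in_degs J -> Q p.
Proof.
move=> Q0 QD p /in_degsP Jp; rewrite [p]mpolyE.
suff gen (s : seq 'X_{1..n}) : {subset s <= msupp p} ->
    \sum_(m <- s) p@_m *: 'X_[m] \in in_degs J /\ Q (\sum_(m <- s) p@_m *: 'X_[m]).
  by have [] := gen (msupp p).
elim: s => [|m s IH] sub; first by rewrite big_nil rpred0.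
have ms : m \in msupp p by apply: sub; rewrite inE eqxx.
have [|js qs] := IH; first by move=> a as_; apply: sub; rewrite inE as_ orbT.
rewrite big_cons; split; last by apply: QD => //; apply: Jp.
apply: rpredD => //; apply: rpredZ; apply/in_degsP => a.
by rewrite msuppX inE => /eqP ->; apply: Jp.
Qed.

Lemma in_degsX (J : pred nat) u : J (mdeg u) -> 'X_[u] \in @in_degs k n J.
Proof. by move=> Ju; apply/in_degsP => m; rewrite msuppX inE => /eqP ->. Qed.

Lemma hpart_dhomog e p : p \is e.-homog -> hpart e p = p.
Proof. exact: pihomog_dE. Qed.

Lemma act_hpart g e (p : S) : Defs.act g (hpart e p) = hpart e (Defs.act g p).
Proof.
elim/mpoly_lin_ind: p => [|c u p IH]; first by rewrite !linear0.
rewrite !linearP /= IH; congr (_ *: _ + _); rewrite hpartX.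
have hX : Defs.act g ('X_[u] : S) \is (mdeg u).-homog by rewrite act_dhomog ?dhomogX.
case: eqP => [<-|/eqP ne]; first by rewrite hpart_dhomog.
by rewrite linear0 [RHS](pihomog_ne0 ne).
Qed.

(** M starts in degree r, so only the constant term of a contributes in this degree. *)
Lemma hpart_ver_mod d r (a x : S) : a \in in_degs (ver_degs d) ->
  x \in in_degs (mod_degs d r) -> hpart r (a * x) = a@_0%MM *: hpart r x.
Proof.
move=> ha hx; elim/in_degs_ind: a / ha => [|c u a du ha IH].
  by rewrite mul0r linear0 mcoeff0 scale0r.
rewrite mulrDl hpartD IH mcoeffD scalerDl; congr (_ + _).
rewrite -scalerAl hpartZ mcoeffZ -scalerA mcoeffX; congr (_ *: _).
elim/in_degs_ind: x / hx {IH ha} => [|c' v x /andP[rv _] hx IH].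
  by rewrite mulr0 !linear0 ?scaler0.
rewrite mulrDr !hpartD IH scalerDr; congr (_ + _).
rewrite -scalerAr !hpartZ -mpolyXD !hpartX scalerA mulrC -scalerA; congr (_ *: _).
rewrite mdegD; case: (u =P 0%MM) => [->|/eqP u0].
  by rewrite mdeg0 add0n add0m scale1r.
rewrite scale0r gtn_eqF //.
by rewrite -mdeg_eq0 -lt0n in u0; apply: leq_ltn_trans rv _;
  rewrite -{1}[mdeg v]add0n ltn_add2r.
Qed.

(** The least positive degree of R is d, so taking the part of degree d is a derivation
    along the constant term. *)
Lemma hpart_ver_mul d (a b : S) : (0 < d)%N -> a \in in_degs (ver_degs d) ->
  b \in in_degs (ver_degs d) ->
  hpart d (a * b) = a@_0%MM *: hpart d b + b@_0%MM *: hpart d a.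
Proof.
move=> d0 ha hb; elim/in_degs_ind: a / ha => [|c u a du ha IH].
  by rewrite mul0r !linear0 ?scaler0 ?mcoeff0 ?scale0r ?addr0.
rewrite mulrDl hpartD IH hpartD mcoeffD scalerDl scalerDr addrACA.
congr (_ + _); rewrite -scalerAl !hpartZ mcoeffZ -scalerA [_ *: (c *: _)]scalerA.
rewrite [_ * c]mulrC -scalerA -scalerDr mcoeffX; congr (_ *: _).
elim/in_degs_ind: b / hb {IH ha} => [|c' v b dv hb IH].
  by rewrite mulr0 !linear0 ?scaler0 ?mcoeff0 ?scale0r ?addr0.
rewrite mulrDr !hpartD IH mcoeffD scalerDl scalerDr [RHS]addrACA.
congr (_ + _); rewrite -scalerAr !hpartZ mcoeffZ mcoeffX -mpolyXD !hpartX.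
rewrite scalerA [_ * c']mulrC -!scalerA -scalerDr; congr (_ *: _).
rewrite mdegD; case: (u =P 0%MM) => [->|/eqP u0].
  rewrite mdeg0 add0n add0m scale1r [0%N == d]ltn_eqF // scaler0 addr0 //.
rewrite scale0r add0r; case: (v =P 0%MM) => [->|/eqP v0].
  by rewrite mdeg0 addn0 addm0 scale1r.
rewrite scale0r gtn_eqF //.
rewrite -mdeg_eq0 -lt0n in u0; rewrite -mdeg_eq0 -lt0n in v0.
apply: (leq_ltn_trans (dvdn_leq u0 du)).
by rewrite -{1}[mdeg u]addn0 ltn_add2l.
Qed.

Definition row_part (l e : nat) : A -> A :=
  mlift (fun m => if mdeg (m l) == e then rX k m else 0).
HB.instance Definition _ l e := GRing.Linear.on (row_part l e).

Lemma row_partX l e (m : K) : row_part l e (rX k m) =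
  if mdeg (m l) == e then rX k m else 0.
Proof. exact: mliftX. Qed.

Lemma rsupp_ind (Q : A -> Prop) (G : K -> Prop) : Q 0 ->
  (forall c m x, G m -> Q x -> Q (c *: rX k m + x)) ->
  forall x, (forall m, m \in rsupp x -> G m) -> Q x.
Proof.
move=> Q0 QD x Gx; rewrite [x]rowring_sum.
suff gen (s : seq K) : {subset s <= rsupp x} -> Q (\sum_(m <- s) rcoef m x *: rX k m).
  exact: gen.
elim: s => [|m s IH] sub; first by rewrite big_nil.
rewrite big_cons; apply: QD; first by apply/Gx/sub; rewrite inE eqxx.
by apply: IH => a as_; apply: sub; rewrite inE as_ orbT.
Qed.

Lemma row_part_iota l e (x : A) (p : S) :
  (forall m : K, m \in rsupp x -> m l = 0%MM) ->
  row_part l e (x * iota_ l p) = x * iota_ l (hpart e p).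
Proof.
move=> x0; elim/rsupp_ind: x / x0 => [|c m x ml IH].
  by rewrite !mul0r linear0.
rewrite !mulrDl linearD /= IH -!scalerAl linearZ /=; congr (_ *: _ + _).
elim/mpoly_lin_ind: p {IH} => [|c' u p IH]; first by rewrite !linear0 mulr0 linear0.
rewrite !linearP /= !mulrDr linearD /= IH -!scalerAr linearZ /=; congr (_ *: _ + _).
rewrite iotaX rXM row_partX hpartX rmME rowmE eqxx ml add0m.
by case: eqP; rewrite ?iotaX ?rXM // linear0 mulr0.
Qed.

Lemma mu_row_part i e f (x : A) : (forall m : K, m \in rsupp x -> mdeg (m i) = f) ->
  mu i (row_part i.+1 e x) = row_part i (f + e) (mu i x).
Proof.
move=> xf; elim/rsupp_ind: x / xf => [|c m x mf IH]; first by rewrite !linear0.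
rewrite !linearP /= IH row_partX muX row_partX merge_rowE eqxx mdegD mf eqn_add2l.
by case: eqP; rewrite ?muX ?linear0.
Qed.

Lemma mu_row_part_comm l e j (x : A) : (j.+1 < l)%N ->
  mu j (row_part l e x) = row_part l e (mu j x).
Proof.
move=> jl; elim/rowring_ind: x => [|c m x IH]; first by rewrite !linear0.
rewrite !linearP /= IH row_partX muX row_partX merge_rowE (gtn_eqF jl)
  (gtn_eqF (ltnW jl)).
by case: eqP; rewrite ?muX ?linear0.
Qed.

Lemma rcoef_row_part l e (x : A) (m : K) :
  rcoef m (row_part l e x) = if mdeg (m l) == e then rcoef m x else 0.
Proof.
elim/rowring_ind: x => [|c a x IH]; first by rewrite !linear0; case: ifP.
rewrite !linearP /= IH row_partX; have [<-|ma] := eqVneq a m.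
  by case: ifP => _; rewrite ?linear0 ?mulr0 ?addr0.
have h : rcoef m (rX k a) = 0 by rewrite rcoefX (negPf ma).
rewrite h mulr0 add0r; case: (mdeg (a l) == e); rewrite ?h ?linear0 mulr0 add0r //.
Qed.

Lemma rsupp_row_part l e (x : A) (m : K) : m \in rsupp (row_part l e x) ->
  m \in rsupp x /\ mdeg (m l) = e.
Proof. by rewrite !rsuppE rcoef_row_part; case: (mdeg (m l) =P e) => [-> //|_];
  rewrite eqxx. Qed.

Lemma row_part_id l e (x : A) : (forall m : K, m \in rsupp x -> mdeg (m l) = e) ->
  row_part l e x = x.
Proof.
move=> xe; elim/rsupp_ind: x / xe => [|c m x me IH]; first by rewrite linear0.
by rewrite linearP /= IH row_partX me eqxx.
Qed.

Lemma mu_fix j (x : A) : (forall m : K, m \in rsupp x -> m j.+1 = 0%MM) -> mu j x = x.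
Proof.
move=> x0; elim/rsupp_ind: x / x0 => [|c m x m0 IH]; first by rewrite linear0.
rewrite linearP /= IH muX; congr (_ *: rX _ _ + _); apply/rmP => i.
by rewrite merge_rowE; case: eqP => [->|_]; [rewrite m0 addm0|case: eqP => [->|]].
Qed.

Lemma iota_inj l : injective (@iota_ k n l).
Proof.
move=> p q e; apply/mpolyP => u.
have rcI (x : S) : rcoef (rowm l u) (iota_ l x) = x@_u.
  elim/mpoly_lin_ind: x => [|c v x IH]; first by rewrite !linear0.
  rewrite !linearP /= IH iotaX rcoefX mcoeffX; congr (_ * (nat_of_bool _)%:R + _).
  apply/eqP/eqP => [/rmP/(_ l)|->//]; by rewrite !rowmE eqxx.
by rewrite -!rcI e.
Qed.

Lemma rsupp_iota l (p : S) m : m \in rsupp (iota_ l p) ->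
  exists2 u, u \in msupp p & m = rowm l u.
Proof.
rewrite {1}[p]mpolyE linear_sum rsuppE linear_sum /=; apply: contraPP => ne; apply/negP.
rewrite negbK big_seq big1 // => u up; rewrite linearZ linearZ /= iotaX rcoefX.
by case: eqP => [e|_]; rewrite ?mulr0 //; case: ne; exists u.
Qed.

Lemma rsupp_mul_iota l (x : A) (p : S) m : m \in rsupp (x * iota_ l p) ->
  exists a u, [/\ a \in rsupp x, u \in msupp p & m = rmM a (rowm l u)].
Proof.
rewrite [p in iota_ l p]mpolyE linear_sum mulr_sumr rsuppE linear_sum /=.
apply: contraPP => ne; apply/negP; rewrite negbK big_seq big1 // => u up.
rewrite linearZ /= -scalerAr linearZ /= iotaX.
have [|] := boolP (m \in rsupp (x * rX k (rowm l u))).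
  by move=> /rsupp_shift[a ax e]; case: ne; exists a, u.
by rewrite rsuppE negbK => /eqP ->; rewrite mulr0.
Qed.

End Graded.

(** * The ribbon resolution of a Veronese module *)

Section TabFree.
Variables (k : comNzRingType) (n : nat).
Variables (al : nat -> nat) (al_gt0 : forall t, (0 < al t)%N).
Local Notation K := (rowmon n).
Local Notation S := {mpoly k[n]}.

Lemma tab_rows0 l (y : K) j : tab al l y -> (l <= j)%N -> y j = 0%MM.
Proof. by move=> ty lj; have := ty.1 j; rewrite ltnNge lj. Qed.

Lemma cut_tab l (y : K) u : tab al l y -> cut l (rmM y (rowm l u)) = y.
Proof.
move=> ty; apply/rmP => j; rewrite cutE rmME rowmE.
have [jl|lj|->] := ltngtP j l; first by rewrite addm0.
  by rewrite (tab_rows0 ty) // ltnW.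
by rewrite (tab_rows0 ty).
Qed.

Lemma row_tab l (y : K) u : tab al l y -> rmM y (rowm l u) l = u.
Proof. by move=> ty; rewrite rmME rowmE eqxx (tab_rows0 ty) // add0m. Qed.

(** The products tab_elt l y * iota_ l 'X_[u] are led by different monomials, from which
    y and u can be read off. *)
Lemma tab_free l (s : seq K) (c : K -> S) : uniq s ->
  (forall y, y \in s -> tab al l y) ->
  \sum_(y <- s) tab_elt k al_gt0 l y * iota_ l (c y) = 0 ->
  forall y, y \in s -> c y = 0.
Proof.
move=> us ts s0.
pose s' := [seq rmM y (rowm l u) | y <- s, u <- msupp (c y)].
have us' : uniq s'.
  apply: allpairs_uniq_dep; [exact: us|by move=> y ys; apply: msupp_uniq|].
  move=> /= _ _ /allpairsPdep[y [u [ys uc ->]]] /allpairsPdep[y' [u' [ys' uc' ->]]]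
    /= e.
  have ey : y = y' by rewrite -(cut_tab u (ts _ ys)) e (cut_tab _ (ts _ ys')).
  have eu : u = u' by rewrite -(row_tab u (ts _ ys)) e row_tab //; apply: ts.
  by rewrite ey eu.
have := @leads_free k n s' (fun m : K => (c (cut l m))@_(m l))
  (fun m : K => tab_elt k al_gt0 l (cut l m) * rX k (rowm l (m l))) us'.
have ld (m : K) : m \in s' ->
    leads (tab_elt k al_gt0 l (cut l m) * rX k (rowm l (m l))) m.
  case/allpairsPdep=> [y [u [ys uc ->]]]; have ty := ts _ ys.
  by rewrite cut_tab // row_tab //; apply/leads_shift/tab_elt_leads.
move=> /(_ ld) fr y ys; apply/mpolyP => u; rewrite mcoeff0.
case: (boolP (u \in msupp (c y))) => [uc|]; last exact: memN_msupp_eq0.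
have ty := ts _ ys; have := fr _ (rmM y (rowm l u)); rewrite cut_tab // row_tab //.
apply; last by apply/allpairsPdep; exists y, u.
rewrite -[RHS]s0 /s' big_allpairs_dep; apply: eq_big_seq => y' ys';
  have ty' := ts _ ys'.
rewrite [c y' in RHS]mpolyE linear_sum mulr_sumr; apply: eq_bigr => v _.
by rewrite cut_tab // row_tab // linearZ /= iotaX scalerAr.
Qed.

Lemma tab_elt0 (y : K) : tab al 0 y -> tab_elt k al_gt0 0 y = 1.
Proof.
move=> ty; have sh (m : K) : shape al 0 m -> m = rm1 n.
  by move=> h; apply/rmP => j; rewrite rm1E; exact: h j.
have [ld _] := tab_elt_leads k al_gt0 ty.
apply: rP => m; rewrite -rX1 rcoefX eq_sym; have [->|m1] := eqVneq m (rm1 n).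
  by rewrite -ld (sh _ ty.1).
apply/eqP; rewrite -[_ == _]negbK -rsuppE; apply/negP => /tab_elt_shape/sh e.
by rewrite e eqxx in m1.
Qed.
End TabFree.

Section VeroneseComplex.
Variables (k : comNzRingType) (n d r : nat).
Hypotheses (d_gt0 : (0 < d)%N) (r_gt0 : (0 < r)%N).
Local Notation K := (rowmon n).
Local Notation A := (rowring k n).
Local Notation S := {mpoly k[n]}.
Local Notation R := (veronese k n d).
Local Notation M := (ver_mod k n d r).

Definition vdeg (j : nat) : nat := if j is 0 then r else d.
Fact vdeg_gt0 j : (0 < vdeg j)%N. Proof. by case: j. Qed.

Definition istab l : pred K := fun y => `[< tab vdeg l y >].
Definition tableau l := {y : K | istab l y}.
HB.instance Definition _ l := Choice.on (tableau l).

Local Notation P i := {freeg (tableau i.+1) / R}.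

Definition tableau_elt l (y : tableau l) : A := tab_elt k vdeg_gt0 l (val y).

Lemma tableauP l (y : tableau l) : tab vdeg l (val y).
Proof. exact/asboolP/(valP y). Qed.

(** A scalar from R, written in row l. *)
Definition ver_iota l (a : R) : A := iota_ l (ver_val a).
Fact ver_iota_zmod l : zmod_morphism (ver_iota l).
Proof. by move=> a b; rewrite /ver_iota /= raddfB. Qed.
Fact ver_iota_monoid l : monoid_morphism (ver_iota l).
Proof. by split=> [|a b]; rewrite /ver_iota /= ?rmorph1 ?rmorphM. Qed.
HB.instance Definition _ l := GRing.isZmodMorphism.Build R A (ver_iota l)
  (ver_iota_zmod l).
HB.instance Definition _ l := GRing.isMonoidMorphism.Build R A (ver_iota l)
  (ver_iota_monoid l).

Definition ver_mon u : R := insubd 0 'X_[u].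
Lemma ver_monE u : (d %| mdeg u)%N -> ver_val (ver_mon u) = 'X_[u].
Proof. by move=> du; rewrite /ver_mon val_insubd in_degsX. Qed.

Definition ver_cst (c : k) : R := Veronese (in_degsC _ c (dvdn0 d)).

(** The free R-module P i on the tableaux with i.+1 rows, embedded in A with the
    coefficients written in the next row. *)
Definition vemb i : P i -> A^o := free_lift (ver_iota i.+1)
  (fun y => tableau_elt y : A^o).
HB.instance Definition _ i := GRing.Linear.on (@vemb i).

Lemma vembD i p q : vemb (p + q : P i) = vemb p + vemb q.
Proof. exact: raddfD. Qed.
Lemma vembZ i a p : vemb (a *: p : P i) = ver_iota i.+1 a * vemb p.
Proof. exact: semilinZ. Qed.
Lemma vemb0 i : vemb (0 : P i) = 0. Proof. exact: raddf0. Qed.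
Lemma vembU i (y : tableau i.+1) : vemb << y >> = tableau_elt y.
Proof. exact: free_liftU. Qed.

Lemma tableau_free l (s : seq (tableau l)) (c : tableau l -> S) : uniq s ->
  \sum_(y <- s) tableau_elt y * iota_ l (c y) = 0 -> forall y, y \in s -> c y = 0.
Proof.
move=> us s0 y ys.
pose c' (m : K) : S := if insub m is Some y then c y else 0.
have c'E (z : tableau l) : c' (val z) = c z by rewrite /c' valK.
rewrite -c'E; apply: (@tab_free k n vdeg vdeg_gt0 l [seq val y | y <- s] c').
- by rewrite map_inj_uniq //; apply: val_inj.
- by move=> _ /mapP[z _ ->]; apply: tableauP.
- by rewrite big_map -[RHS]s0; apply: eq_bigr => z _; rewrite c'E.
exact: map_f.
Qed.

Lemma vemb_inj i (p : P i) : vemb p = 0 -> p = 0.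
Proof.
move=> p0; apply/eqP/freeg_eqP => y; rewrite coeff0.
case: (boolP (y \in dom p)) => [yp|]; last exact: coeff_outdom.
apply: val_inj; apply: (@tableau_free _ (dom p) (fun y => ver_val (coeff y p))) => //.
  exact: uniq_dom.
rewrite -[RHS]p0; apply: eq_bigr => z _; exact: mulrC.
Qed.

Lemma iotaC l c (x : A) : iota_ l c%:MP * x = c *: x.
Proof. by rewrite -[c%:MP]mulr1 mul_mpolyC iotaZ rmorph1 -scalerAl mul1r. Qed.

Lemma ver_iotaC l c (x : A) : ver_iota l (ver_cst c) * x = c *: x.
Proof. exact: iotaC. Qed.

Section DegreePart.
Variables (l : nat) (X : choiceType) (b : X -> A).
(** The coefficients in the differential of the ribbon resolution are homogeneous of
    degree d, so dpart loses nothing there ([dpart_vdiff_gen]). *)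
Definition dpart (D : {freeg X / R}) : A :=
  \sum_(x <- dom D) iota_ l (hpart k n d (ver_val (coeff x D))) * b x.

Lemma dpartE (s : seq X) D : uniq s -> {subset dom D <= s} ->
  dpart D = \sum_(x <- s) iota_ l (hpart k n d (ver_val (coeff x D))) * b x.
Proof.
move=> us sD; rewrite [RHS](bigID (mem (dom D))) /= [X in _ + X]big1 ?addr0.
  rewrite -big_filter; apply: perm_big; apply: uniq_perm;
    rewrite ?filter_uniq ?uniq_dom //.
  by move=> x; rewrite mem_filter; case: (boolP (x \in dom D)) => // /sD.
by move=> x /coeff_outdom ->; rewrite /= !linear0 mul0r.
Qed.

Lemma dpartD D E : dpart (D + E) = dpart D + dpart E.
Proof.
pose s := undup (dom D ++ dom E).
have us : uniq s by apply: undup_uniq.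
have sD : {subset dom D <= s} by move=> x xD; rewrite mem_undup mem_cat xD.
have sE : {subset dom E <= s} by move=> x xE; rewrite mem_undup mem_cat xE orbT.
have sDE : {subset dom (D + E) <= s} by move=> x /domD_subset; rewrite mem_undup.
rewrite (dpartE us sD) (dpartE us sE) (dpartE us sDE) -big_split; apply: eq_bigr => x _.
by rewrite coeffD /= !linearD /= mulrDl.
Qed.

Lemma dpart0 : dpart 0 = 0.
Proof. by rewrite /dpart dom0 big_nil. Qed.

Lemma dpartU a x : dpart (a *: << x >>) = iota_ l (hpart k n d (ver_val a)) * b x.
Proof.
have sub : {subset dom (a *: << x >> : {freeg X / R}) <= [:: x]}.
  by move=> y /domZ_subset; rewrite domU1.
by rewrite (dpartE _ sub) // big_seq1 coeffZ coeffU eqxx !mulr1.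
Qed.

Lemma dpartC c D : dpart (ver_cst c *: D) = c *: dpart D.
Proof.
elim/freeg_ind: D => [|a x D IH]; first by rewrite scaler0 dpart0 scaler0.
rewrite scalerDr scalerA !dpartD IH !dpartU scalerDr; congr (_ + _).
by rewrite /= mul_mpolyC hpartZ iotaZ scalerAl.
Qed.
End DegreePart.

Definition mk_tab l (y : K) (ty : tab vdeg l y) : tableau l := exist _ y (asboolT ty).

(** The row i.+1 of t, of degree d, is read as a coefficient, and the rows below it are
    expanded in tableaux. As the coefficients are homogeneous of degree d, dpart
    recovers t as well. *)
Lemma lift_exists i (t : A) : ker_rows vdeg i.+1 (pred1 d) t ->
  exists p : P i, (vemb p : A) = t /\ dpart i.+1 (@tableau_elt i.+1) p = t.
Proof.
move: t; apply: (tab_span (al_gt0 := vdeg_gt0)).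
  split=> [|c x y [p [pj pd]] [q [qj qd]]]; first by exists 0; rewrite vemb0 dpart0.
  exists (ver_cst c *: p + q); rewrite vembD vembZ ver_iotaC dpartD dpartC.
  by split; congr (_ *: _ + _).
move=> y u ty /eqP du.
have vu : ver_val (ver_mon u) = 'X_[u] by apply: ver_monE; rewrite du.
exists (ver_mon u *: << mk_tab ty >>); rewrite vembZ vembU dpartU /ver_iota vu
  hpartX du eqxx mulrC.
by split.
Qed.

Lemma aug_exists (t : A) : ker_rows vdeg 0 (pred1 r) t ->
  exists x : M, iota_ 0 (ver_mod_val x) = t /\ iota_ 0 (hpart k n r (ver_mod_val
    x)) = t.
Proof.
move: t; apply: (tab_span (al_gt0 := vdeg_gt0)).
  split=> [|c x y [p [pj pd]] [q [qj qd]]]; first by exists 0; rewrite /= !linear0.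
  exists (ver_cst c *: p + q); rewrite /= !linearD /= mul_mpolyC hpartZ !iotaZ.
  by split; congr (_ *: _ + _).
move=> y u ty /eqP du; rewrite tab_elt0 // mul1r.
have h : 'X_[u] \in @in_degs k n (mod_degs d r).
  by apply: in_degsX; rewrite /mod_degs du leqnn eqxx.
by exists (VerMod h); rewrite /= hpartX du eqxx.
Qed.

Lemma tableau_elt_shape l (y : tableau l) m : m \in rsupp (tableau_elt y) ->
  shape vdeg l m.
Proof. exact: tab_elt_shape. Qed.

Lemma mu_tableau_elt j l (y : tableau l) : (j.+1 < l)%N -> mu j (tableau_elt y) = 0.
Proof. exact: mu_tab_elt. Qed.

Lemma tableau_elt_ker l (y : tableau l.+1) : ker_rows vdeg l (pred1 (vdeg l))
  (tableau_elt y).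
Proof.
split=> [m /tableau_elt_shape sh|j jl]; last by apply/mu_tableau_elt/ltnW.
split=> [j jl||j jl].
- by have := sh j; rewrite ltnS (ltnW jl).
- by have := sh l; rewrite ltnS leqnn => ->; rewrite /= eqxx.
by have := sh j; rewrite ltnS leqNgt jl.
Qed.

Lemma tableau_elt_row0 l (y : tableau l) (m : K) j : m \in rsupp (tableau_elt y) ->
  (l <= j)%N -> m j = 0%MM.
Proof. by move=> /tableau_elt_shape sh lj; have := sh j; rewrite ltnNge lj. Qed.

Definition vdiff_gen i (y : tableau i.+2) : P i :=
  projT1 (cid (lift_exists (tableau_elt_ker y : ker_rows vdeg i.+1 (pred1 d)
    (tableau_elt y)))).
Lemma vemb_diff_gen i (y : tableau i.+2) : vemb (vdiff_gen y) = tableau_elt y.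
Proof. by rewrite /vdiff_gen; case: cid => p []. Qed.
Lemma dpart_vdiff_gen i (y : tableau i.+2) : dpart i.+1 (@tableau_elt i.+1)
  (vdiff_gen y) = tableau_elt y.
Proof. by rewrite /vdiff_gen; case: cid => p []. Qed.

Definition vaug_gen (y : tableau 1) : M :=
  projT1 (cid (aug_exists (tableau_elt_ker y : ker_rows vdeg 0 (pred1 r)
    (tableau_elt y)))).
Lemma iota_vaug_gen (y : tableau 1) : iota_ 0 (ver_mod_val (vaug_gen y)) =
  tableau_elt y.
Proof. by rewrite /vaug_gen; case: cid => p []. Qed.
Lemma iota_hpart_vaug_gen (y : tableau 1) : iota_ 0 (hpart k n r (ver_mod_val
  (vaug_gen y))) = tableau_elt y.
Proof. by rewrite /vaug_gen; case: cid => p []. Qed.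

Definition vdiff i : {linear P i.+1 -> P i} := freel (@vdiff_gen i).
Definition vaug : {linear P 0 -> M} := freel vaug_gen.

Lemma vdiffU i (y : tableau i.+2) : vdiff i << y >> = vdiff_gen y.
Proof. exact: freelU. Qed.
Lemma vaugU (y : tableau 1) : vaug << y >> = vaug_gen y.
Proof. exact: freelU. Qed.

Lemma mu_ver_iota l a : mu l (ver_iota l.+1 a) = ver_iota l a.
Proof. by rewrite /ver_iota mu_iota eqxx. Qed.

Lemma mu_tableau_elt_fix l j (y : tableau l) : (l <= j.+1)%N ->
  mu j (tableau_elt y) = tableau_elt y.
Proof. by move=> lj; apply: mu_fix => m /tableau_elt_row0; apply. Qed.

(** On generators the differential does not change the element of A and only rereads its
    last row as a coefficient. So it merges the old coefficient row i.+2 into the new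
    one. *)
Lemma mu_vemb i (p : P i.+1) : mu i.+1 (vemb p) = vemb (vdiff i p).
Proof.
elim/freeg_ind: p => [|a y p IH]; first by rewrite vemb0 !linear0 ?vemb0.
rewrite vembD vembZ vembU linearD linearP /= IH vembD vembZ vdiffU vemb_diff_gen
  rmorphM /= mu_ver_iota.
by rewrite mu_tableau_elt_fix.
Qed.

Lemma mu_vemb0 (p : P 0) : mu 0 (vemb p) = iota_ 0 (ver_mod_val (vaug p)).
Proof.
elim/freeg_ind: p => [|a y p IH]; first by rewrite vemb0 !linear0.
rewrite vembD vembZ vembU linearD linearP /= IH !raddfD /= vaugU rmorphM /= mu_ver_iota.
by rewrite mu_tableau_elt_fix // [in RHS]rmorphM /= iota_vaug_gen.
Qed.

Lemma mu_vemb_low i j (p : P i) : (j < i)%N -> mu j (vemb p) = 0.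
Proof.
move=> ji; elim/freeg_ind: p => [|a y p IH]; first by rewrite vemb0 linear0.
by rewrite vembD vembZ vembU linearD /= IH rmorphM /= mu_tableau_elt // mulr0 addr0.
Qed.

Lemma supp_tableau_elt_iota l (y : tableau l) (J' : pred nat) (p : S) :
  p \in in_degs J' ->
  forall m, m \in rsupp (tableau_elt y * iota_ l p) -> shape_last vdeg l J' m.
Proof.
move=> /in_degsP Jp m /rsupp_mul_iota[a [u [ay up ->]]].
have sh := tableau_elt_shape ay; split=> [j jl||j lj].
- by rewrite rmME rowmE (ltn_eqF jl) addm0; have := sh j; rewrite jl.
- by rewrite rmME rowmE eqxx (tableau_elt_row0 ay) // add0m Jp.
by rewrite rmME rowmE (gtn_eqF lj) addm0 (tableau_elt_row0 ay) // ltnW.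
Qed.

Lemma suppD (Q : K -> Prop) (x y : A) :
  (forall m, m \in rsupp x -> Q m) -> (forall m, m \in rsupp y -> Q m) ->
  forall m, m \in rsupp (x + y) -> Q m.
Proof. by have [_ h] := supp_lin k Q; have := h 1 x y; rewrite scale1r. Qed.

Lemma supp0 (Q : K -> Prop) m : m \in rsupp (0 : A) -> Q m.
Proof. by rewrite rsuppE linear0 eqxx. Qed.

Lemma vemb_shape i (p : P i) : forall m, m \in rsupp (vemb p) ->
  shape_last vdeg i.+1 (ver_degs d) m.
Proof.
elim/freeg_ind: p => [|a y p IH]; first by rewrite vemb0; apply: supp0.
rewrite vembD vembZ vembU mulrC; apply: suppD IH; apply: supp_tableau_elt_iota;
  exact: verP.
Qed.

(** By [tab_split_span], since the degree of a nonempty coefficient row is a multiple of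
    d, hence at least d. *)
Lemma vdiffK i (p : P i) : mu i (vemb p) = 0 -> exists q, vdiff i q = p.
Proof.
move=> mp; suff [q e] : exists q, vemb (vdiff i q) = vemb p.
  exists q; apply/eqP; rewrite -subr_eq0; apply/eqP/vemb_inj.
  by rewrite -scaleN1r addrC vembD vembZ rmorphN1 mulN1r e addNr.
apply: (tab_split_span (al_gt0 := vdeg_gt0) (l := i.+1) (J := ver_degs d)
  (E := fun t : A => exists q, vemb (vdiff i q) = t)).
- split=> [|c x y [p1 e1] [p2 e2]]; first by exists 0; rewrite linear0 vemb0.
  by exists (ver_cst c *: p1 + p2); rewrite linearP vembD vembZ ver_iotaC e1 e2.
- move=> y u ty du; exists (ver_mon u *: << mk_tab ty >>).
  by rewrite linearZ /= vdiffU vembZ vemb_diff_gen /ver_iota ver_monE // mulrC.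
- move=> m /vemb_shape[sl sJ s0]; split=> //= D0.
  by rewrite dvdn_leq // /ver_degs dvdn_sub.
move=> j; rewrite ltnS leq_eqVlt => /predU1P[->//|]; exact: mu_vemb_low.
Qed.

(** The case of a single row in [tab_split_span]: the r greatest letters of a monomial
    of M form a tableau of one row. *)
Lemma vaug_surj (x : M) : exists p, vaug p = x.
Proof.
suff [p e] : exists p, iota_ 0 (ver_mod_val (vaug p)) = iota_ 0 (ver_mod_val x).
  by exists p; apply/val_inj/(iota_inj e).
apply: (tab_split_span (al_gt0 := vdeg_gt0) (l := 0) (J := ver_degs d)
  (E := fun t : A => exists p, iota_ 0 (ver_mod_val (vaug p)) = t)).
- split=> [|c y z [p1 e1] [p2 e2]]; first by exists 0; rewrite !linear0.
  exists (ver_cst c *: p1 + p2); rewrite linearP /= linearD /= e2; congr (_ + _).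
  by rewrite rmorphM /= iotaC e1.
- move=> y u ty du; exists (ver_mon u *: << mk_tab ty >>).
  by rewrite linearZ /= vaugU rmorphM /= iota_vaug_gen ver_monE // mulrC.
- move=> m /rsupp_iota[u /(in_degsP _ _ (ver_modP x)) /andP[ru /eqP ur] ->].
  split=> // [|j j0]; last by rewrite rowmE gtn_eqF.
  by rewrite rowmE eqxx /= ru /ver_degs -eqn_mod_dvd // ur eqxx.
by [].
Qed.

Lemma vaug_vdiff p : vaug (vdiff 0 p) = 0.
Proof.
elim/freeg_ind: p => [|a y p IH]; first by rewrite !linear0.
rewrite linearP linearD /= IH addr0 linearZ /= vdiffU.
suff -> : vaug (vdiff_gen y) = 0 by rewrite scaler0.
by apply/val_inj/(@iota_inj k n 0); rewrite -mu_vemb0 vemb_diff_gen mu_tableau_elt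
  // linear0.
Qed.

Lemma vdiff_vdiff i p : vdiff i (vdiff i.+1 p) = 0.
Proof.
elim/freeg_ind: p => [|a y p IH]; first by rewrite !linear0.
rewrite linearP linearD /= IH addr0 linearZ /= vdiffU.
suff -> : vdiff i (vdiff_gen y) = 0 by rewrite scaler0.
by apply: vemb_inj; rewrite -mu_vemb vemb_diff_gen mu_tableau_elt.
Qed.

Lemma vaug_ker p : vaug p = 0 -> exists q, vdiff 0 q = p.
Proof. by move=> p0; apply: vdiffK; rewrite mu_vemb0 p0 /= linear0. Qed.

Lemma vdiff_ker i p : vdiff i p = 0 -> exists q, vdiff i.+1 q = p.
Proof. by move=> p0; apply: vdiffK; rewrite mu_vemb p0 vemb0. Qed.

Section Coefficients.
Variable r' : nat.
Local Notation N := (ver_mod k n d r').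

Fact vembN_bilin i : bilin (ver_iota i.+1)
  (fun (p : P i) (x : N) => vemb p * iota_ i.+1 (ver_mod_val x) : A^o).
Proof.
split=> [x x' y|x y y'|a x y|a x y].
- by rewrite vembD mulrDl.
- by rewrite /= linearD mulrDr.
- by rewrite vembZ -mulrA.
- by rewrite /= rmorphM /= mulrCA.
Qed.

(** The embedding of P i (x) N, with the second factor written in row i.+1. *)
Definition vembN i : tens (P i) N -> A^o := tens_lift (vembN_bilin i).
HB.instance Definition _ i := GRing.Linear.on (@vembN i).

Lemma vembND i t t' : vembN (t + t' : tens (P i) N) = vembN t + vembN t'.
Proof. exact: raddfD. Qed.
Lemma vembN0 i : vembN (0 : tens (P i) N) = 0. Proof. exact: raddf0. Qed.
Lemma vembNZ i a t : vembN (a *: t : tens (P i) N) = ver_iota i.+1 a * vembN t.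
Proof. exact: semilinZ. Qed.
Lemma vembN_pure i (p : P i) (x : N) :
  vembN (tpure p x) = vemb p * iota_ i.+1 (ver_mod_val x).
Proof. exact: tens_liftE. Qed.

Lemma vembN_inj i (t : tens (P i) N) : vembN t = 0 -> t = 0.
Proof.
have [s [x [us ->]]] := tens_free_form t => t0.
suff x0 y : y \in s -> x y = 0.
  rewrite big_seq big1 // => y ys; rewrite x0 // -[0 : N](scale0r 0) tpureZr.
  exact: scale0r.
move=> ys; apply: val_inj.
apply: (@tableau_free _ s (fun y => ver_mod_val (x y))) => //.
rewrite -[RHS]t0; elim: (s) => [|z s' IH]; first by rewrite !big_nil vembN0.
by rewrite !big_cons vembND IH vembN_pure vembU.
Qed.

Lemma mu_vembN i (t : tens (P i.+1) N) : mu i.+1 (vembN t) =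
  vembN (tens_left (vdiff i) t).
Proof.
elim/tens_ind: t => [|a p x t IH]; first by rewrite vembN0 !linear0 ?vembN0.
rewrite vembND vembNZ linearD linearP /= IH vembND vembNZ tens_leftE !vembN_pure.
by rewrite !rmorphM /= mu_ver_iota mu_vemb mu_iota eqxx.
Qed.

Lemma mu_vembN_low i j (t : tens (P i) N) : (j < i)%N -> mu j (vembN t) = 0.
Proof.
move=> ji; elim/tens_ind: t => [|a p x t IH]; first by rewrite vembN0 linear0.
by rewrite vembND vembNZ linearD /= IH vembN_pure !rmorphM /= mu_vemb_low // mul0r
  mulr0 addr0.
Qed.

Lemma vembN_shape i (t : tens (P i) N) :
  forall m, m \in rsupp (vembN t) -> shape_last vdeg i.+1 (mod_degs d r') m.
Proof.
have [s [x [_ ->]]] := tens_free_form t.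
elim: s => [|y s IH]; first by rewrite big_nil vembN0; apply: supp0.
rewrite big_cons vembND; apply: suppD IH; rewrite vembN_pure vembU.
by apply: supp_tableau_elt_iota; apply: ver_modP.
Qed.

(** As in [vdiffK], except that a coefficient row of degree r' is too short: after
    splitting off d letters it would leave no element of N. This is why the part of
    degree r' has to vanish. *)
Lemma tens_vdiffK i (t : tens (P i) N) : mu i (vembN t) = 0 ->
  row_part i.+1 r' (vembN t) = 0 ->
  exists q, tens_left (vdiff i) q = t.
Proof.
move=> mt pt; suff [q e] : exists q, vembN (tens_left (vdiff i) q) = vembN t.
  exists q; apply/eqP; rewrite -subr_eq0; apply/eqP/vembN_inj.
  by rewrite -scaleN1r addrC vembND vembNZ rmorphN1 mulN1r e addNr.
apply: (tab_split_span (al_gt0 := vdeg_gt0) (l := i.+1) (J := mod_degs d r')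
  (E := fun t : A => exists q, vembN (tens_left (vdiff i) q) = t)).
- split=> [|c x y [p1 e1] [p2 e2]]; first by exists 0; rewrite linear0 vembN0.
  exists (ver_cst c *: p1 + p2).
  apply: etrans (congr1 (@vembN i) (tens_left_linear (vdiff i) (ver_cst c) p1 p2)) _.
  by rewrite vembND vembNZ ver_iotaC e1 e2.
- move=> y u ty du; exists (tpure << mk_tab ty >> (VerMod (in_degsX k du))).
  by rewrite tens_leftE vdiffU vembN_pure vemb_diff_gen.
- move=> m mt'; have [sl /andP[rm /eqP mr] s0] := vembN_shape mt'; split=> //= _.
  have ne : mdeg (m i.+1) != r'.
    apply/eqP => e; move: mt'; rewrite rsuppE; have := congr1 (rcoef m) pt.
    by rewrite rcoef_row_part e eqxx linear0 => ->; rewrite eqxx.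
  have dv : (d %| mdeg (m i.+1) - r')%N by rewrite -eqn_mod_dvd // mr.
  have le : (d + r' <= mdeg (m i.+1))%N.
    rewrite addnC -leq_subRL // dvdn_leq // subn_gt0 ltn_neqAle rm andbT.
    by rewrite eq_sym.
  have le' : (d <= mdeg (m i.+1))%N by apply: leq_trans le; apply: leq_addr.
  rewrite le' /mod_degs leq_subRL // le /= -(eqn_modDr d) subnK //.
  by rewrite mr modnDr.
move=> j; rewrite ltnS leq_eqVlt => /predU1P[->//|]; exact: mu_vembN_low.
Qed.

Lemma lowest_cycle i (t : A) : ker_rows vdeg i.+1 (pred1 r') t ->
  exists p : tens (P i) N, vembN p = t.
Proof.
apply: (tab_span (al_gt0 := vdeg_gt0) (l := i.+1) (J := pred1 r')
  (E := fun t : A => exists p : tens (P i) N, vembN p = t)).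
- split=> [|c x y [p1 e1] [p2 e2]]; first by exists 0; rewrite vembN0.
  by exists (ver_cst c *: p1 + p2); rewrite vembND vembNZ ver_iotaC e1 e2.
move=> y u ty /eqP du.
have h : 'X_[u] \in @in_degs k n (mod_degs d r').
  by apply: in_degsX; rewrite /mod_degs du leqnn eqxx.
by exists (tpure << mk_tab ty >> (VerMod h)); rewrite vembN_pure vembU.
Qed.

End Coefficients.
End VeroneseComplex.

(** * The lowest part of a cycle *)

Section LowestPart.
Variables (k : comNzRingType) (n d r r' : nat).
Hypotheses (d_gt0 : (0 < d)%N) (r_gt0 : (0 < r)%N).
Local Notation A := (rowring k n).
Local Notation R := (veronese k n d).
Local Notation M := (ver_mod k n d r).
Local Notation N := (ver_mod k n d r').
Local Notation hpart := (hpart k n).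
Local Notation P i := {freeg (tableau n d r i.+1) / R}.
Local Notation vc := (@ver_const k n d).
Local Notation vdiff := (@vdiff k n d r d_gt0 r_gt0).
Local Notation vaug := (@vaug k n d r d_gt0 r_gt0).
Local Notation vembN := (@vembN k n d r d_gt0 r_gt0 r' _).
Local Notation tableau_elt := (@tableau_elt k n d r d_gt0 r_gt0 _).
Local Notation gmap := (cmp_g vdiff vaug).

Section ConstantPart.
Variables (X : choiceType) (b : X -> A).
Definition cpart : {freeg X / R} -> A := free_lift vc b.
HB.instance Definition _ := GRing.Linear.on cpart.

Lemma cpartD D E : cpart (D + E) = cpart D + cpart E. Proof. exact: raddfD. Qed.
Lemma cpart0 : cpart 0 = 0. Proof. exact: raddf0. Qed.
Lemma cpartZ a D : cpart (a *: D) = vc a *: cpart D. Proof. exact: semilinZ. Qed.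
Lemma cpartU x : cpart << x >> = b x. Proof. exact: free_liftU. Qed.

Lemma dpartZ l a (D : {freeg X / R}) : dpart l b (a *: D) =
  vc a *: dpart l b D + iota_ l (hpart d (ver_val a)) * cpart D.
Proof.
elim/freeg_ind: D => [|c x D IH].
  by rewrite scaler0 dpart0 cpart0 scaler0 mulr0 addr0.
rewrite scalerDr scalerA !dpartD IH !dpartU cpartD cpartZ cpartU scalerDr mulrDr
  addrACA.
congr (_ + _); rewrite /= (hpart_ver_mul d_gt0 (verP a) (verP c)) linearD /= !iotaZ.
by rewrite mulrDl scalerAl -[in RHS]scalerAr [in RHS]scalerAl.
Qed.
End ConstantPart.

(** The lowest part of a syzygy, living in the rows 0, .., i: the part of degree r in M,
    and the part of degree d of the coefficients at each stage. *)
Fixpoint tau i : syz M i -> A :=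
  match i return syz M i -> A with
  | 0 => fun x : M => iota_ 0 (hpart r (ver_mod_val x))
  | j.+1 => fun z => dpart j.+1 (@tau j) (syz_val z)
  end.

(** By the product rule [dpartZ] the defect of semilinearity is a constant part of a
    cycle, and this is the value of the previous tau at a vanishing augmentation. *)
Lemma tau_semilin i a x y : tau (a *: x + y : syz M i) = vc a *: tau x + tau y.
Proof.
elim: i a x y => [|i IH] a x y.
  rewrite /= !linearD /= (hpart_ver_mod (verP a) (ver_modP (x : M))).
  by rewrite iotaZ.
rewrite [LHS]/= (syz_val_lin a x y) dpartD dpartZ.
suff -> : cpart (@tau i) (syz_val x) = 0 by rewrite mulr0 addr0.
have t0 : tau (0 : syz M i) = 0.
  by have := IH (-1) 0 0; rewrite scaler0 addr0 rmorphN1 scaleN1r addNr.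
have h D : cpart (@tau i) D = tau (free_aug D).
  elim/freeg_ind: D => [|c z D IHD]; first by rewrite cpart0 linear0 t0.
  by rewrite cpartD cpartZ cpartU IHD (free_aug_linear c << z >> D) IH free_augU.
by rewrite h free_aug_syz_val t0.
Qed.

Lemma tau0 i : tau (0 : syz M i) = 0.
Proof.
by have := tau_semilin (-1) (0 : syz M i) 0; rewrite scaler0 addr0 rmorphN1
  scaleN1r addNr.
Qed.

Lemma cpart_tau i (D : res M i) : cpart (@tau i) D = tau (free_aug D).
Proof.
elim/freeg_ind: D => [|c z D IHD]; first by rewrite cpart0 linear0 tau0.
by rewrite cpartD cpartZ cpartU IHD (free_aug_linear c << z >> D) tau_semilin free_augU.
Qed.

(** The map Phi from the standard resolution to A is the one induced by this pairing. *)
Fact Phi_bilin i : bilin vc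
  (fun (p : res M i) (x : N) => cpart (@tau i) p * iota_ i.+1 (hpart r'
    (ver_mod_val x))).
Proof.
split=> [x x' y|x y y'|a x y|a x y].
- by rewrite cpartD mulrDl.
- by rewrite /= !linearD mulrDr.
- by rewrite cpartZ scalerAl.
- by rewrite /= (hpart_ver_mod (verP a) (ver_modP y)) iotaZ scalerAr.
Qed.

Local Notation Phi i := (tens_lift (Phi_bilin i)).

Lemma Phi_pure i (p : res M i) (x : N) :
  Phi _ (tpure p x) = cpart (@tau i) p * iota_ i.+1 (hpart r' (ver_mod_val x)).
Proof. exact: tens_liftE. Qed.

(** The constant part of the boundary of p is tau of its augmentation, which is 0. *)
Lemma Phi_diff i (w : tens (res M i.+1) N) : Phi _ (tens_diff w) = 0.
Proof.
elim/tens_ind: w => [|a p x w IH]; first by rewrite linear0 tens_lift0.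
apply: etrans (congr1 (tens_lift (Phi_bilin i)) (tens_diff_linear a (tpure p x) w)) _.
rewrite tens_liftD [X in _ + X]IH addr0 tens_liftZ tens_diffE Phi_pure.
by rewrite cpart_tau free_aug_res_diff tau0 mul0r scaler0.
Qed.

Lemma dpart_gmap i (q : P i) :
  (forall y, exists2 u, gmap i << y >> = << u >> & tau u = tableau_elt y) ->
  dpart i.+1 (@tau i) (gmap i q) = dpart i.+1 (fun y => tableau_elt y) q.
Proof.
move=> h; elim/freeg_ind: q => [|a y q IH]; first by rewrite linear0 !dpart0.
by rewrite (linearP (gmap i)) !dpartD IH; have [u -> tu] := h y; rewrite !dpartU tu.
Qed.

(** The comparison map sends generators to generators by construction, and by induction
    tau recovers tableau_elt y, because the coefficients in the differential of P are
    homogeneous of degree d. *)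
Lemma tau_gmap i y : exists2 u : syz M i, gmap i << y >> = << u >> & tau u =
  tableau_elt y.
Proof.
elim: i y => [|i IH] y.
  exists (vaug_gen k d_gt0 r_gt0 y); last exact: iota_hpart_vaug_gen.
  by apply: etrans (freelU _ _) _; rewrite vaugU.
have [|u e ux] := @res_sect_gen _ _ i (gmap i (vdiff i << y >>)).
  by apply: cmp_g_cycle => [p|j p]; [apply: vaug_vdiff|apply: vdiff_vdiff].
exists u; first by rewrite cmp_gSU.
by rewrite /= ux dpart_gmap // vdiffU; apply: dpart_vdiff_gen.
Qed.

(** Elements of R_+ raise the degree of the last row above r', so both sides are
    semilinear along the constant term, and on generators [tau_gmap] applies. *)
Lemma Phi_gmap i (t : tens (P i) N) :
  Phi _ (tens_left (gmap i) t) = row_part i.+1 r' (vembN t).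
Proof.
elim/tens_ind: t => [|a p x t IH].
  by rewrite vembN0 (raddf0 (tens_left (gmap i))) tens_lift0 linear0.
apply: etrans (congr1 (tens_lift (Phi_bilin i)) (tens_left_linear (gmap i)
  a (tpure p x) t)) _.
rewrite tens_liftD [X in _ + X]IH vembND linearD; congr (_ + _).
rewrite tens_liftZ (vembNZ d_gt0 r_gt0 a (tpure p x)).
rewrite tens_leftE Phi_pure vembN_pure.
elim/freeg_ind: p {IH} => [|c y p IH].
  by rewrite vemb0 linear0 cpart0 !mul0r mulr0 !linear0 ?scaler0.
rewrite (linearP (gmap i)) cpartD vembD !mulrDl mulrDr scalerDr linearD /= [X in _
  + X]IH.
congr (_ + _); have [u -> tu] := tau_gmap y; rewrite cpartZ cpartU tu vembZ vembU.
have -> : ver_iota i.+1 a * (ver_iota i.+1 c * tableau_elt y * iota_ i.+1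
  (ver_mod_val x)) =
   tableau_elt y * iota_ i.+1 (ver_mod_val (a *: (c *: x))).
  by rewrite /= !rmorphM /= /ver_iota [RHS]mulrCA; congr (_ * _);
    rewrite [RHS]mulrCA mulrA.
rewrite row_part_iota => [|m /tableau_elt_row0]; last by apply.
rewrite (hpart_ver_mod (verP a) (ver_modP (c *: x))) /=.
rewrite (hpart_ver_mod (verP c) (ver_modP x)) !iotaZ.
by rewrite -!scalerAr -!scalerAl.
Qed.

Local Notation vdeg := (vdeg d r).

Lemma tens_gd i (t : tens (P i.+1) N) :
  tens_diff (tens_left (gmap i.+1) t) = tens_left (gmap i) (tens_left (vdiff i) t).
Proof.
by apply: tens_cmp_gd => [p|j p]; [apply: vaug_vdiff|apply: vdiff_vdiff].
Qed.

Lemma Phi_cycle_comparison i (t : tens (res M i.+1) N) : tens_diff t = 0 ->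
  exists2 p : tens (P i.+1) N, tens_left (vdiff i) p = 0 &
    exists w, t = tens_left (gmap i.+1) p + tens_diff w.
Proof.
apply: cycle_comparison => [p|j p|x|p|j p].
- exact: vaug_vdiff.
- exact: vdiff_vdiff.
- exact: vaug_surj.
- exact: vaug_ker.
exact: vdiff_ker.
Qed.

(** The common kernel that describes the Schur module of the ribbon (r, d^i.+1, r'). *)
Definition ker_ribbon i (x : A) : Prop :=
  ker_rows vdeg i.+2 (pred1 r') x /\ mu i.+1 x = 0.

Lemma Phi_cycle i (t : tens (res M i.+1) N) : tens_diff t = 0 -> ker_ribbon i (Phi _ t).
Proof.
move=> /Phi_cycle_comparison[p p0 [w ->]]; rewrite tens_liftD [X in _ + X]Phi_diff
  addr0 Phi_gmap.
split; last first.
  rewrite (@mu_row_part _ _ _ _ d) => [|m /vembN_shape[sl _ _]]; last exact: sl.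
  by rewrite mu_vembN p0 vembN0 linear0.
split=> [m /rsupp_row_part[/vembN_shape[sl _ s0] mr]|j jl].
  by split=> //; rewrite /= mr.
by rewrite mu_row_part_comm ?mu_vembN_low ?linear0 // ltnW.
Qed.

(** Up to a boundary the cycle comes from P (x) N, and there vanishing of the lowest
    part makes it a boundary by [tens_vdiffK]. *)
Lemma Phi_injective i (t : tens (res M i.+1) N) : tens_diff t = 0 -> Phi _ t = 0 ->
  exists w : tens (res M i.+2) N, tens_diff w = t.
Proof.
move=> /Phi_cycle_comparison[p p0 [w ->]]; rewrite tens_liftD [X in _ + X]Phi_diff
  addr0 Phi_gmap => h.
have [|q <-] := @tens_vdiffK _ _ _ _ d_gt0 r_gt0 r' _ p _ h.
  by rewrite mu_vembN p0 vembN0.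
exists (tens_left (gmap i.+2) q + w).
by rewrite -tens_gd linearD.
Qed.

(** By [tab_span] an element concentrated in degree r' of the last row comes from P (x)
    N, and there it is a cycle because the differential is a merging. *)
Lemma Phi_surjective i (x : A) : ker_ribbon i x ->
  exists2 t : tens (res M i.+1) N, tens_diff t = 0 & Phi _ t = x.
Proof.
move=> [xi xm]; have [p e] := lowest_cycle d_gt0 r_gt0 xi.
exists (tens_left (gmap i.+1) p).
  suff p0 : tens_left (vdiff i) p = 0 by rewrite (tens_gd p) p0; exact: raddf0.
  by apply: vembN_inj; rewrite -mu_vembN e.
rewrite Phi_gmap e row_part_id // => m /(xi.1) [_ /eqP -> _] //.
Qed.

End LowestPart.

(** * Symmetric tensors in the row ring *)

Section RowAction.
Variables (k : comNzRingType) (n : nat) (g : 'M[k]_n).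
Local Notation K := (rowmon n).
Local Notation A := (rowring k n).

Definition act_mon (m : K) : A := \prod_(j <- rows m) iota_ j (Defs.act g 'X_[m j]).

Lemma act_monE (s : seq nat) (m : K) : uniq s -> {subset rows m <= s} ->
  act_mon m = \prod_(j <- s) iota_ j (Defs.act g 'X_[m j]).
Proof.
move=> us sm; rewrite [RHS](bigID (mem (rows m))) /= [X in _ * X]big1 ?mulr1.
  rewrite -big_filter; apply: perm_big; apply: uniq_perm;
    rewrite ?filter_uniq ?rows_uniq //.
  by move=> x; rewrite mem_filter; case: (boolP (x \in rows m)) => // /sm.
by move=> j; rewrite rowsE negbK => /eqP ->; rewrite mpolyX0 !rmorph1.
Qed.

Definition actA : A -> A := mlift act_mon.
HB.instance Definition _ := GRing.Linear.on actA.

Lemma actAM x y : actA (x * y) = actA x * actA y.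
Proof.
apply: mliftM => m1 m2; pose s := undup (rows m1 ++ rows m2).
have us : uniq s by apply: undup_uniq.
have s1 : {subset rows m1 <= s} by move=> j; rewrite mem_undup mem_cat => ->.
have s2 : {subset rows m2 <= s} by move=> j; rewrite mem_undup mem_cat orbC => ->.
have s12 : {subset rows (rmM m1 m2) <= s}.
  by move=> j; rewrite mem_undup mem_cat !rowsE rmME mnmD_eq0 negb_and.
rewrite (act_monE us s1) (act_monE us s2) (act_monE us s12) -big_split.
by apply: eq_bigr => j _; rewrite rmME mpolyXD !rmorphM.
Qed.

Lemma actA1 : actA 1 = 1.
Proof.
apply: mlift1; rewrite (@act_monE [::]) ?big_nil // => j.
by rewrite rowsE rm1E eqxx.
Qed.

Lemma actA_iota j p : actA (iota_ j p) = iota_ j (Defs.act g p).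
Proof.
elim/mpoly_lin_ind: p => [|c u p IH]; first by rewrite !linear0.
rewrite !linearP /= IH iotaX; congr (_ *: _ + _); rewrite /actA mliftX.
have sub : {subset rows (rowm j u) <= [:: j]}.
  by move=> i; rewrite rowsE rowmE inE; case: (i =P j) => // _; rewrite eqxx.
by rewrite (act_monE _ sub) // big_seq1 rowmE eqxx.
Qed.
End RowAction.

Section SymmetricTensors.
Variables (k : comNzRingType) (n : nat).
Local Notation K := (rowmon n).
Local Notation A := (rowring k n).
Local Notation S := {mpoly k[n]}.
Local Notation symtens := (symtens k n).

Definition scalA (c : k^o) : A := (c : k)%:A.
Fact scalA_linear : linear_for (idfun \; *:%R) scalA.
Proof. by move=> a x y; rewrite /scalA /= scalerDl -scalerA. Qed.
HB.instance Definition _ := GRing.isLinear.Build k k^o A (idfun \;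
  *:%R) scalA scalA_linear.

Lemma rowemb_bilin (V : lmodType k) j a (f : {linear V -> A | idfun \; *:%R}) :
  bilin idfun (fun (p : dhomog n k a) (t : V) => iota_ j (mpoly_of_dhomog p) * f t).
Proof.
split=> [x x' y|x y y'|c x y|c x y].
- by rewrite /= !linearD mulrDl.
- by rewrite raddfD mulrDr.
- by rewrite /= !linearZ scalerAl.
- by rewrite semilinZ scalerAr.
Qed.

(** Tensors of symmetric powers as elements of A, the factors being written in the rows
    j, j.+1, and so on. *)
Fixpoint rowemb (s : seq nat) (j : nat) : {linear symtens s -> A | idfun \; *:%R} :=
  match s return {linear symtens s -> A | idfun \; *:%R} with
  | [::] => scalA
  | a :: s' => tens_lift (rowemb_bilin j a (rowemb s' j.+1))
  end.

Lemma rowemb_pure a s j (p : dhomog n k a) (t : symtens s) :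
  rowemb (a :: s) j (tpure p t) = iota_ j (mpoly_of_dhomog p) * rowemb s j.+1 t.
Proof. exact: tens_liftE. Qed.

Lemma rowemb_supp s j t : forall m : K, m \in rsupp (rowemb s j t) ->
  forall i, (i < j)%N -> m i = 0%MM.
Proof.
elim: s j t => [|a s IH] j t.
  move=> m; rewrite [rowemb _ _ _]/(_%:A) rsuppE linearZ /= -rX1 rcoefX.
  by have [<- _ i _|_] := eqVneq (rm1 n) m; rewrite ?rm1E // mulr0 eqxx.
have [Q0 QD] := @supp_lin k n (fun m => forall i, (i < j)%N -> m i = 0%MM).
elim/tens_ind: t => [|c p t t' IHt]; first by rewrite raddf0.
rewrite semilin; apply: (QD c) IHt.
rewrite rowemb_pure mulrC => m /rsupp_mul_iota[b [u [/IH b0 _ ->]]] i ij.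
by rewrite rmME rowmE (ltn_eqF ij) addm0 b0 // ltnW.
Qed.

Fixpoint mon_tens (s : seq nat) (j : nat) (m : K) : symtens s :=
  match s return symtens s with
  | [::] => 1 : k^o
  | a :: s' => tpure (indhomog a ('X_[m j] : S)) (mon_tens s' j.+1 m)
  end.

Lemma mon_tens_ext s j (m m' : K) : (forall i, (j <= i)%N -> m i = m' i) ->
  mon_tens s j m = mon_tens s j m'.
Proof.
elim: s j => //= a s IH j e; rewrite e // (IH j.+1) // => i ji.
by rewrite e // ltnW.
Qed.

(** A retraction of [rowemb], which is therefore injective. *)
Definition rowsplit s j : A -> symtens s := mlift (mon_tens s j).
HB.instance Definition _ s j := GRing.Linear.on (rowsplit s j).

Lemma rowsplitD s j x y : rowsplit s j (x + y) = rowsplit s j x + rowsplit s j y.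
Proof. exact: linearD. Qed.
Lemma rowsplit0 s j : rowsplit s j 0 = 0. Proof. exact: linear0. Qed.
Lemma rowsplitZ s j c x : rowsplit s j (c *: x) = c *: rowsplit s j x.
Proof. exact: linearZ. Qed.
Lemma rowsplitX s j m : rowsplit s j (rX k m) = mon_tens s j m.
Proof. exact: mliftX. Qed.

Lemma dhomog_sum a (p : dhomog n k a) :
  p = \sum_(u <- msupp (mpoly_of_dhomog p)) (mpoly_of_dhomog p)@_u *: indhomog a 'X_[u].
Proof.
apply: val_inj; rewrite /= raddf_sum /= {1}[mpoly_of_dhomog p]mpolyE.
rewrite !big_seq; apply: eq_bigr => u up; rewrite /indhomog val_insubd.
by rewrite dhomogX; have := dhomogP _ _ _ (dhomog_is_dhomog p) u up => /eqP ->.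
Qed.

Lemma rowsplit_mul a s j (p : dhomog n k a) (x : A) :
  (forall m : K, m \in rsupp x -> m j = 0%MM) ->
  rowsplit (a :: s) j (iota_ j (mpoly_of_dhomog p) * x) = tpure p (rowsplit s j.+1 x).
Proof.
move=> x0; elim/rsupp_ind: x / x0 => [|c m x mj IH].
  by rewrite mulr0 !rowsplit0 -[0 : symtens s](scale0r 0) tpureZr scale0r.
rewrite mulrDr !rowsplitD IH tpureDr -scalerAr !rowsplitZ tpureZr; congr (_ *: _ + _).
rewrite rowsplitX {2}[p]dhomog_sum {1}[mpoly_of_dhomog p]mpolyE.
have tp s' (c' : 'X_{1..n} -> k) (b : 'X_{1..n} -> dhomog n k a) t :
    tpure (\sum_(u <- s') c' u *: b u) t = \sum_(u <- s') c' u *: tpure (b u)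
      t :> tens _ (symtens s).
  elim: s' => [|u s' IHs]; first by rewrite !big_nil tpure0l.
  by rewrite !big_cons tpureDl tpureZl IHs.
have -> : iota_ j (\sum_(u <- msupp (mpoly_of_dhomog p))
  (mpoly_of_dhomog p)@_u *: 'X_[u]) =
    \sum_(u <- msupp (mpoly_of_dhomog p)) (mpoly_of_dhomog p)@_u *: rX k (rowm j u).
  by rewrite linear_sum; apply: eq_bigr => u _; rewrite linearZ /= iotaX.
rewrite tp mulr_suml (raddf_sum (rowsplit (a :: s) j)); apply: eq_bigr => u _.
rewrite -scalerAl; apply: etrans (rowsplitZ _ _ _ _) _; congr (_ *: _).
rewrite rXM rowsplitX /= rmME rowmE eqxx mj addm0; congr tpure.
apply: mon_tens_ext => i ji; rewrite rmME rowmE gtn_eqF // add0m //.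
Qed.

Lemma rowembK s j t : rowsplit s j (rowemb s j t) = t.
Proof.
elim: s j t => [|a s IH] j t.
  rewrite [rowemb _ _ _]/(_%:A) rowsplitZ -rX1 rowsplitX; exact: mulr1.
elim/tens_ind: t => [|c p t t' IHt]; first by rewrite raddf0 rowsplit0.
rewrite semilin rowsplitD IHt rowsplitZ rowemb_pure; congr (_ *: _ + _).
by rewrite rowsplit_mul ?IH // => m /rowemb_supp; apply.
Qed.

Lemma rowemb_inj s j : injective (rowemb s j).
Proof. exact: can_inj (@rowembK s j). Qed.

Lemma rowemb_act g s j t : rowemb s j (symtens_act g s t) = actA g (rowemb s j t).
Proof.
elim: s j t => [|a s IH] j t.
  by rewrite /= [scalA _]/(_%:A) linearZ /= actA1.
elim/tens_ind: t => [|c p t t' IHt]; first by rewrite !raddf0.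
rewrite !semilin linearP /=.
apply: etrans (congr2 +%R _ IHt) _; last by [].
by rewrite tens_mapE rowemb_pure rowemb_pure actAM actA_iota IH.
Qed.

Section Schur.
Variable D : {fset nat * nat}.

Lemma rowemb_row_tensor (v : D -> dhomog n k 1) (l : seq nat) j :
  rowemb (map (row_size D) l) j (row_tensor v l) =
  \prod_(t < size l) iota_ (j + t)%N (mpoly_of_dhomog (row_prod v (nth 0%N l t))).
Proof.
elim: l j => [|i l IH] j; first by rewrite big_ord0; exact: scale1r.
rewrite [LHS]rowemb_pure IH big_ord_recl /= addn0; congr (_ * _).
by apply: eq_bigr => t _; rewrite /= /bump leq0n add1n addnS addSn.
Qed.
End Schur.

End SymmetricTensors.

(** * Ribbon Schur modules as common kernels *)

Section RibbonSchur.
Variables (k : comNzRingType) (n : nat).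
Variables (al : nat -> nat) (al_gt0 : forall t, (0 < al t)%N) (l : nat).
Local Notation K := (rowmon n).
Local Notation A := (rowring k n).
Local Notation D := (ribbon (mkseq al l)).
Local Notation crow := (@crow al l).
Local Notation ccol := (@ccol al l).

Lemma diag_rows_ribbon : diag_rows D = rev (iota 0 l).
Proof.
apply: (@sorted_eq _ geq).
- by move=> y x z /= yx zy; apply: leq_trans yx.
- by move=> x y /=; rewrite andbC -eqn_leq => /eqP.
- by apply: sort_sorted => x y; apply: leq_total.
- by rewrite rev_sorted; apply: iota_sorted.
rewrite /diag_rows perm_sort; apply: uniq_perm.
- exact: undup_uniq.
- by rewrite rev_uniq iota_uniq.
move=> x; rewrite mem_undup mem_rev mem_iota /= add0n; apply/mapP/idP.
  by case=> c; rewrite mem_ribbon => /andP[h _] ->.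
move=> xl; have tl : (l.-1 - x < l)%N by lia.
exists (val (cell tl (al_gt0 (l.-1 - x)))); first exact: valP.
by rewrite /=; lia.
Qed.

Lemma rowemb_ribbon_row (v : D -> dhomog n k 1) :
  rowemb k n _ 0 (row_tensor v (diag_rows D)) = \prod_c iota_ (crow c)
    (mpoly_of_dhomog (v c)).
Proof.
rewrite rowemb_row_tensor diag_rows_ribbon size_rev size_iota.
rewrite (partition_big (fun c => Ordinal (crow_lt c)) xpredT) //=.
apply: eq_bigr => t _; have tl := ltn_ord t; rewrite add0n nth_rev ?size_iota //
  nth_iota ?add0n; last by lia.
rewrite rmorph_prod; apply: eq_big => c.
  rewrite /cell_row -(inj_eq val_inj) /= /crow.
  have := valP c; rewrite mem_ribbon => /andP[h _].
  move: h tl; rewrite -[fsval c]/(val c) -[nat_of_ord t]/(val t).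
  by move: (val c).1 (val t) => a b h tl; apply/eqP/eqP; lia.
move=> /eqP e; congr (iota_ _ _); rewrite /crow -/(cell_row c) e.
lia.
Qed.

Lemma rowemb_col_antisym (v : D -> dhomog n k 1) :
  rowemb k n _ 0 (col_antisym v) = antisym crow ccol (fun c => mpoly_of_dhomog (v c)).
Proof.
rewrite /col_antisym raddf_sum; apply: eq_bigr => w _.
by apply: etrans (semilinZ _ _ _) _; rewrite rowemb_ribbon_row.
Qed.

Definition mhomog (f : nat -> nat) (x : A) : Prop :=
  forall m : K, m \in rsupp x -> forall j, mdeg (m j) = f j.

Lemma mhomog_lin f : lin_closed (mhomog f).
Proof. exact: (supp_lin k (fun m : K => forall j, mdeg (m j) = f j)). Qed.

Lemma mhomog_iota_mul f j e (x : A) p : mhomog f x -> p \is e.-homog ->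
  mhomog (fun i => (e * (j == i) + f i)%N) (iota_ j p * x).
Proof.
move=> fx /dhomogP hp m; rewrite mulrC => /rsupp_mul_iota[a [u [ax up ->]]] i.
rewrite rmME rowmE mdegD (fx _ ax) eq_sym addnC; congr (_ + _)%N.
by case: eqP => _; rewrite ?muln1 ?muln0 ?mdeg0 //; apply: hp.
Qed.

Lemma mhomog1 : mhomog (fun=> 0%N) 1.
Proof.
move=> m; rewrite -rX1 rsuppE rcoefX; have [<- _ j|_] := eqVneq (rm1 n) m;
  first by rewrite rm1E mdeg0.
by rewrite eqxx.
Qed.

Lemma antisym_mhomog (v : D -> dhomog n k 1) :
  mhomog (fun j => if (j < l)%N then al j else 0%N)
    (antisym crow ccol (fun c => mpoly_of_dhomog (v c))).
Proof.
rewrite /antisym; have [Z ZD] := mhomog_lin (fun j => if (j < l)%N then al j else 0%N).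
apply: (big_ind (mhomog _)) => //; first by move=> x y hx hy; rewrite -[x]scale1r;
  apply: ZD.
move=> w _; rewrite -[_ *: _]addr0; apply: (ZD _ _ _ _ Z).
have h (s : seq D) : mhomog (fun j => \sum_(c <- s) (crow c == j))%N
    (\prod_(c <- s) iota_ (crow c) (mpoly_of_dhomog (v (w c)))).
  elim: s => [|c s IH].
    by rewrite big_nil => m hm j; rewrite big_nil; apply: mhomog1 hm j.
  rewrite big_cons => m hm j; rewrite big_cons -[(crow c == j) : nat]mul1n.
  exact: (mhomog_iota_mul IH (dhomog_is_dhomog (v (w c))) hm j).
move=> m hm j; rewrite (h _ _ hm j) -big_mkcond sum1_card.
by case: ltnP => jl; [apply: card_row|apply: card_row0].
Qed.

Local Notation schur := (schur k n D).

Lemma schur_sub_ker (t : schur) :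
  mhomog (fun j => if (j < l)%N then al j else 0%N) (rowemb k n _ 0 (val t)) /\
  forall j, (j.+1 < l)%N -> mu j (rowemb k n _ 0 (val t)) = 0.
Proof.
case: t => t /= /asboolP; elim=> [|c x y [v ->] _ [IH1 IH2]].
  by rewrite raddf0; split=> [m|j _]; rewrite ?linear0 // rsuppE linear0 eqxx.
rewrite semilin rowemb_col_antisym; split.
  by have [_ ZD] := mhomog_lin (fun j => if (j < l)%N then al j else 0%N);
     apply: ZD IH1; apply: antisym_mhomog.
by move=> j jl; rewrite linearP /= mu_ribbon // scaler0 add0r IH2.
Qed.

(** The case of [tab_span] with a trivial coefficient row, of degree 0. *)
Lemma ker_sub_schur (x : A) :
  mhomog (fun j => if (j < l)%N then al j else 0%N) x ->
  (forall j, (j.+1 < l)%N -> mu j x = 0) ->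
  exists t : schur, rowemb k n _ 0 (val t) = x.
Proof.
move=> xh xk; move: x {xh xk} (conj xh xk) => x [xh xk].
apply: (tab_span (al_gt0 := al_gt0) (l := l) (J := pred1 0%N)
  (E := fun x : A => exists t : schur, rowemb k n _ 0 (val t) = x)).
- split=> [|c y z [t <-] [u <-]]; first by exists 0; rewrite /= raddf0.
  by exists (c *: t + u); rewrite /= semilin.
- move=> y u ty /=; rewrite mdeg_eq0 => /eqP ->; rewrite mpolyX0 rmorph1 mulr1.
  have [f ->] := tab_elt_antisym k al_gt0 ty.
  have h c : ('X_(f c) : {mpoly k[n]}) \is 1.-homog by rewrite dhomogX; apply/eqP/mdeg1.
  pose v c := DHomog (h c).
  have hv : col_antisym v \in span_pred (fun t => exists v, t = col_antisym v).
    by apply/asboolP/span_gen; exists v.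
  by exists (Spanm hv); rewrite /= rowemb_col_antisym.
split=> // m mx; split=> [j jl||j lj].
- by rewrite (xh _ mx) jl.
- by rewrite /= (xh _ mx) ltnn.
by apply/eqP; rewrite -mdeg_eq0 (xh _ mx) ltnNge ltnW.
Qed.

Lemma rowemb_schur_inj (t u : schur) : rowemb k n _ 0 (val t) =
  rowemb k n _ 0 (val u) -> t = u.
Proof. by move/rowemb_inj/val_inj. Qed.

Lemma rowemb_schur_act g (t : schur) : rowemb k n _ 0 (val (schur_act g t)) =
  actA g (rowemb k n _ 0 (val t)).
Proof. exact: rowemb_act. Qed.

End RibbonSchur.

(** * Equivariance of the lowest part *)

Section PhiAction.
Variables (k : comNzRingType) (n d r r' : nat).
Hypotheses (d_gt0 : (0 < d)%N).
Variable g : 'M[k]_n.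
Local Notation A := (rowring k n).
Local Notation S := {mpoly k[n]}.
Local Notation R := (veronese k n d).
Local Notation M := (ver_mod k n d r).
Local Notation N := (ver_mod k n d r').
Local Notation actM := (ver_mod_act g : {linear M -> M | ver_act g \; *:%R}).
Local Notation actN := (ver_mod_act g : {linear N -> N | ver_act g \; *:%R}).

Lemma act_const (p : S) : (Defs.act g p)@_0%MM = p@_0%MM.
Proof.
elim/mpoly_lin_ind: p => [|c u p IH]; first by rewrite !linear0.
rewrite !linearP /= IH; congr (_ * _ + _); rewrite mcoeffX.
have [->|u0] := eqVneq u 0%MM; first by rewrite mpolyX0 rmorph1 mcoeff1 eqxx.
apply: (@dhomog_nemf_coeff _ _ mdeg (mdeg u)); first by rewrite act_dhomog ?dhomogX.
by change (mdeg (0%MM : 'X_{1..n}) != mdeg u); rewrite mdeg0 eq_sym mdeg_eq0.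
Qed.

Lemma ver_const_act (a : R) : ver_const (ver_act g a) = ver_const a.
Proof. exact: act_const. Qed.

Lemma cpart_act (X Y : choiceType) (h : X -> Y) (b : X -> A) (b' : Y ->
  A) (D : {freeg X / R}) :
  (forall x, b' (h x) = actA g (b x)) ->
  cpart b' (free_map (ver_act g) h D) = actA g (cpart b D).
Proof.
move=> hb; elim/freeg_ind: D => [|a x D IH]; first by rewrite (raddf0 (free_map _
  h)) !cpart0 linear0.
rewrite (semilin (free_map _ _)) cpartD cpartZ IH cpartD cpartZ linearP;
  congr (_ *: _ + _).
  exact: ver_const_act.
by rewrite /= free_mapU !cpartU hb.
Qed.

Lemma dpart_act l (X Y : choiceType) (h : X -> Y) (b : X -> A) (b' : Y -> A)
    (D : {freeg X / R}) :
  (forall x, b' (h x) = actA g (b x)) ->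
  dpart l b' (free_map (ver_act g) h D) = actA g (dpart l b D).
Proof.
move=> hb; elim/freeg_ind: D => [|a x D IH]; first by rewrite (raddf0 (free_map _
  h)) !dpart0 linear0.
rewrite (semilin (free_map _ _)) dpartD IH dpartD linearD; congr (_ + _).
by rewrite /= free_mapU !dpartU actAM actA_iota act_hpart hb.
Qed.

(** The part of degree e, the row embeddings and products all commute with g. *)
Lemma tau_act i (z : syz M i) : tau (syz_map actM i z) = actA g (tau z).
Proof.
elim: i z => [|i IH] z; first by rewrite /= actA_iota act_hpart.
exact: (dpart_act i.+1 (syz_val z) IH).
Qed.

Lemma Phi_act i (t : tens (res M i) N) :
  tens_lift (Phi_bilin k n d r r' i) (tens_res_map actM actN i t) =
  actA g (tens_lift (Phi_bilin k n d r r' i) t).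
Proof.
elim/tens_ind: t => [|a p x t IH]; first by rewrite raddf0 tens_lift0 linear0.
apply: etrans (congr1 _ (semilin (tens_res_map actM actN i) a (tpure p x) t)) _.
rewrite !tens_liftD [X in _ + X]IH !tens_liftZ linearD linearZ.
congr (_ *: _ + _); first exact: ver_const_act.
apply: etrans (congr1 _ (tens_mapE (res_map actM i) actN p x)) _.
rewrite !Phi_pure [RHS]actAM actA_iota act_hpart; congr (_ * _).
by apply: cpart_act; apply: tau_act.
Qed.

End PhiAction.

(** * The isomorphism *)

Section Isomorphism.
Variables (k : comNzRingType) (n d r r' : nat).
Hypotheses (d_gt0 : (0 < d)%N) (r_gt0 : (0 < r)%N) (r'_gt0 : (0 < r')%N).
Variable i : nat.
Local Notation A := (rowring k n).
Local Notation R := (veronese k n d).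
Local Notation M := (ver_mod k n d r).
Local Notation N := (ver_mod k n d r').
Local Notation Phi := (tens_lift (Phi_bilin k n d r r' i.+1)).
Local Notation vc := (@ver_const k n d).
Local Notation Tor := (Tor i.+1 M N).

(** Row lengths are functions on nat here; the default 1 keeps them positive beyond the
    ribbon. *)
Definition rowlen (j : nat) : nat := nth 1%N (rcons (r :: nseq i.+1 d) r') j.

Lemma rowlen_al j : (j < i.+2)%N -> rowlen j = vdeg d r j.
Proof.
move=> ji; rewrite /rowlen nth_rcons /= size_nseq ji.
by case: j ji => // j; rewrite ltnS /= => ji; rewrite -[LHS]/(nth _ (nseq i.+1 d)
  j) nth_nseq ji.
Qed.

Lemma rowlen_last : rowlen i.+2 = r'.
Proof. by rewrite /rowlen nth_rcons /= size_nseq ltnn eqxx. Qed.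

Lemma rowlen_gt0 j : (0 < rowlen j)%N.
Proof.
have [ji|ij|->] := ltngtP j i.+2; last by rewrite rowlen_last.
  by rewrite rowlen_al //; case: (j).
by rewrite /rowlen nth_default // size_rcons /= size_nseq.
Qed.

Lemma mkseq_rowlen : mkseq rowlen i.+3 = r :: rcons (nseq i.+1 d) r'.
Proof.
have -> : i.+3 = size (rcons (r :: nseq i.+1 d) r') by rewrite size_rcons /= size_nseq.
exact: mkseq_nth.
Qed.

Local Notation D := (ribbon (mkseq rowlen i.+3)).
Local Notation schur := (schur k n D).
Local Notation schurA t := (rowemb k n _ 0 (val (t : schur))).

Lemma ker_ribbon_schur (x : A) : ker_ribbon d r r' i x <-> exists t : schur,
  schurA t = x.
Proof.
split=> [[[sh ker] kl]|[t <-]].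
  apply: (ker_sub_schur rowlen_gt0) => [m mx j|j].
    have [sl /eqP sr s0] := sh _ mx; rewrite ltnS.
    have [ji|ij|->] := ltngtP j i.+2; first by rewrite sl // rowlen_al.
      by rewrite s0 // mdeg0.
    by rewrite sr rowlen_last.
  by rewrite !ltnS leq_eqVlt => /predU1P[->|ji] //; apply: ker.
have [hom ker] := schur_sub_ker rowlen_gt0 t.
split; last by apply: ker.
split=> [m mx|j jl]; last by apply: ker; rewrite ltnS ltnW.
have hm := hom _ mx; split=> [j jl||j jl]; first by rewrite hm ltnS ltnW // rowlen_al.
  by rewrite /= hm ltnSn rowlen_last.
by apply/eqP; rewrite -mdeg_eq0 hm ltnNge jl.
Qed.

Local Notation cycles := (kerm (tens_diff_out M N i.+1)).

Lemma cycle_diff (z : cycles) : tens_diff (val z : tens (res M i.+1) N) = 0.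
Proof. exact: (eqP (kermP z)). Qed.

Definition Phi_ker (z : cycles) : A := Phi (val z).
Fact Phi_ker_linear : linear_for (vc \; *:%R) Phi_ker.
Proof. by move=> a x y; apply: tens_lift_linear. Qed.
HB.instance Definition _ := GRing.isLinear.Build R cycles A (vc \;
  *:%R) Phi_ker Phi_ker_linear.

Definition TorPhi : Tor -> A := quot_lift Phi_ker.

Lemma Phi_ker_boundary (z : cycles) :
  (exists w : tens (res M i.+2) N, tens_diff w = val z) -> Phi_ker z = 0.
Proof. by case=> w e; rewrite /Phi_ker -e; apply: Phi_diff. Qed.

Lemma TorPhiE (z : cycles) : TorPhi (\pi_Tor z) = Phi_ker z.
Proof. exact: (quot_liftE Phi_ker_boundary). Qed.

Lemma TorPhi_linear : linear_for (vc \; *:%R) TorPhi.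
Proof. exact: (quot_lift_linear Phi_ker_boundary). Qed.

Lemma TorPhi_schur (t : Tor) : exists s : schur, schurA s = TorPhi t.
Proof.
apply/ker_ribbon_schur; rewrite -[t]reprK TorPhiE.
by apply: (Phi_cycle d_gt0 r_gt0); apply: cycle_diff.
Qed.

(** The image of TorPhi is the embedded Schur module, by [Phi_cycle] and
    [ker_ribbon_schur]. *)
Definition tor_schur (t : Tor) : schur := projT1 (cid (TorPhi_schur t)).

Lemma tor_schurE t : schurA (tor_schur t) = TorPhi t.
Proof. by rewrite /tor_schur; case: cid. Qed.

Fact tor_schur_linear : linear_for (vc \; *:%R) tor_schur.
Proof.
move=> a x y; apply: rowemb_schur_inj.
rewrite tor_schurE TorPhi_linear /=.
rewrite (semilin (rowemb k n _ 0)) !tor_schurE //.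
Qed.
HB.instance Definition _ := GRing.isLinear.Build R Tor schur (vc \; *:%R)
  tor_schur tor_schur_linear.

Lemma tor_schur_inj : injective tor_schur.
Proof.
move=> x y e; apply/eqP; rewrite -subr_eq0; apply/eqP.
rewrite addrC -scaleN1r.
have : TorPhi (-1 *: y + x) = 0.
  by rewrite TorPhi_linear -!tor_schurE e /= rmorphN1 scaleN1r addNr.
rewrite -[-1 *: y + x]reprK TorPhiE; move: (repr _) => z z0.
have [w e'] := Phi_injective d_gt0 r_gt0 (cycle_diff z) z0.
rewrite -[RHS](raddf0 (\pi_Tor)); apply/eqP/quotm_eqP; rewrite subr0.
by apply: span_gen; exists w.
Qed.

Lemma tor_schur_surj (s : schur) : exists t, tor_schur t = s.
Proof.
have /ker_ribbon_schur/(Phi_surjective d_gt0 r_gt0)[t t0 e] : exists s' : schur,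
  schurA s' = schurA s.
  by exists s.
have hz : t \in ker_pred (tens_diff_out M N i.+1) by rewrite unfold_in; apply/eqP.
exists (\pi_Tor (Kerm hz)); apply: rowemb_schur_inj.
by rewrite tor_schurE TorPhiE.
Qed.

Lemma tor_schur_bij : bijective tor_schur.
Proof.
exists (fun s => projT1 (cid (tor_schur_surj s))) => [t|s].
  by apply: tor_schur_inj; case: cid.
by case: cid.
Qed.

Lemma tor_schur_act g t : tor_schur (Tor_act g t) = schur_act g (tor_schur t).
Proof.
apply: rowemb_schur_inj; rewrite rowemb_schur_act !tor_schurE.
rewrite -[t]reprK; move: (repr t) => z.
rewrite /Tor_act /Tor_map quot_mapE => [|y [w wy]].
  by rewrite !TorPhiE; apply: Phi_act.
apply: span_gen; exists (tens_res_map (ver_mod_act g) (ver_mod_act g) i.+2 w).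
by rewrite tens_res_map_diff wy.
Qed.

End Isomorphism.

Lemma ver_plus_const (k : comNzRingType) (n d : nat) (a : veronese k n d) :
  (0 < d)%N -> a \in ver_plus -> ver_const a = 0.
Proof.
move=> d_gt0 ha; apply: memN_msupp_eq0; apply/negP => h.
have /in_degsP/(_ _ h) := ha.
by rewrite mdeg0 /mod_degs leqNgt d_gt0.
Qed.

Theorem theorem1p8 (k : comNzRingType) (n d r r' : nat)
    (d_gt0 : (0 < d)%N) (r_gt0 : (0 < r)%N) (r'_gt0 : (0 < r')%N)
    (i : nat) (i_gt0 : (0 < i)%N) :
  (forall (a : veronese k n d) (t : Tor i (ver_mod k n d r) (ver_mod k n d r')),
      a \in ver_plus -> a *: t = 0) /\
  exists phi : {linear Tor i (ver_mod k n d r) (ver_mod k n d r') ->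
                  schur k n (ribbon (r :: rcons (nseq i d) r'))
                | ver_const \; *:%R},
    bijective phi /\
    forall g : 'M[k]_n, invertible g ->
      forall t, phi (Tor_act g t) = schur_act g (phi t).
Proof.
case: i i_gt0 => // i _; split=> [a t ha|].
  apply: (@tor_schur_inj _ _ _ _ _ d_gt0 r_gt0 r'_gt0).
  by rewrite semilinZ [GRing.RMorphism.sort _ _](ver_plus_const d_gt0 ha)
    scale0r raddf0.
rewrite -mkseq_rowlen; exists (tor_schur d_gt0 r_gt0 r'_gt0 (i := i)); split.
  exact: tor_schur_bij.
by move=> g _ t; apply: tor_schur_act.
Qed.
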